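(* Let $G\in\tilde L$, let $Y_\infty$ be the unique solution of the Birkhoff factorization of data $(\mathbb S^1,G)$, and let $\mathcal A(x)=\frac{dY_\infty}{dx}(x)\,Y_\infty(x)^{-1}$ for $x\in\mathbb P^1\setminus\mathbb S^1$. Then: (a) there exists a $C^1$ function $A:\mathbb S^1\to \mathrm M_N(\mathbb C)$ such that $$\mathcal A(x)=\frac1{2i\pi}\oint_{\mathbb S^1}\frac{A(\xi)}{\xi-x}\,d\xi\qquad (x\in\mathbb P^1\setminus\mathbb S^1).$$ In particular $\mathcal A$ is analytic on $\mathbb D^+$ and on $\mathbb D^-$, and $\mathcal A|_{\mathbb D^+}$ and $\mathcal A|_{\mathbb D^-}$ extend to $C^1$ functions on $\overline{\mathbb D^+}$ and $\overline{\mathbb D^-}$ respectively; (b) moreover $\oint_{\mathbb S^1}A(\xi)\,d\xi=0$, which is equivalent to the expansion of $\mathcal A$ at infinity satisfying $\mathcal A(x)=O(1/x^2)$ as $x\to\infty$.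
   Context: Notation. $\mathbb P^1=\mathbb C\cup\{\infty\}$; $\mathbb S^1$ is the unit circle; $\mathbb D^+$ is the open unit disk and $\mathbb D^-=\mathbb P^1\setminus\overline{\mathbb D^+}$. For a function $F$ on $\mathbb P^1\setminus\mathbb S^1$, $F^\pm(\xi)$ denote the non-tangential limits of $F(x)$ as $x\to\xi\in\mathbb S^1$ with $x\in\mathbb D^\pm$. Birkhoff factorization. For a loop $G:\mathbb S^1\to\mathrm{GL}_N(\mathbb C)$, the Birkhoff factorization of data $(\mathbb S^1,G)$ asks for an $N\times N$ matrix-valued function $Y$ on $\mathbb P^1\setminus\mathbb S^1$ which is analytic on $\mathbb D^+$ and $\mathbb D^-$, Hölder continuous up to the boundary on each of $\overline{\mathbb D^+}$, $\overline{\mathbb D^-}$, and satisfies $Y^+(\xi)=Y^-(\xi)G(\xi)$ for all $\xi\in\mathbb S^1$ and $Y(\infty)=\mathrm I_N$. Groups. $L=C^2(\mathbb S^1,\mathrm{GL}_N(\mathbb C))$; $L^+$ is the group of analytic maps $\mathbb D^+\to\mathrm{GL}_N(\mathbb C)$ which extend to $\mathbb S^1$ with boundary values in $L$; $L^-_0$ is the group of analytic maps $\mathbb D^-\to\mathrm{GL}_N(\mathbb C)$ which extend to $\mathbb S^1$ with boundary values in $L$ and take the value $\mathrm I_N$ at $\infty$. $\tilde L\subset L$ is the set of loops of the form $G=(Z^-)^{-1}Y^+$ on $\mathbb S^1$ with $Y\in L^+$, $Z\in L^-_0$. For $G\in\tilde L$ the Birkhoff factorization has a unique solution $Y_\infty$,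 and $Y_\infty|_{\mathbb D^+}\in L^+$, $Y_\infty|_{\mathbb D^-}\in L^-_0$. *)

(* Defs.v *)
From HB Require Import structures.
From mathcomp Require Import all_boot all_order all_algebra.
From mathcomp Require Import complex.
From mathcomp Require Import all_classical all_reals all_analysis.

Set Implicit Arguments.
Unset Strict Implicit.
Unset Printing Implicit Defensive.

Import Order.TTheory GRing.Theory Num.Theory.
Import numFieldNormedType.Exports.

Local Open Scope classical_set_scope.
Local Open Scope ring_scope.
Local Open Scope complex_scope.

(* R[i] is a numFieldType, but its topology, given by the modulus, is not
   attached by default to the type constructor [complex]. *)
HB.instance Definition _ (R : realType) :=
  PseudoPointedMetric.copy R[i] R[i]^o.
HB.instance Definition _ (R : realType) := GRing.ComAlgebra.copy R[i] R[i]^o.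
HB.instance Definition _ (R : realType) := Vector.copy R[i] R[i]^o.
HB.instance Definition _ (R : realType) := NormedModule.copy R[i] R[i]^o.

(* The Riemann sphere; [None] is the point at infinity. *)
Definition P1 (R : realType) : Type := option R[i].

Definition unit_circle (R : realType) : set R[i] := [set x | `|x| = 1].

Definition circle (R : realType) : set (P1 R) := Some @` @unit_circle R.

Definition Dplus (R : realType) : set (P1 R) :=
  [set p | match p with Some x => `|x| < 1 | None => False end].

Definition Dminus (R : realType) : set (P1 R) :=
  [set p | match p with Some x => 1 < `|x| | None => True end].

(* The local coordinate of the sphere centred at p: x - x0 at a finite point x0,
   and 1/x at infinity. *)
Definition coord (R : realType) (p : P1 R) (h : R[i]) : P1 R :=
  match p with
  | Some x => Some (x + h)
  | None => if h == 0 then None else Some h^-1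
  end.

Definition analytic_at (R : realType) (N : nat) (F : P1 R -> 'M[R[i]]_N)
    (p : P1 R) : Prop :=
  exists (a : nat -> 'M[R[i]]_N) (r : R), 0 < r /\
    forall h : R[i], `|h| < r%:C ->
      series (fun n => h ^+ n *: a n) @ \oo --> F (coord p h).

Definition analytic_on (R : realType) (N : nat) (D : set (P1 R))
    (F : P1 R -> 'M[R[i]]_N) : Prop :=
  forall p, D p -> analytic_at F p.

Definition chordal (R : realType) (p q : P1 R) : R :=
  let w (x : R[i]) : R := Num.sqrt (1 + Normc.normc x ^+ 2) in
  match p, q with
  | Some x, Some y => 2 * Normc.normc (x - y) / (w x * w y)
  | Some x, None | None, Some x => 2 / w x
  | None, None => 0
  end.

Definition holder_on (R : realType) (N : nat) (E : set (P1 R))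
    (F : P1 R -> 'M[R[i]]_N) : Prop :=
  exists a k : R, 0 < a <= 1 /\
    forall p q, E p -> E q -> `|F p - F q| <= (k * chordal p q `^ a)%:C.

(* For D = Dplus or Dminus, the closure of D is D together with the circle. *)
Definition holder_up_to_circle (R : realType) (N : nat) (D : set (P1 R))
    (F : P1 R -> 'M[R[i]]_N) : Prop :=
  exists Fb : P1 R -> 'M[R[i]]_N,
    (forall p, D p -> Fb p = F p) /\ holder_on (D `|` @circle R) Fb.

Definition stolz (R : realType) (xi : R[i]) (M : R) : set R[i] :=
  [set x | `|x - xi| <= M%:C * `|1 - `|x| | ].

Definition nontangential_limit (R : realType) (N : nat) (D : set (P1 R))
    (F : P1 R -> 'M[R[i]]_N) (xi : R[i]) (l : 'M[R[i]]_N) : Prop :=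
  forall M : R,
    F (Some x) @[x --> within ((Some @^-1` D) `&` stolz xi M) (nbhs xi)] --> l.

Definition cis (R : realType) (t : R) : R[i] := cos t +i* sin t.

Definition Ck (R : realType) (k : nat) (g : R -> R) : Prop :=
  (forall m, (m < k)%N -> forall t, derivable (derive1n m g) t 1) /\
  continuous (derive1n k g).

Definition Ck_circle (R : realType) (N k : nat) (f : R[i] -> 'M[R[i]]_N) :
    Prop :=
  forall i j : 'I_N,
    Ck k (fun t => complex.Re (f (cis t) i j)) /\
    Ck k (fun t => complex.Im (f (cis t) i j)).

(* Functions on the unit circle are represented by functions on R[i], of which
   only the values on the unit circle are ever used. *)
Definition in_L (R : realType) (N : nat) (G : R[i] -> 'M[R[i]]_N) : Prop :=
  Ck_circle 2 G /\ forall xi, unit_circle xi -> G xi \in unitmx.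

Definition boundary_values (R : realType) (N : nat) (D : set (P1 R))
    (F : P1 R -> 'M[R[i]]_N) (B : R[i] -> 'M[R[i]]_N) : Prop :=
  forall xi, unit_circle xi ->
    F (Some x) @[x --> within (Some @^-1` D) (nbhs xi)] --> B xi.

(* F represents an element of L^+ through its values on Dplus, and B is its
   boundary loop. *)
Definition in_Lplus (R : realType) (N : nat) (F : P1 R -> 'M[R[i]]_N)
    (B : R[i] -> 'M[R[i]]_N) : Prop :=
  [/\ analytic_on (@Dplus R) F, forall p, Dplus p -> F p \in unitmx,
      boundary_values (@Dplus R) F B & in_L B].

Definition in_Lminus0 (R : realType) (N : nat) (F : P1 R -> 'M[R[i]]_N)
    (B : R[i] -> 'M[R[i]]_N) : Prop :=
  [/\ analytic_on (@Dminus R) F, forall p, Dminus p -> F p \in unitmx,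
      boundary_values (@Dminus R) F B, in_L B & F None = 1%:M].

Definition in_Ltilde (R : realType) (N : nat) (G : R[i] -> 'M[R[i]]_N) :
    Prop :=
  in_L G /\
  exists (Y Z : P1 R -> 'M[R[i]]_N) (Yp Zm : R[i] -> 'M[R[i]]_N),
    [/\ in_Lplus Y Yp, in_Lminus0 Z Zm &
        forall xi, unit_circle xi -> G xi = invmx (Zm xi) *m Yp xi].

(* Only the values of Y off the circle matter. *)
Record birkhoff_solution (R : realType) (N : nat) (G : R[i] -> 'M[R[i]]_N)
    (Y : P1 R -> 'M[R[i]]_N) : Prop := {
  birkhoff_analytic_plus : analytic_on (@Dplus R) Y;
  birkhoff_analytic_minus : analytic_on (@Dminus R) Y;
  birkhoff_holder_plus : holder_up_to_circle (@Dplus R) Y;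
  birkhoff_holder_minus : holder_up_to_circle (@Dminus R) Y;
  birkhoff_jump : forall xi, unit_circle xi ->
    exists Yp Ym : 'M[R[i]]_N,
      [/\ nontangential_limit (@Dplus R) Y xi Yp,
          nontangential_limit (@Dminus R) Y xi Ym & Yp = Ym *m G xi];
  birkhoff_infty : Y None = 1%:M }.

Definition log_derivative_fin (R : realType) (N : nat)
    (Y : P1 R -> 'M[R[i]]_N) (x : R[i]) : 'M[R[i]]_N :=
  derive1 (fun z : R[i] => Y (Some z)) x *m invmx (Y (Some x)).

(* The value at infinity of Y' Y^-1 is its limit there. *)
Definition log_derivative (R : realType) (N : nat) (Y : P1 R -> 'M[R[i]]_N)
    (p : P1 R) : 'M[R[i]]_N :=
  match p with
  | Some x => log_derivative_fin Y x
  | None => lim (log_derivative_fin Y w^-1 @[w --> (0 : R[i])^'])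
  end.

Definition complex_integral (R : realType) (D : set R) (g : R -> R[i]) : R[i] :=
  (\int[lebesgue_measure]_(t in D) complex.Re (g t))%R +i*
  (\int[lebesgue_measure]_(t in D) complex.Im (g t))%R.

(* xi = cis t, d xi = i cis t dt, with 0 <= t <= 2 pi. *)
Definition circle_integral (R : realType) (N : nat)
    (f : R[i] -> 'M[R[i]]_N) : 'M[R[i]]_N :=
  \matrix_(i, j) complex_integral `[0, 2 * pi]
    (fun t => f (cis t) i j * ('i%C * cis t)).

Definition cauchy_kernel (R : realType) (xi : R[i]) (p : P1 R) : R[i] :=
  match p with Some x => (xi - x)^-1 | None => 0 end.

Definition cauchy_integral (R : realType) (N : nat)
    (A : R[i] -> 'M[R[i]]_N) (p : P1 R) : 'M[R[i]]_N :=
  ((2 * pi)%:C * 'i%C)^-1 *: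
    circle_integral (fun xi => cauchy_kernel xi p *: A xi).

Definition closed_disk (R : realType) : set R[i] := [set z | `|z| <= 1].

(* Real C^1 functions on the closed disk, boundary included: P and Q are the
   partial derivatives in the real and imaginary directions, and
   differentiability at z is relative to the closed disk. *)
Definition C1_closed_disk (R : realType) (N : nat) (f : R[i] -> 'M[R[i]]_N) :
    Prop :=
  exists P Q : R[i] -> 'M[R[i]]_N,
    [/\ {within @closed_disk R, continuous P},
        {within @closed_disk R, continuous Q} &
        forall z, closed_disk z -> forall e : R, 0 < e ->
          \forall y \near within (@closed_disk R) (nbhs z),
            `|f y - f z - (complex.Re (y - z))%:C *: P z
                        - (complex.Im (y - z))%:C *: Q z|
              <= e%:C * `|y - z|].

Definition C1_extends_plus (R : realType) (N : nat)
    (F : P1 R -> 'M[R[i]]_N) : Prop :=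
  exists Fb : P1 R -> 'M[R[i]]_N,
    (forall p, Dplus p -> Fb p = F p) /\
    C1_closed_disk (fun z => Fb (Some z)).

(* The coordinate w = 1/x identifies the closure of Dminus with the closed
   disk. *)
Definition C1_extends_minus (R : realType) (N : nat)
    (F : P1 R -> 'M[R[i]]_N) : Prop :=
  exists Fb : P1 R -> 'M[R[i]]_N,
    (forall p, Dminus p -> Fb p = F p) /\
    C1_closed_disk (fun w => Fb (coord None w)).

Definition bigO_inv_sqr_at_infty (R : realType) (N : nat)
    (F : P1 R -> 'M[R[i]]_N) : Prop :=
  exists k r : R, forall x : R[i],
    r%:C < `|x| -> `|F (Some x)| <= k%:C / `|x| ^+ 2.

(* Main.v *)
Require Import Defs.
From mathcomp Require Import all_boot all_order all_algebra.
From mathcomp Require Import complex.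
From mathcomp Require Import all_classical all_reals all_analysis.
From mathcomp Require Import ring lra.

Set Implicit Arguments.
Unset Strict Implicit.
Unset Printing Implicit Defensive.

Import Order.TTheory GRing.Theory Num.Theory.
Import numFieldNormedType.Exports.

Local Open Scope classical_set_scope.
Local Open Scope ring_scope.
Local Open Scope complex_scope.

(**
Uniqueness in the Birkhoff factorization identifies Y with the given factors
Y0 and Z: the quotients Y Y0^-1 and Y Z^-1 are continuous up to the circle and
agree there, and Cauchy's formula forces functions glued in this way to be
constant.  If the boundary loop of a function f analytic in the disk is C^2,
the difference quotients of f under rotations converge uniformly on the circle,
hence on the disk by the maximum principle, so f' and then f'' extend
continuously to the closed disk.  Therefore Y' Y^-1 is C^1 up to the circle on
both sides, and Cauchy's formula inside and outside shows that it is the Cauchy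
integral of its jump A.  The exterior part is - w^2 Z'(w) Z(w)^-1 in the
coordinate w = 1/x, which vanishes to second order at infinity and has no
residue there.
*)

(** Everything is brought to the closed unit disk: the exterior is read in w = 1/x, so one class of
    functions and one regularity theorem serve both sides, and only the orientation of the boundary
    loop changes. The functions at hand are merely continuous at the circle, so Cauchy's formula is
    proved on the unit circle itself by contracting it to a point. The derivative in the contraction
    parameter is taken at interior points only, where it is also a derivative along the closed curve
    and therefore integrates to 0; at the outermost stage continuity suffices.

    The boundary is the obstacle. Since Y' Y^-1 has to be C^1 up to the circle, two derivatives of Y
    must extend continuously, while the hypotheses only differentiate along the boundary loop.
    Rotations preserve the disk and the circle, so their difference quotients stay in the same class
    and can be compared by their boundary values; their limit is i z f'(z), and each round uses up
    one derivative of the loop, whence C^2. Matrices are treated entry by entry, with Cramer's rule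
    for inverses. *)

Local Notation nm := Normc.normc.

(** * The real-valued modulus and the parametrization of the circle *)

Section Modulus.
Context (R : realType).
Implicit Types (x y z : R[i]) (a b : R).

Lemma nmE z : `|z| = (nm z)%:C.
Proof. by rewrite normc_def; case: z. Qed.

Lemma nm_ge0 z : 0 <= nm z.
Proof. by case: z => a b; exact: sqrtr_ge0. Qed.

Lemma nm0 : nm (0 : R[i]) = 0.
Proof. exact: Normc.normc0. Qed.

Lemma nm1 : nm (1 : R[i]) = 1.
Proof. exact: Normc.normc1. Qed.

Lemma nmM x y : nm (x * y) = nm x * nm y.
Proof. exact: Normc.normcM. Qed.

Lemma nmV x : nm x^-1 = (nm x)^-1.
Proof. exact: Normc.normcV. Qed.

Lemma nmD x y : nm (x + y) <= nm x + nm y.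
Proof. exact: le_normcD. Qed.

Lemma nmN x : nm (- x) = nm x.
Proof. exact: normcN. Qed.

Lemma nmC x y : nm (x - y) = nm (y - x).
Proof. by rewrite -nmN opprB. Qed.

Lemma nmB x y : nm (x - y) <= nm x + nm y.
Proof. by rewrite -(nmN y); exact: nmD. Qed.

Lemma nm_tri x y z : nm (x - z) <= nm (x - y) + nm (y - z).
Proof. by apply: le_trans (nmD _ _); rewrite addrA subrK. Qed.

Lemma nm_dist x y : `|nm x - nm y| <= nm (x - y).
Proof.
have := nmD (x - y) y; have := nmD (y - x) x; rewrite !subrK (nmC y x).
by move=> h1 h2; rewrite ler_norml; lra.
Qed.

Lemma nmX x n : nm (x ^+ n) = nm x ^+ n.
Proof. by elim: n => [|n IH]; rewrite ?expr0 ?nm1// !exprS nmM IH. Qed.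

Lemma nm_eq0 x : (nm x == 0) = (x == 0).
Proof. by apply/eqP/eqP => [/Normc.eq0_normc//|->]; rewrite nm0. Qed.

Lemma nm_gt0 x : (0 < nm x) = (x != 0).
Proof. by rewrite lt_def nm_eq0 nm_ge0 andbT. Qed.

Lemma nmR a : nm a%:C = `|a|.
Proof. by rewrite /= expr0n addr0 sqrtr_sqr. Qed.

Lemma nm_i : nm ('i : R[i]) = 1.
Proof. by rewrite /= expr0n expr1n add0r sqrtr1. Qed.

Lemma nm_Re z : `|complex.Re z| <= nm z.
Proof.
case: z => a b /=; rewrite -sqrtr_sqr ler_wsqrtr// lerDl; exact: sqr_ge0.
Qed.

Lemma nm_Im z : `|complex.Im z| <= nm z.
Proof.
case: z => a b /=; rewrite -sqrtr_sqr ler_wsqrtr// lerDr; exact: sqr_ge0.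
Qed.

Lemma nm_ReIm z : nm z <= `|complex.Re z| + `|complex.Im z|.
Proof.
rewrite {1}(complexE z); apply: le_trans (nmD _ _) _.
by rewrite nmM nm_i mul1r !nmR.
Qed.

Lemma reD x y : complex.Re (x + y) = complex.Re x + complex.Re y.
Proof. by case: x; case: y. Qed.
Lemma imD x y : complex.Im (x + y) = complex.Im x + complex.Im y.
Proof. by case: x; case: y. Qed.
Lemma reN x : complex.Re (- x) = - complex.Re x.
Proof. by case: x. Qed.
Lemma imN x : complex.Im (- x) = - complex.Im x.
Proof. by case: x. Qed.
Lemma reM x y : complex.Re (x * y) =
  complex.Re x * complex.Re y - complex.Im x * complex.Im y.
Proof. by case: x; case: y. Qed.
Lemma imM x y : complex.Im (x * y) =
  complex.Re x * complex.Im y + complex.Im x * complex.Re y.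
Proof. by case: x; case: y. Qed.

Lemma nm_cis a : nm (cis a) = 1.
Proof. by rewrite /cis /= cos2Dsin2 sqrtr1. Qed.

Lemma cis_neq0 a : cis a != 0 :> R[i].
Proof. by rewrite -nm_gt0 nm_cis. Qed.

Lemma cis0 : cis 0 = 1 :> R[i].
Proof. by rewrite /cis cos0 sin0. Qed.

Lemma cisD a b : cis (a + b) = cis a * cis b.
Proof.
rewrite /cis cosD sinD; apply/eqP; rewrite eq_complex /=; apply/andP; split => //.
by apply/eqP; ring.
Qed.

Lemma cisN a : cis (- a) = (cis a)^-1.
Proof.
apply: (mulfI (cis_neq0 a)); rewrite -cisD subrr cis0 divff//; exact: cis_neq0.
Qed.

Lemma cis2pi : cis (2 * pi) = 1 :> R[i].
Proof. by rewrite /cis mulrC mulr_natr cos2pi sin2pi. Qed.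

Lemma nm_lt1 z : (`|z| < 1) = (nm z < 1).
Proof. by rewrite nmE (_ : 1 = 1%:C)// ltcR. Qed.
Lemma nm_gt1 z : (1 < `|z|) = (1 < nm z).
Proof. by rewrite nmE (_ : 1 = 1%:C)// ltcR. Qed.
Lemma nm_le1 z : (`|z| <= 1) = (nm z <= 1).
Proof. by rewrite nmE (_ : 1 = 1%:C)// lecR. Qed.
Lemma nm_eq1 z : (`|z| = 1) <-> (nm z = 1).
Proof. by rewrite nmE; split => [[]|->]. Qed.

(** The angle is [acos a] or [2 * pi - acos a], according to the sign of the imaginary part. Keeping
    it in [[0, 2 * pi]] lets estimates that are uniform on this compact segment cover the whole
    circle. *)
Lemma cis_surj z : nm z = 1 -> exists2 t, t \in `[0, 2 * pi]%R & z = cis t.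
Proof.
case: z => a b /= h; have {}h : a ^+ 2 + b ^+ 2 = 1.
  by rewrite -[LHS]sqr_sqrtr ?addr_ge0 ?sqr_ge0// h expr1n.
have a1 : -1 <= a <= 1.
  by move: (sqr_ge0 b) => hb; apply/andP; split; nra.
have hs : b ^+ 2 = sin (acos a) ^+ 2 by rewrite sin2cos2 acosK//; lra.
have [s0 s1] := (acos_ge0 a1, acos_lepi a1).
have ps : 0 <= sin (acos a) by apply: sin_ge0_pi; rewrite s0.
move/eqP: hs; rewrite eqf_sqr => /orP[/eqP ->|/eqP ->].
  exists (acos a); last by rewrite /cis acosK.
  by rewrite in_itv /= s0 /=; move: s1 (pi_ge0 R); lra.
exists (2 * pi - acos a).
  by rewrite in_itv /=; move: s0 s1 (pi_ge0 R); lra.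
have -> : 2 * pi - acos a = - acos a + pi *+ 2 by rewrite mulr_natl addrC.
by rewrite /cis cosD2pi sinD2pi cosN sinN acosK.
Qed.

End Modulus.

(** * Limits of complex-valued functions along a filter *)

Section Limits.
Context (R : realType) (T : Type).
Implicit Types (F : set_system T) (f g : T -> R[i]) (a b : R[i]).

(** Stated through the real modulus, so that limits reduce to real squeezing; [cv_within_nb] and
    [cv_mxP] translate to the topology of [R[i]] and of matrices. *)
Definition cv F f a := (fun x => nm (f x - a)) @ F --> (0 : R).

Lemma cvP F {FF : Filter F} f a :
  cv F f a <-> forall e : R, 0 < e -> \forall x \near F, nm (f x - a) < e.
Proof.
split => [/cvgr0Pnorm_lt h e /h|h].
  by apply: filterS => x; rewrite ger0_norm// nm_ge0.
apply/cvgr0Pnorm_lt => e /h.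
by apply: filterS => x; rewrite ger0_norm// nm_ge0.
Qed.

Lemma cv_le F {FF : Filter F} f a (u : T -> R) :
  (\forall x \near F, nm (f x - a) <= u x) -> u @ F --> (0 : R) -> cv F f a.
Proof.
move=> h hu; apply: (squeeze_cvgr (f := fun=> 0) (h := u)) => //.
- by apply: filterS h => x ->; rewrite nm_ge0.
- exact: cvg_cst.
Qed.

Lemma cv_near F {FF : Filter F} f g a :
  (\forall x \near F, f x = g x) -> cv F f a -> cv F g a.
Proof. by move=> h; apply: cv_le; apply: filterS h => x ->. Qed.

Lemma cv_cst F {FF : Filter F} a : cv F (fun=> a) a.
Proof. by rewrite /cv subrr nm0; exact: cvg_cst. Qed.

Lemma cvD F {FF : Filter F} f g a b :
  cv F f a -> cv F g b -> cv F (fun x => f x + g x) (a + b).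
Proof.
move=> hf hg; apply: (cv_le (u := fun x => nm (f x - a) + nm (g x - b))).
  by apply: nearW => x; rewrite opprD addrACA nmD.
by rewrite -[X in _ --> X](addr0 0); exact: cvgD.
Qed.

Lemma cvN F {FF : Filter F} f a : cv F f a -> cv F (fun x => - f x) (- a).
Proof.
by move=> hf; apply: cv_le hf; apply: nearW => x; rewrite -opprD nmN.
Qed.

Lemma cvB F {FF : Filter F} f g a b :
  cv F f a -> cv F g b -> cv F (fun x => f x - g x) (a - b).
Proof. by move=> hf hg; apply: cvD => //; exact: cvN. Qed.

Lemma cvM F {FF : Filter F} f g a b :
  cv F f a -> cv F g b -> cv F (fun x => f x * g x) (a * b).
Proof.
move=> hf hg; pose u x := nm (f x - a); pose v x := nm (g x - b).
apply: (cv_le (u := fun x => u x * v x + u x * nm b + nm a * v x)).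
  apply: nearW => x; rewrite /u /v -!nmM.
  have -> : f x * g x - a * b =
    (f x - a) * (g x - b) + (f x - a) * b + a * (g x - b) by ring.
  by apply: le_trans (nmD _ _) _; rewrite lerD2r; exact: nmD.
have -> : (0 : R) = 0 * 0 + 0 * nm b + nm a * 0 by ring.
by apply: cvgD; [apply: cvgD|]; apply: cvgM => //; exact: cvg_cst.
Qed.

Lemma cv_norm F {FF : Filter F} f a :
  cv F f a -> (fun x => nm (f x)) @ F --> nm a.
Proof.
move=> hf; apply/cvgrPdist_lt => e e0; move/cvP: hf => /(_ e e0).
by apply: filterS => x; apply: le_lt_trans; rewrite distrC nm_dist.
Qed.

Lemma cvV F {FF : Filter F} f a :
  a != 0 -> cv F f a -> cv F (fun x => (f x)^-1) a^-1.
Proof.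
move=> a0 hf; have na : 0 < nm a by rewrite nm_gt0.
have near0 : \forall x \near F, nm a / 2 < nm (f x).
  by apply: (cvgr_gt _ (cv_norm hf)); lra.
apply: (cv_le (u := fun x => nm (f x - a) * (2 / nm a ^+ 2))).
  apply: filterS near0 => x hx.
  have fx0 : f x != 0 by rewrite -nm_gt0; apply: lt_trans hx; lra.
  have -> : (f x)^-1 - a^-1 = - (f x - a) * ((f x)^-1 * a^-1).
    by field; rewrite fx0 a0.
  rewrite !nmM nmN !nmV ler_wpM2l ?nm_ge0//.
  rewrite -invfM -(invrK 2) -invfM lef_pV2 ?posrE; last 2 first.
  - by rewrite mulr_gt0 ?nm_gt0.
  - by rewrite mulr_gt0 ?invr_gt0// exprn_gt0.
  by rewrite expr2 mulrA ler_wpM2r// ?ltW// mulrC.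
rewrite -[X in _ --> X](mul0r (2 / nm a ^+ 2)).
by apply: cvgM => //; exact: cvg_cst.
Qed.

Lemma cv_unique F {FF : ProperFilter F} f a b : cv F f a -> cv F f b -> a = b.
Proof.
move=> ha hb; apply/eqP; rewrite -subr_eq0 -nm_eq0 eq_le nm_ge0 andbT.
rewrite leNgt; apply/negP => ab; pose e := nm (a - b) / 2.
have e0 : 0 < e by rewrite /e; lra.
have [x [h1 h2]] : exists x, nm (f x - a) < e /\ nm (f x - b) < e.
  apply: (@filter_ex _ F); apply: filterI.
    by move/cvP: ha; exact.
  by move/cvP: hb; exact.
have := nm_tri a (f x) b; rewrite (nmC a (f x)); rewrite /e in h1 h2; lra.
Qed.

Lemma cv_le_bound F {FF : ProperFilter F} f a (M : R) :
  (\forall x \near F, nm (f x) <= M) -> cv F f a -> nm a <= M.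
Proof.
move=> h hf; rewrite leNgt; apply/negP => aM.
have [x [h1 h2]] : exists x, nm (f x) <= M /\ nm (f x - a) < nm a - M.
  apply: (@filter_ex _ F); apply: filterI => //.
  by move/cvP: hf; apply; rewrite subr_gt0.
have := nmB (f x) (f x - a).
by rewrite opprB addrC subrK; lra.
Qed.

Lemma cv_Re F {FF : Filter F} f a :
  cv F f a -> (fun x => complex.Re (f x)) @ F --> complex.Re a.
Proof.
move=> hf; apply/cvgrPdist_lt => e e0; move/cvP: hf => /(_ e e0).
apply: filterS => x; apply: le_lt_trans; rewrite distrC -reN -reD; exact: nm_Re.
Qed.

Lemma cv_Im F {FF : Filter F} f a :
  cv F f a -> (fun x => complex.Im (f x)) @ F --> complex.Im a.
Proof.
move=> hf; apply/cvgrPdist_lt => e e0; move/cvP: hf => /(_ e e0).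
apply: filterS => x; apply: le_lt_trans; rewrite distrC -imN -imD; exact: nm_Im.
Qed.

Lemma cv_ReIm F {FF : Filter F} f a :
  (fun x => complex.Re (f x)) @ F --> complex.Re a ->
  (fun x => complex.Im (f x)) @ F --> complex.Im a -> cv F f a.
Proof.
move=> h1 h2; apply/cvP => e e0.
have e2 : 0 < e / 2 by lra.
move/cvgrPdist_lt: h1 => /(_ _ e2) h1; move/cvgrPdist_lt: h2 => /(_ _ e2) h2.
apply: filterS2 h1 h2 => x; rewrite distrC (distrC (complex.Im a)) => h1 h2.
by apply: le_lt_trans (nm_ReIm _) _; rewrite reD imD reN imN; lra.
Qed.

End Limits.

(** * Relative neighbourhoods and derivatives in Caratheodory's form *)

Section Derivatives.
Context (R : realType).

(** The centre is not removed: for z in S, convergence of f along [nb S z] forces the limit to be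
    [f z]. *)
Definition nb (S : set R[i]) (z : R[i]) : set_system R[i] :=
  filter_from [set d : R | 0 < d] (fun d => [set y | S y /\ nm (y - z) < d]).

#[global] Instance nb_filter S z : Filter (nb S z).
Proof.
apply: filter_from_filter; first by exists 1 => /=; exact: ltr01.
move=> a b /= a0 b0; exists (Num.min a b); first by rewrite /= lt_min a0.
by move=> y /= [Sy]; rewrite lt_min => /andP[ha hb]; split.
Qed.

Lemma nb_in S z : \forall y \near nb S z, S y.
Proof. by exists 1 => [|y []] //=; exact: ltr01. Qed.

Lemma nb_lt S z (d : R) : 0 < d -> \forall y \near nb S z, nm (y - z) < d.
Proof. by exists d => [|y []]. Qed.

Lemma cv_id (S : set R[i]) z : cv (nb S z) id z.
Proof. by apply/cvP => e e0; exact: nb_lt. Qed.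

Lemma nbS (S S' : set R[i]) z (r : R) : 0 < r ->
  (forall y, nm (y - z) < r -> S y -> S' y) -> nb S' z `<=` nb S z.
Proof.
move=> r0 h A [d /= d0 hd]; exists (Num.min d r); first by rewrite /= lt_min d0.
by move=> y /= [Sy]; rewrite lt_min => /andP[yd yr]; apply: hd; split => //; exact: h.
Qed.

Lemma cv_comp T (F : set_system T) {FF : Filter F} (S : set R[i])
    (f : R[i] -> R[i]) (g : T -> R[i]) a b :
  cv (nb S a) f b -> cv F g a -> (\forall x \near F, S (g x)) ->
  cv F (fun x => f (g x)) b.
Proof.
move=> /cvP hf /cvP hg hS; apply/cvP => e /hf [d /= d0 hd].
by apply: filterS2 (hg _ d0) hS => x h1 h2; apply: hd.
Qed.

(* The derivative of f at p with respect to u along F, in Caratheodory's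
   form: f - f p factors through u - u p with a factor tending to d. *)
Definition der T (F : set_system T) (u : T -> R[i]) (p : T) (f : T -> R[i])
    (d : R[i]) :=
  exists2 q : T -> R[i], cv F q d &
    \forall x \near F, f x - f p = q x * (u x - u p).

Section Algebra.
Context (T : Type) (F : set_system T) {FF : Filter F} (u : T -> R[i]) (p : T).
Implicit Types (f g : T -> R[i]) (d e : R[i]).

Lemma der_near f g d : f p = g p -> (\forall x \near F, f x = g x) ->
  der F u p f d -> der F u p g d.
Proof.
move=> fg h [q hq e]; exists q => //.
by apply: filterS2 h e => x <-; rewrite fg.
Qed.

Lemma der_cst a : der F u p (fun=> a) 0.
Proof.
exists (fun=> 0); first exact: cv_cst.
by apply: nearW => x; rewrite subrr mul0r.
Qed.

Lemma der_self : der F u p u 1.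
Proof.
exists (fun=> 1); first exact: cv_cst.
by apply: nearW => x; rewrite mul1r.
Qed.

Lemma derD f g d e : der F u p f d -> der F u p g e ->
  der F u p (fun x => f x + g x) (d + e).
Proof.
move=> [q hq eq] [r hr er]; exists (fun x => q x + r x); first exact: cvD.
by apply: filterS2 eq er => x h1 h2; rewrite opprD addrACA h1 h2 mulrDl.
Qed.

Lemma derN f d : der F u p f d -> der F u p (fun x => - f x) (- d).
Proof.
move=> [q hq eq]; exists (fun x => - q x); first exact: cvN.
by apply: filterS eq => x h; rewrite -opprD h mulNr.
Qed.

Lemma derB f g d e : der F u p f d -> der F u p g e ->
  der F u p (fun x => f x - g x) (d - e).
Proof. by move=> h1 h2; apply: derD => //; exact: derN. Qed.

Hypothesis cu : cv F u (u p).

Lemma der_cv f d : der F u p f d -> cv F f (f p).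
Proof.
move=> [q hq eq].
apply: (@cv_near _ _ _ _ (fun x => q x * (u x - u p) + f p)).
  by apply: filterS eq => x <-; rewrite subrK.
rewrite -[X in cv _ _ X]add0r -(mulr0 d) -(subrr (u p)).
apply: cvD; last exact: cv_cst.
by apply: cvM => //; apply: cvB => //; exact: cv_cst.
Qed.

Lemma derM f g d e : der F u p f d -> der F u p g e ->
  der F u p (fun x => f x * g x) (d * g p + f p * e).
Proof.
move=> hf hg; have cg := der_cv hg; move: hf hg => [q hq eq] [r hr er].
exists (fun x => q x * g x + f p * r x).
  by apply: cvD; apply: cvM => //; exact: cv_cst.
apply: filterS2 eq er => x h1 h2.
have -> : f x * g x - f p * g p = (f x - f p) * g x + f p * (g x - g p) by ring.
by rewrite h1 h2; ring.
Qed.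

Lemma derZ a f d : der F u p f d -> der F u p (fun x => a * f x) (a * d).
Proof. by move=> hf; have := derM (der_cst a) hf; rewrite mul0r add0r. Qed.

Lemma derV f d : f p != 0 -> der F u p f d ->
  der F u p (fun x => (f x)^-1) (- d / f p ^+ 2).
Proof.
move=> f0 hf; have cf := der_cv hf; move: hf => [q hq eq].
exists (fun x => - q x * ((f x)^-1 * (f p)^-1)).
  rewrite expr2 invfM; apply: cvM; first exact: cvN.
  by apply: cvM; [exact: cvV|exact: cv_cst].
have fx0 : \forall x \near F, f x != 0.
  have np : 0 < nm (f p) by rewrite nm_gt0.
  suff : \forall x \near F, 0 < nm (f x).
    by apply: filterS => x; rewrite nm_gt0.
  exact: (cvgr_gt _ (cv_norm cf)).
apply: filterS2 eq fx0 => x h1 h2.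
have -> : (f x)^-1 - (f p)^-1 = - (f x - f p) * ((f x)^-1 * (f p)^-1).
  by field; rewrite h2 f0.
by rewrite h1; ring.
Qed.

Lemma derX f d n : der F u p f d ->
  der F u p (fun x => f x ^+ n) (n%:R * f p ^+ n.-1 * d).
Proof.
move=> hf; elim: n => [|n IH].
  have -> : (fun x => f x ^+ 0) = fun=> 1 by apply/funext => x; rewrite expr0.
  by rewrite !mul0r; exact: der_cst.
have -> : (fun x => f x ^+ n.+1) = fun x => f x * f x ^+ n.
  by apply/funext => x; rewrite exprS.
suff -> : n.+1%:R * f p ^+ n.+1.-1 * d = d * f p ^+ n + f p * (n%:R * f p ^+ n.-1 * d).
  exact: derM.
by case: n {IH} => [|n] /=; rewrite ?expr0 ?exprS -?natr1; ring.
Qed.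

(** The factors of f and g multiply. In Caratheodory's form the points where [g x = g p] need no
    separate treatment. *)
Lemma der_comp (S : set R[i]) (f : R[i] -> R[i]) g d e :
  der (nb S (g p)) id (g p) f e -> der F u p g d ->
  (\forall x \near F, S (g x)) -> der F u p (fun x => f (g x)) (e * d).
Proof.
move=> [r hr er] hg hS; have cg := der_cv hg; move: hg => [q hq eq].
exists (fun x => r (g x) * q x).
  by apply: cvM => //; exact: (cv_comp hr).
have [k /= k0 hk] := er; move/cvP: cg => /(_ _ k0).
apply: filterS3 eq hS => x h1 h2 h3.
by have /= -> := hk _ (conj h2 h3); rewrite h1 mulrA.
Qed.

End Algebra.
End Derivatives.

(** * Complex-valued functions of a real parameter *)

Section Curves.
Context (R : realType).
Implicit Types (c g : R -> R[i]) (t : R).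

Definition ccont g := forall t, cv (nbhs t) g (g t).

Definition cder c t (d : R[i]) := der (nbhs t) (fun s => s%:C) t c d.

Lemma cv_real t : cv (nbhs t) (fun s : R => s%:C) t%:C.
Proof.
apply/cvP => e e0.
have : \forall s \near t, `|t - s| < e by apply: (@cvgr_dist_lt _ _ _ (nbhs t)).
by apply: filterS => s; rewrite -rmorphB /= distrC -nmR.
Qed.

Lemma ccont_cst (a : R[i]) : ccont (fun=> a).
Proof. by move=> t; exact: cv_cst. Qed.

Lemma ccontD c g : ccont c -> ccont g -> ccont (fun t => c t + g t).
Proof. by move=> h1 h2 t; exact: cvD. Qed.

Lemma ccontM c g : ccont c -> ccont g -> ccont (fun t => c t * g t).
Proof. by move=> h1 h2 t; exact: cvM. Qed.

Lemma ccontN c : ccont c -> ccont (fun t => - c t).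
Proof. by move=> h1 t; exact: cvN. Qed.

Lemma ccontV c : (forall t, c t != 0) -> ccont c -> ccont (fun t => (c t)^-1).
Proof. by move=> h0 h1 t; exact: cvV (h0 t) (h1 t). Qed.

Lemma cder_cont c g : (forall t, cder c t (g t)) -> ccont c.
Proof. by move=> h t; apply: (der_cv (cv_real t) (h t)). Qed.

Lemma ccont_Re g : ccont g -> continuous (fun t => complex.Re (g t)).
Proof. by move=> h t; exact (cv_Re (h t)). Qed.

Lemma ccont_Im g : ccont g -> continuous (fun t => complex.Im (g t)).
Proof. by move=> h t; exact (cv_Im (h t)). Qed.

Lemma shift_cvg t : (fun h : R => h + t) @ 0^' --> t.
Proof.
have h0 : (fun h : R => h) @ 0^' --> (0 : R).
  by apply: cvg_within_filter; exact: cvg_id.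
have h1 : (fun h : R => h + t) @ 0^' --> 0 + t.
  by apply: cvgD => //; exact: cvg_cst.
by rewrite add0r in h1.
Qed.

Lemma caratheodory_is_derive (f q : R -> R) t (d : R) : q @ t --> d ->
  (\forall s \near t, f s - f t = q s * (s - t)) -> is_derive t 1 f d.
Proof.
move=> hq e.
have H : h^-1 *: (f (h *: 1 + t) - f t) @[h --> 0^'] --> d.
  have := cvg_comp _ _ (@shift_cvg t) hq; apply: cvg_trans; apply: near_eq_cvg.
  have h0 : \forall h \near 0^', h != 0 :> R by exact: nbhs_dnbhs_neq.
  have e' : \forall h \near 0^', f (h + t) - f t = q (h + t) * (h + t - t).
    exact (@shift_cvg t _ e).
  apply: filterS2 h0 e' => h hn /=; rewrite addrK => eh.
  by rewrite /= [h *: 1]mulr1 eh [_ *: _]mulrC mulfK.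
by apply: DeriveDef; [apply/cvg_ex; exists d|exact/cvg_lim].
Qed.

Lemma is_derive_caratheodory (f : R -> R) t (d : R) : is_derive t 1 f d ->
  (fun s => if s == t then d else (f s - f t) / (s - t)) @ t --> d.
Proof.
move=> [h1 <-]; apply/cvgrPdist_lt => e e0.
move/cvgrPdist_lt: h1 => /(_ _ e0) [r /= r0 hr].
exists r => //= s /= st; case: ifP => [_|/negbT ns]; first by rewrite subrr normr0.
have := hr (s - t); rewrite /= sub0r normrN distrC subr_eq0 => /(_ st ns).
by rewrite [_ *: 1]mulr1 subrK [_ *: _]mulrC.
Qed.

Lemma cder_Re c t d : cder c t d ->
  is_derive t 1 (fun s => complex.Re (c s)) (complex.Re d).
Proof.
move=> [q hq e]; apply: (caratheodory_is_derive (cv_Re hq)).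
apply: filterS e => s e; rewrite -reN -reD e reM -rmorphB /=; ring.
Qed.

Lemma cder_Im c t d : cder c t d ->
  is_derive t 1 (fun s => complex.Im (c s)) (complex.Im d).
Proof.
move=> [q hq e]; apply: (caratheodory_is_derive (cv_Im hq)).
apply: filterS e => s e; rewrite -imN -imD e imM -rmorphB /=; ring.
Qed.

Lemma cder_ReIm c t a b : is_derive t 1 (fun s => complex.Re (c s)) a ->
  is_derive t 1 (fun s => complex.Im (c s)) b -> cder c t (a +i* b).
Proof.
move=> /is_derive_caratheodory h1 /is_derive_caratheodory h2.
exists (fun s => if s == t then a +i* b else (c s - c t) / (s - t)%:C).
  apply: cv_ReIm => /=.
    apply: cvg_trans h1; apply: near_eq_cvg; apply: nearW => s; case: ifP => // ns.
    by rewrite -fmorphV reM /= mulr0 subr0 reD reN.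
  apply: cvg_trans h2; apply: near_eq_cvg; apply: nearW => s; case: ifP => // ns.
  by rewrite -fmorphV imM /= mulr0 add0r imD imN.
apply: nearW => s; case: eqP => [->|/eqP ns]; first by rewrite !subrr mulr0.
by rewrite -rmorphB divfK//= fmorph_eq0 subr_eq0.
Qed.

Lemma cder_cis t : cder (@cis R) t ('i * cis t).
Proof.
have -> : 'i * cis t = (- sin t) +i* cos t :> R[i].
  by apply/eqP; rewrite eq_complex /=; apply/andP; split; apply/eqP; ring.
exact: cder_ReIm.
Qed.

Lemma cder_cisM (a t : R) : cder (fun s => cis (a * s)) t (a%:C * 'i * cis (a * t)).
Proof.
have -> : a%:C * 'i * cis (a * t) = (- (a * sin (a * t))) +i* (a * cos (a * t)) :> R[i].
  by apply/eqP; rewrite eq_complex /=; apply/andP; split; apply/eqP; ring.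
have da : is_derive t 1 (fun s => a * s) a.
  by have := is_deriveZ a (is_derive_id t 1); rewrite [_ *: _]mulr1.
apply: cder_ReIm => /=.
  by apply: (is_derive_eq (is_derive1_comp (is_derive_cos (a * t)) da)); ring.
by apply: (is_derive_eq (is_derive1_comp (is_derive_sin (a * t)) da)); ring.
Qed.

Lemma ccont_cisM (a : R) : ccont (fun s => cis (a * s)).
Proof. exact: cder_cont (cder_cisM a). Qed.

Lemma ccont_cis : ccont (@cis R).
Proof. exact: cder_cont cder_cis. Qed.

End Curves.

(** * Integrals over one period *)

Section CircleIntegrals.
Context (R : realType).
Implicit Types (g h : R -> R[i]) (t : R).

Definition cI g := complex_integral `[0, 2 * pi] g.

Let I : set R := `[0, 2 * pi].
Let mI : measurable I. Proof. exact: measurable_itv. Qed.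
Let pos : (0 : R) < 2 * pi. Proof. by have := pi_gt0 R; lra. Qed.

Lemma int_cont (f : R -> R) : continuous f ->
  lebesgue_measure.-integrable I (EFin \o f).
Proof.
move=> cf; apply: continuous_compact_integrable; first exact: segment_compact.
exact: continuous_subspaceT.
Qed.

Lemma eq_cI g h : (forall t, t \in `[0, 2 * pi]%R -> g t = h t) -> cI g = cI h.
Proof.
move=> e; rewrite /cI /complex_integral.
by congr (_ +i* _); apply: eq_Rintegral => t; rewrite inE => /e ->.
Qed.

Lemma cID g h : ccont g -> ccont h -> cI (fun t => g t + h t) = cI g + cI h.
Proof.
move=> cg ch; rewrite /cI /complex_integral.
transitivity ((\int[lebesgue_measure]_(t in I) (complex.Re (g t) + complex.Re (h t)))
  +i* (\int[lebesgue_measure]_(t in I) (complex.Im (g t) + complex.Im (h t)))).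
  by congr (_ +i* _); apply: eq_Rintegral => t _; rewrite ?reD ?imD.
by rewrite !RintegralD//; apply: int_cont; exact: ccont_Re || exact: ccont_Im.
Qed.

Lemma cIZ (a : R[i]) g : ccont g -> cI (fun t => a * g t) = a * cI g.
Proof.
move=> cg; rewrite /cI /complex_integral.
have cr := ccont_Re cg; have ci := ccont_Im cg.
have zc (x : R) (f : R -> R) : continuous f -> continuous (fun t => x * f t).
  by move=> cf t; apply: cvgM; [exact: cvg_cst|exact: cf].
case: a => x y.
transitivity ((\int[lebesgue_measure]_(t in I) (x * complex.Re (g t) - y * complex.Im (g t)))
  +i* (\int[lebesgue_measure]_(t in I) (x * complex.Im (g t) + y * complex.Re (g t)))).
  by congr (_ +i* _); apply: eq_Rintegral => t _; rewrite ?reM ?imM.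
rewrite RintegralB ?RintegralD ?RintegralZl//; try by apply: int_cont; auto.
Qed.

Lemma cIN g : ccont g -> cI (fun t => - g t) = - cI g.
Proof.
move=> cg; rewrite -mulN1r -cIZ//; apply: eq_cI => t _; by rewrite mulN1r.
Qed.

Lemma cIB g h : ccont g -> ccont h -> cI (fun t => g t - h t) = cI g - cI h.
Proof. by move=> cg ch; rewrite cID ?cIN//; exact: ccontN. Qed.

Lemma measure_I : fine (lebesgue_measure I) = 2 * pi.
Proof. by rewrite lebesgue_measure_itv /= lte_fin pos -EFinD subr0. Qed.

Lemma cI_cst (a : R[i]) : cI (fun=> a) = (2 * pi)%:C * a.
Proof.
rewrite /cI /complex_integral !Rintegral_cst// measure_I.
by apply/eqP; rewrite eq_complex reM imM /=; apply/andP; split; apply/eqP; ring.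
Qed.

Lemma Rint_bound (f : R -> R) (M : R) : continuous f ->
  (forall t, t \in `[0, 2 * pi]%R -> `|f t| <= M) ->
  `|\int[lebesgue_measure]_(t in I) f t| <= 2 * pi * M.
Proof.
move=> cf hM; have h := @le_normr_Rintegral _ _ _ lebesgue_measure _ _ mI (int_cont cf).
apply: le_trans h _.
have -> : 2 * pi * M = \int[lebesgue_measure]_(t in I) M.
  by rewrite Rintegral_cst// measure_I mulrC.
apply: le_Rintegral => //.
- by apply: int_cont => t; apply: cvg_norm; exact: cf.
- by apply: int_cont => t; exact: cvg_cst.
Qed.

(** Real and imaginary parts are bounded separately, hence 4 pi instead of 2 pi. The uses are
    limits, and the maximum principle, where taking powers absorbs any constant. *)
Lemma cI_bound g (M : R) : ccont g ->
  (forall t, t \in `[0, 2 * pi]%R -> nm (g t) <= M) -> nm (cI g) <= 4 * pi * M.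
Proof.
move=> cg hM; apply: le_trans (nm_ReIm _) _.
have -> : 4 * pi * M = 2 * pi * M + 2 * pi * M by ring.
apply: lerD; apply: Rint_bound => [|t /hM h].
- exact: ccont_Re.
- exact: le_trans (nm_Re _) h.
- exact: ccont_Im.
- exact: le_trans (nm_Im _) h.
Qed.

Lemma Rint_FTC (f F : R -> R) : continuous f ->
  (forall t : R, is_derive t (1 : R) F (f t)) ->
  \int[lebesgue_measure]_(t in I) f t = F (2 * pi) - F 0.
Proof.
move=> cf dF; have cF t : {for t, continuous F}.
  by apply: differentiable_continuous; apply/derivable1_diffP; case: (dF t).
rewrite /Rintegral (continuous_FTC2 (F := F))//.
- exact: continuous_subspaceT.
- split => [t _||]; first by case: (dF t).
    by apply: cvg_at_right_filter; exact: cF.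
  by apply: cvg_at_left_filter; exact: cF.
- by move=> t _; rewrite derive1E; case: (dF t).
Qed.

Lemma cI_FTC c g : ccont g -> (forall t, cder c t (g t)) ->
  cI g = c (2 * pi) - c 0.
Proof.
move=> cg hc; rewrite /cI /complex_integral.
rewrite (Rint_FTC (ccont_Re cg) (fun t => cder_Re (hc t))).
rewrite (Rint_FTC (ccont_Im cg) (fun t => cder_Im (hc t))).
by apply/eqP; rewrite eq_complex reD imD reN imN /= !eqxx.
Qed.

(** Compactness of [[0, 2 * pi]] makes a condition that holds locally in t hold uniformly in t. *)
Lemma unif_near U (F : set_system U) {FF : Filter F} (P : U -> R -> Prop) :
  (forall t, \forall p \near filter_prod F (nbhs t), P p.1 p.2) ->
  \forall s \near F, forall t, t \in `[0, 2 * pi]%R -> P s t.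
Proof.
move=> h; have /compact_near_coveringP := @segment_compact R 0 (2 * pi).
move=> /(_ U F P FF) H; apply: H => t _.
have [[A B] [/= hA hB] hAB] := h t.
by exists (B, A) => //= -[t' s] [/= h1 h2]; apply: (hAB (s, t')).
Qed.

(** Joint convergence at each t, together with continuity of the limit, is uniform convergence on
    the segment by [unif_near]. *)
Lemma cI_cv U (F : set_system U) {FF : Filter F} (H : U -> R -> R[i]) g :
  ccont g -> (\forall s \near F, ccont (H s)) ->
  (forall t, cv (filter_prod F (nbhs t)) (fun p => H p.1 p.2) (g t)) ->
  cv F (fun s => cI (H s)) (cI g).
Proof.
move=> cg cH h; apply/cvP => e e0.
have p4 : 0 < 8 * pi :> R by have := pi_gt0 R; lra.
(* [cI_bound] multiplies by 4 pi, so e / (8 pi) leaves e / 2; it is halved again to pass through the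
   value [g t]. *)
pose k := e / (8 * pi) / 2; have k0 : 0 < k by rewrite !divr_gt0.
suff : \forall s \near F, forall t, t \in `[0, 2 * pi]%R ->
    nm (H s t - g t) <= e / (8 * pi).
  apply: filterS2 cH => s cHs hs; rewrite -cIB//.
  have cB : ccont (fun t => H s t - g t) by apply: ccontD => //; exact: ccontN.
  apply: le_lt_trans (cI_bound cB hs) _.
  have : e / (8 * pi) * (8 * pi) = e by rewrite divfK// gt_eqF.
  by move: e0; set u := e / _; nra.
apply: unif_near => t; move/cvP: (h t) => /(_ _ k0) h1.
have /cvP /(_ _ k0) h2 := cg t.
have h3 : \forall p \near filter_prod F (nbhs t), nm (g p.2 - g t) < k.
  exists (setT, [set s | nm (g s - g t) < k]) => /=.
    by split => //; exact: filterT.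
  by move=> p [].
apply: filterS2 h1 h3 => p h1 h3; apply: le_trans (nm_tri _ (g t) _) _.
rewrite (nmC (g t)); have -> : e / (8 * pi) = k + k by rewrite /k; lra.
by rewrite ltW// ltrD.
Qed.

End CircleIntegrals.

(** * Mean value inequality, differentiation under the integral, homotopy invariance *)

Section Homotopy.
Context (R : realType).
Implicit Types (c : R -> R[i]).

Lemma within_in (I : set R) (s : R) : \forall r \near within I (nbhs s), I r.
Proof. by apply: filterS (withinT I _). Qed.

Lemma within_cont_segment (a b : R) (f : R -> R) :
  (forall s : R, s \in `[a, b]%R -> f @ within `[a, b] (nbhs s) --> f s) ->
  {within `[a, b], continuous f}.
Proof. by move=> h; apply/subspace_continuousP => s hs; apply: h. Qed.

Lemma mv01_real (f g : R -> R) (d e : R) :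
  (forall s : R, s \in `]0, 1[%R -> is_derive s 1 f (g s)) ->
  (forall s : R, s \in `[0, 1]%R -> f @ within `[0, 1] (nbhs s) --> f s) ->
  (forall s : R, s \in `]0, 1[%R -> `|g s - d| <= e) ->
  `|f 1 - f 0 - d| <= e.
Proof.
move=> hd hc hb.
have [s hs ->] := MVT (@ltr01 R) hd (within_cont_segment hc).
by rewrite subr0 mulr1; exact: hb.
Qed.

(** The real mean value theorem applies to the real and imaginary parts at two different points,
    which costs the factor 2. Continuity at the ends and derivatives strictly between them allow
    curves that end on the circle. *)
Lemma mv01 c (c' : R -> R[i]) (d : R[i]) (e : R) :
  (forall s : R, s \in `]0, 1[%R -> cder c s (c' s)) ->
  (forall s : R, s \in `[0, 1]%R -> cv (within `[0, 1] (nbhs s)) c (c s)) ->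
  (forall s : R, s \in `]0, 1[%R -> nm (c' s - d) <= e) ->
  nm (c 1 - c 0 - d) <= 2 * e.
Proof.
move=> hd hc hb; apply: le_trans (nm_ReIm _) _.
have -> : 2 * e = e + e by ring.
rewrite !(reD, imD, reN, imN); apply: lerD.
  apply: (@mv01_real (fun s => complex.Re (c s)) (fun s => complex.Re (c' s))).
  - by move=> s /hd /cder_Re.
  - by move=> s /hc h; exact (cv_Re h).
  - move=> s /hb; apply: le_trans; rewrite -reN -reD; exact: nm_Re.
apply: (@mv01_real (fun s => complex.Im (c s)) (fun s => complex.Im (c' s))).
- by move=> s /hd /cder_Im.
- by move=> s /hc h; exact (cv_Im h).
- move=> s /hb; apply: le_trans; rewrite -imN -imD; exact: nm_Im.
Qed.

Lemma cv_fst T U (F : set_system T) (G : set_system U) {FF : Filter F} {FG : Filter G}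
  (f : T -> R[i]) a : cv F f a -> cv (filter_prod F G) (fun p => f p.1) a.
Proof.
move=> /cvP h; apply/cvP => e /h he.
exists ([set x | nm (f x - a) < e], setT) => /=; last by move=> p [].
by split => //; exact: filterT.
Qed.

Lemma cv_snd T U (F : set_system T) (G : set_system U) {FF : Filter F} {FG : Filter G}
  (f : U -> R[i]) a : cv G f a -> cv (filter_prod F G) (fun p => f p.2) a.
Proof.
move=> /cvP h; apply/cvP => e /h he.
exists (setT, [set x | nm (f x - a) < e]) => /=; last by move=> p [].
by split => //; exact: filterT.
Qed.

Lemma cv_slice T (F : set_system T) {FF : Filter F} (s : T) (H : T -> R -> R[i]) (t : R) a :
  (forall A, F A -> A s) ->
  cv (filter_prod F (nbhs t)) (fun p => H p.1 p.2) a -> cv (nbhs t) (H s) a.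
Proof.
move=> hs /cvP h; apply/cvP => e /h [[A B] /= [/hs As hB] hAB].
by apply: filterS hB => r Br; apply: (hAB (s, r)).
Qed.

Lemma cv_within (I : set R) (s : R) c a : cv (nbhs s) c a -> cv (within I (nbhs s)) c a.
Proof.
move=> /cvP h; apply/cvP => e /h; apply: filterS => r hr _; exact: hr.
Qed.

Lemma cder_comp_affine c (a b t : R) d : cder c (a + t * b) d ->
  cder (fun s => c (a + s * b)) t (d * b%:C).
Proof.
move=> [q hq e]; pose g s := a + s * b.
have cg : g @ t --> g t.
  by apply: cvgD; [exact: cvg_cst|apply: cvgM; [exact: cvg_id|exact: cvg_cst]].
exists (fun s => q (g s) * b%:C).
  apply: cvM; last exact: cv_cst.
  by have := cvg_comp _ _ cg hq.
have e' : \forall s \near t, c (g s) - c (g t) = q (g s) * ((g s)%:C - (g t)%:C).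
  exact: (cg _ e).
apply: filterS e' => s ->; rewrite -!rmorphB -mulrA -rmorphM /= /g.
by congr (_ * _%:C); ring.
Qed.

(** The difference quotient, completed by [dH s0] at [s0], converges jointly by the mean value
    inequality on the segment from [s0] to s. By [cI_cv] its integral is then a Caratheodory factor
    with the right limit. *)
Lemma cI_der (H dH : R -> R -> R[i]) (s0 : R) :
  (\forall s \near s0, forall t, cder (H^~ t) s (dH s t)) ->
  (\forall s \near s0, ccont (H s)) ->
  (forall t, cv (filter_prod (nbhs s0) (nbhs t)) (fun p => dH p.1 p.2) (dH s0 t)) ->
  cder (fun s => cI (H s)) s0 (cI (dH s0)).
Proof.
move=> hd hc hJ.
have cd0 : ccont (dH s0).
  by move=> t; apply: cv_slice (hJ t) => A; exact: nbhs_singleton.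
have cH0 : ccont (H s0) := nbhs_singleton hc.
pose Q s t := if s == s0 then dH s0 t else (s - s0)%:C^-1 * (H s t - H s0 t).
have cQ : \forall s \near s0, ccont (Q s).
  apply: filterS hc => s cs; rewrite /Q; case: eqP => // _.
  by apply: ccontM; [exact: ccont_cst|apply: ccontD => //; exact: ccontN].
exists (fun s => cI (Q s)); last first.
  apply: filterS hc => s cs; rewrite /Q; case: eqP => [->|/eqP ns].
    by rewrite !subrr mulr0.
  have n0 : (s - s0)%:C != 0 by rewrite fmorph_eq0 subr_eq0.
  rewrite cIZ; last by apply: ccontD => //; exact: ccontN.
  by rewrite cIB// -rmorphB /= mulrC mulrA divff// mul1r.
apply: cI_cv => // t0; apply/cvP => e e0.
(* [mv01] doubles this, leaving e / 2. *)
move/cvP: (hJ t0) => /(_ (e / 4)) [|[A B] /= [hA hB] hAB]; first by lra.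
have [r /= r0 hr] := filterI hA hd.
exists (ball s0 r, B) => //=; first by split => //; exact: nbhsx_ballx.
move=> [s t] /= [hs Bt]; rewrite /Q; case: eqP => [_|/eqP ns].
  have := hAB (s0, t) (conj (nbhs_singleton hA) Bt); rewrite /= => h; lra.
pose g u := s0 + u * (s - s0).
have gr (u : R) : u \in `[0, 1]%R -> `|s0 - g u| < r.
  rewrite in_itv /= => /andP[u0 u1]; rewrite /g opprD addNKr normrN normrM.
  rewrite ger0_norm//; apply: le_lt_trans hs; rewrite distrC.
  by rewrite ler_piMl.
have oc (u : R) : u \in `]0, 1[%R -> u \in `[0, 1]%R by apply: subset_itv_oo_cc.
have dg (u : R) : u \in `[0, 1]%R -> cder (fun u => H (g u) t) u (dH (g u) t * (s - s0)%:C).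
  move=> hu; apply: (@cder_comp_affine (H^~ t)).
  by have [_] := hr _ (gr u hu); exact.
have h := @mv01 (fun u => H (g u) t) (fun u => dH (g u) t * (s - s0)%:C)
  (dH s0 t0 * (s - s0)%:C) (e / 4 * `|s - s0|) _ _ _.
have {h} : nm (H (g 1) t - H (g 0) t - dH s0 t0 * (s - s0)%:C) <= 2 * (e / 4 * `|s - s0|).
  apply: h => u hu.
  - by apply: dg; exact: oc.
  - by apply: cv_within; apply: (der_cv (cv_real u) (dg u hu)).
  - rewrite -mulrBl nmM nmR ler_wpM2r ?normr_ge0//.
    have [Ag _] := hr _ (gr u (oc u hu)).
    by apply/ltW/(hAB (g u, t)).
have -> : g 1 = s by rewrite /g; ring.
have -> : g 0 = s0 by rewrite /g; ring.
move=> h.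
have p0 : 0 < `|s - s0| by rewrite normr_gt0 subr_eq0.
have n0 : (s - s0)%:C != 0 by rewrite fmorph_eq0 subr_eq0.
have -> : (s - s0)%:C^-1 * (H s t - H s0 t) - dH s0 t0 =
   (s - s0)%:C^-1 * (H s t - H s0 t - dH s0 t0 * (s - s0)%:C).
  by rewrite [RHS]mulrBr [X in _ = _ - X]mulrCA mulVf// mulr1.
rewrite nmM nmV nmR mulrC ltr_pdivrMr//; apply: le_lt_trans h _.
by rewrite mulrA ltr_pM2r//; lra.
Qed.

(* Since dH is also the t-derivative of the periodic K, it integrates to 0. *)
Lemma cI_homotopy (H dH K : R -> R -> R[i]) :
  (forall s t : R, s \in `[0, 1]%R ->
    cv (filter_prod (within `[0, 1] (nbhs s)) (nbhs t)) (fun p => H p.1 p.2) (H s t)) ->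
  (forall s t : R, s \in `]0, 1[%R -> cder (H^~ t) s (dH s t)) ->
  (forall s t : R, s \in `]0, 1[%R ->
    cv (filter_prod (nbhs s) (nbhs t)) (fun p => dH p.1 p.2) (dH s t)) ->
  (forall s t : R, s \in `]0, 1[%R -> cder (K s) t (dH s t)) ->
  (forall s, K s (2 * pi) = K s 0) ->
  cI (H 1) = cI (H 0).
Proof.
move=> hJ hd hdJ hK hK0.
have cH (s : R) : s \in `[0, 1]%R -> ccont (H s).
  move=> hs t; apply: cv_slice (hJ s t hs) => A hA.
  by apply: (nbhs_singleton hA).
have oc (u : R) : u \in `]0, 1[%R -> u \in `[0, 1]%R by apply: subset_itv_oo_cc.
have nr (s : R) : s \in `]0, 1[%R -> \forall u \near s, u \in `]0, 1[%R.
  by move=> hs; exact: near_in_itvoo.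
apply/eqP; rewrite -subr_eq0 -nm_eq0 eq_le nm_ge0 andbT.
suff : nm (cI (H 1) - cI (H 0) - 0) <= 2 * 0 by rewrite subr0 mulr0.
apply: (@mv01 (fun s => cI (H s)) (fun=> 0)).
- move=> s hs; have -> : 0 = cI (dH s).
    rewrite (@cI_FTC _ (K s)) ?hK0 ?subrr//; last by move=> t; exact: hK.
    by move=> t; apply: cv_slice (hdJ s t hs) => A; exact: nbhs_singleton.
  apply: cI_der => [||t]; last exact: hdJ.
    by apply: filterS (nr s hs) => u hu t; exact: hd.
  by apply: filterS (nr s hs) => u /oc; exact: cH.
- move=> s hs; apply: cI_cv => [||t]; [exact: cH| |exact: hJ].
  apply: filterS (within_in `[0, 1] s) => u hu; exact: cH.
- by move=> s _; rewrite subrr nm0.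
Qed.

End Homotopy.

(** * The complex derivative relative to the closed disk *)

Section ComplexDerivative.
Context (R : realType).
Implicit Types (f g : R[i] -> R[i]) (x y z : R[i]).

Definition odisk : set R[i] := [set z | nm z < 1].
Definition cdisk : set R[i] := [set z | nm z <= 1].

Definition wder (S : set R[i]) f z d := der (nb S z) id z f d.

Lemma nb_self (S : set R[i]) z (P : set R[i]) : S z -> nb S z P -> P z.
Proof. by move=> Sz [d /= d0]; apply; split => //; rewrite subrr nm0. Qed.

Lemma odisk_cdisk z : odisk z -> cdisk z.
Proof. exact: ltW. Qed.

Lemma odisk_near z : odisk z -> \forall y \near nb cdisk z, odisk y.
Proof.
move=> hz; exists (1 - nm z); first by rewrite /= subr_gt0.
move=> y /= [_ hy]; have := nmD (y - z) z; rewrite subrK /odisk /=; lra.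
Qed.

(** The closed disk has no isolated point: shrink z slightly towards 0, or move by a small real
    number if z = 0. This makes relative derivatives unique, also on the circle. *)
Lemma nb_punctured z (P : set R[i]) : cdisk z -> nb cdisk z P ->
  exists2 y, y != z & P y.
Proof.
move=> hz [d /= d0 h].
pose e := Num.min (d / 2) (1 / 2); have e0 : 0 < e by rewrite lt_min; apply/andP; split; lra.
have [e1 e2] : e <= d / 2 /\ e <= 1 / 2 by split; rewrite ge_min lexx ?orbT.
have [E|z0] := eqVneq z 0; [subst z|].
  have ne : nm e%:C = e by rewrite nmR gtr0_norm.
  exists e%:C; first by rewrite -nm_gt0 ne.
  have h1 : cdisk e%:C by rewrite /cdisk /mkset ne; lra.
  have h2 : nm (e%:C - 0) < d by rewrite subr0 ne; lra.
  exact: (h _ (conj h1 h2)).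
exists ((1 - e)%:C * z).
  rewrite -subr_eq0 -[X in _ - X]mul1r -mulrBl mulf_neq0// -rmorphB fmorph_eq0.
  by rewrite addrAC subrr add0r oppr_eq0 gt_eqF.
have nz : 0 < nm z by rewrite nm_gt0.
have hz' : nm z <= 1 := hz.
apply: h; split.
  rewrite /cdisk /= [X in X <= _]nmM nmR ger0_norm; last by lra.
  by nra.
rewrite -[X in _ - X]mul1r -mulrBl -rmorphB nmM nmR addrAC subrr add0r normrN gtr0_norm//.
by nra.
Qed.

Lemma wder_unique f z d e : cdisk z -> wder cdisk f z d -> wder cdisk f z e -> d = e.
Proof.
move=> hz [q hq eq] [r hr er].
have hN : forall (P : set R[i]), nb cdisk z P -> exists2 y, y != z & P y.
  by move=> P; exact: nb_punctured.
apply/eqP; rewrite -subr_eq0 -nm_eq0 eq_le nm_ge0 andbT leNgt; apply/negP => de.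
have e2 : 0 < nm (d - e) / 2 by lra.
move/cvP: hq => /(_ _ e2) hq; move/cvP: hr => /(_ _ e2) hr.
have [y yz [[h1 h2] [h3 h4]]] := hN _ (filterI (filterI eq er) (filterI hq hr)).
have yz0 : y - z != 0 by rewrite subr_eq0.
have qr : q y = r y by apply: (mulIf yz0); rewrite /= -h1 h2.
rewrite /= qr in h3; rewrite /= in h4.
have := nm_tri d (r y) e; rewrite (nmC d (r y)); lra.
Qed.

(* The complex derivative relative to the closed disk, and 0 where there is
   none. *)
Definition cd f z : R[i] := xget 0 [set d | wder cdisk f z d].

Lemma cdE f z d : cdisk z -> wder cdisk f z d -> cd f z = d.
Proof.
move=> hz hd; apply: (wder_unique (f := f) hz) => //.
exact: (@xgetPex _ 0 [set d | wder cdisk f z d] (ex_intro _ d hd)).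
Qed.

(** Differentiability is required on a relative neighbourhood, so that near z the values of [cd f]
    are true derivatives and not its default 0. *)
Definition C1at f z := (\forall y \near nb cdisk z, wder cdisk f y (cd f y)) /\
  cv (nb cdisk z) (cd f) (cd f z).

Lemma C1atI f f' z : cdisk z -> (\forall y \near nb cdisk z, wder cdisk f y (f' y)) ->
  cv (nb cdisk z) f' (f' z) -> C1at f z.
Proof.
move=> hz h hf; have e : \forall y \near nb cdisk z, f' y = cd f y.
  by apply: filterS2 (nb_in cdisk z) h => y hy /cdE ->.
split; first by apply: filterS2 e h => y <-.
by rewrite -(nb_self hz e); apply: cv_near hf.
Qed.

Lemma C1at_wder f z : cdisk z -> C1at f z -> wder cdisk f z (cd f z).
Proof. by move=> hz [/(nb_self hz)]. Qed.

Lemma wder_cv f z d : wder cdisk f z d -> cv (nb cdisk z) f (f z).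
Proof. by move=> h; apply: (der_cv (cv_id _ _) h). Qed.

Lemma C1at_cv f z : cdisk z -> C1at f z -> cv (nb cdisk z) f (f z).
Proof. by move=> hz /(C1at_wder hz) /wder_cv. Qed.

Lemma C1at_cst a z : cdisk z -> C1at (fun=> a) z.
Proof.
move=> hz; apply: (@C1atI _ (fun=> 0)) => //; last exact: cv_cst.
by apply: nearW => y; exact: der_cst.
Qed.

Lemma C1at_id z : cdisk z -> C1at id z.
Proof.
move=> hz; apply: (@C1atI _ (fun=> 1)) => //; last exact: cv_cst.
by apply: nearW => y; exact: der_self.
Qed.

Lemma C1atD f g z : cdisk z -> C1at f z -> C1at g z -> C1at (fun y => f y + g y) z.
Proof.
move=> hz [h1 h2] [h3 h4]; apply: (@C1atI _ (fun y => cd f y + cd g y)) => //.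
  by apply: filterS2 h1 h3 => y; exact: derD.
exact: cvD.
Qed.

Lemma C1atN f z : cdisk z -> C1at f z -> C1at (fun y => - f y) z.
Proof.
move=> hz [h1 h2]; apply: (@C1atI _ (fun y => - cd f y)) => //.
  by apply: filterS h1 => y; exact: derN.
exact: cvN.
Qed.

Lemma C1atM f g z : cdisk z -> C1at f z -> C1at g z -> C1at (fun y => f y * g y) z.
Proof.
move=> hz hf hg; have cf := C1at_cv hz hf; have cg := C1at_cv hz hg.
move: hf hg => [h1 h2] [h3 h4].
apply: (@C1atI _ (fun y => cd f y * g y + f y * cd g y)) => //.
  by apply: filterS2 h1 h3 => y k1 k2; apply: (derM (cv_id _ _) k1 k2).
by apply: cvD; exact: cvM.
Qed.

Lemma C1atV f z : cdisk z -> f z != 0 -> C1at f z -> C1at (fun y => (f y)^-1) z.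
Proof.
move=> hz f0 hf; have cf := C1at_cv hz hf; move: hf => [h1 h2].
apply: (@C1atI _ (fun y => - cd f y / f y ^+ 2)) => //.
  have n0 : \forall y \near nb cdisk z, f y != 0.
    suff : \forall y \near nb cdisk z, 0 < nm (f y) by apply: filterS => y; rewrite nm_gt0.
    by apply: (cvgr_gt _ (cv_norm cf)); rewrite nm_gt0.
  by apply: filterS2 h1 n0 => y k1 k2; apply: (derV (cv_id _ _) k2 k1).
apply: cvM; first exact: cvN.
by apply: cvV; rewrite ?expf_neq0// expr2; apply: cvM.
Qed.

Lemma C1at_comp f g z : cdisk z -> (\forall y \near nb cdisk z, cdisk (g y)) ->
  C1at f (g z) -> C1at g z -> C1at (fun y => f (g y)) z.
Proof.
move=> hz hin hf hg; have cg := C1at_cv hz hg.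
have cf := C1at_cv (nb_self hz hin) hf.
move: hf hg => [[r /= r0 h1] h2] [h3 h4].
apply: (@C1atI _ (fun y => cd f (g y) * cd g y)) => //; last first.
  by apply: cvM => //; apply: (cv_comp h2 cg).
move/cvP: (cg) => /(_ _ r0) hr; have [r' /= r'0 hr'] := filterI hin hr.
have [r2 /= r20 h3'] := h3.
exists (Num.min r' r2); first by rewrite /= lt_min r'0.
move=> y /= [cy]; rewrite lt_min => /andP[y1 y2].
have [gy1 gy2] := hr' y (conj cy y1).
apply: (@der_comp R _ _ _ id y (cv_id cdisk y) cdisk f g).
- exact: (h1 (g y)).
- exact: h3'.
- exists (r' - nm (y - z)); first by rewrite /= subr_gt0.
  move=> w /= [cw hw]; have [] := hr' w; last by [].
  by split => //; have := nm_tri w y z; lra.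
Qed.

End ComplexDerivative.

(** * Cauchy's formula on the unit circle and the maximum principle *)

Section CauchyFormula.
Context (R : realType).
Implicit Types (f g : R[i] -> R[i]) (x y z : R[i]).

Definition hol f := forall z, odisk z -> C1at f z.
Definition contc f := forall z, cdisk z -> cv (nb (@cdisk R) z) f (f z).
(** The disk algebra. *)
Definition A0 f := hol f /\ contc f.
(** The C^1 counterpart of [A0]: the derivative is continuous up to the circle. *)
Definition K f := forall z, cdisk z -> C1at f z.

Lemma K_hol f : K f -> hol f.
Proof. by move=> h z /odisk_cdisk; exact: h. Qed.

Lemma K_contc f : K f -> contc f.
Proof. by move=> h z hz; apply: C1at_cv => //; exact: h. Qed.

Lemma K_A0 f : K f -> A0 f.
Proof. by move=> h; split; [exact: K_hol|exact: K_contc]. Qed.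

Lemma A0_cst a : A0 (fun=> a).
Proof. by apply: K_A0 => z hz; exact: C1at_cst. Qed.

Lemma A0D f g : A0 f -> A0 g -> A0 (fun z => f z + g z).
Proof.
move=> [h1 h2] [h3 h4]; split=> z hz; last by apply: cvD; auto.
by apply: C1atD; auto; exact: odisk_cdisk.
Qed.

Lemma A0N f : A0 f -> A0 (fun z => - f z).
Proof.
move=> [h1 h2]; split=> z hz; last by apply: cvN; auto.
by apply: C1atN; auto; exact: odisk_cdisk.
Qed.

Lemma A0B f g : A0 f -> A0 g -> A0 (fun z => f z - g z).
Proof. by move=> h1 h2; apply: A0D => //; exact: A0N. Qed.

Lemma A0M f g : A0 f -> A0 g -> A0 (fun z => f z * g z).
Proof.
move=> [h1 h2] [h3 h4]; split=> z hz; last by apply: cvM; auto.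
by apply: C1atM; auto; exact: odisk_cdisk.
Qed.

Lemma A0X f n : A0 f -> A0 (fun z => f z ^+ n).
Proof.
move=> hf; elim: n => [|n IH].
  by have -> : (fun z => f z ^+ 0) = (fun=> 1) by []; exact: A0_cst.
have -> : (fun z => f z ^+ n.+1) = (fun z => f z * f z ^+ n).
  by apply/funext => z; rewrite exprS.
exact: A0M.
Qed.

Lemma A0V f : (forall z, cdisk z -> f z != 0) -> A0 f -> A0 (fun z => (f z)^-1).
Proof.
move=> h0 [h1 h2]; split=> z hz; last by apply: cvV; auto.
have cz := odisk_cdisk hz; apply: C1atV; auto.
Qed.

Lemma ccont_path f (c : R -> R[i]) : contc f -> ccont c -> (forall t, cdisk (c t)) ->
  ccont (fun t => f (c t)).
Proof.
by move=> hf hc hin t; apply: (cv_comp (hf _ (hin t)) (hc t)); apply: nearW.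
Qed.

Lemma cdisk_cis (t : R) : cdisk (cis t).
Proof. by rewrite /cdisk /mkset nm_cis. Qed.

Lemma near_fst T U (F : set_system T) (G : set_system U) {FF : Filter F} {FG : Filter G}
  (P : T -> Prop) : F P -> \forall p \near filter_prod F G, P p.1.
Proof.
by move=> h; exists (P, setT) => /=; [split => //; exact: filterT|move=> p []].
Qed.

Lemma cder_eq (c : R -> R[i]) (t : R) (d e : R[i]) : cder c t d -> d = e -> cder c t e.
Proof. by move=> h <-. Qed.

Section Kernel.
(** [sg] is the orientation of the circle. The value -1 serves functions of w = 1/x, which at the
    point x = cis t of the circle are evaluated at w = cis (-t). *)
Variables (sg : R) (x : R[i]).
Hypotheses (hsg : sg = 1 \/ sg = -1) (hx : nm x < 1).

Let g (t : R) : R[i] := cis (sg * t).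
Let cg : ccont g. Proof. exact: ccont_cisM. Qed.
Let ng t : nm (g t) = 1. Proof. exact: nm_cis. Qed.
Let dg t : cder g t (sg%:C * 'i * g t). Proof. exact: cder_cisM. Qed.
Let sg0 : sg%:C * 'i != 0 :> R[i].
Proof.
rewrite mulf_neq0//; last by rewrite -nm_gt0 nm_i.
by rewrite fmorph_eq0; case: hsg => ->; rewrite ?oppr_eq0 oner_neq0.
Qed.
Let g2pi : g (2 * pi) = g 0.
Proof.
rewrite /g mulr0 cis0; case: hsg => ->; first by rewrite mul1r cis2pi.
by rewrite mulN1r cisN cis2pi invr1.
Qed.

Let gsx s t : s \in `[0, 1]%R -> g t - s%:C * x != 0.
Proof.
rewrite in_itv /= => /andP[s0 s1]; rewrite subr_eq0; apply/eqP => e.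
have := ng t; rewrite e nmM nmR ger0_norm//.
have : s * nm x <= 1 * nm x by rewrite ler_wpM2r ?nm_ge0.
by move: hx; lra.
Qed.

Lemma cauchy_kernel_cont : ccont (fun t => g t / (g t - x)).
Proof.
apply: ccontM => //; apply: ccontV.
  by move=> t; have := @gsx 1 t; rewrite mul1r; apply; rewrite in_itv /= ler01 lexx.
by apply: ccontD => //; exact: ccont_cst.
Qed.

Let oc (u : R) : u \in `]0, 1[%R -> u \in `[0, 1]%R.
Proof. by apply: subset_itv_oo_cc. Qed.

(** With s x in place of x, the integrand is 1 at s = 0. As g' = sg i g, its s-derivative g x / (g -
    s x)^2 is also the t-derivative of -x / (sg i (g - s x)), which is periodic. *)
Lemma cauchy_one : cI (fun t => g t / (g t - x)) = (2 * pi)%:C.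
Proof.
pose H s t := g t / (g t - s%:C * x).
pose dH s t := g t * (x / (g t - s%:C * x) ^+ 2).
have -> : cI (fun t => g t / (g t - x)) = cI (H 1).
  by apply: eq_cI => t _; rewrite /H mul1r.
have -> : (2 * pi)%:C = cI (H 0) :> R[i].
  rewrite -[LHS]mulr1 -cI_cst; apply: eq_cI => t _; rewrite /H mul0r subr0 divff//.
  exact: cis_neq0.
have cvd (F : set_system R) (FF : Filter F) s t : cv F (fun r => r%:C) s%:C ->
    cv (filter_prod F (nbhs t)) (fun p => g p.2 - p.1%:C * x) (g t - s%:C * x).
  move=> hF; apply: cvB; first by apply: cv_snd; exact: cg.
  by apply: cvM; [exact: cv_fst hF|exact: cv_cst].
have dden s t : cder (fun s => g t - s%:C * x) s (- x).
  have := derB (der_cst (fun r : R => r%:C) s (g t))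
    (derM (cv_real s) (der_self _ _) (der_cst _ _ x)).
  by rewrite mul1r mulr0 addr0 sub0r; exact.
apply: (@cI_homotopy _ H dH (fun s t => - (sg%:C * 'i)^-1 * (x / (g t - s%:C * x)))).
- move=> s t hs; apply: cvM; first by apply: cv_snd; exact: cg.
  by apply: cvV; [exact: gsx|apply: cvd; apply: cv_within; exact: cv_real].
- move=> s t /oc hs.
  have := derZ (cv_real s) (g t) (derV (cv_real s) (gsx t hs) (dden s t)).
  by rewrite opprK; exact.
- move=> s t /oc hs; apply: cvM; first by apply: cv_snd; exact: cg.
  apply: cvM; first exact: cv_cst.
  apply: cvV; first by rewrite expf_neq0// gsx.
  by rewrite expr2; apply: cvM; apply: cvd; exact: cv_real.
- move=> s t /oc hs.
  have dd : cder (fun t => g t - s%:C * x) t (sg%:C * 'i * g t).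
    by have := derB (dg t) (der_cst _ _ (s%:C * x)); rewrite subr0; exact.
  apply: (cder_eq (derZ (cv_real t) (- (sg%:C * 'i)^-1)
    (derZ (cv_real t) x (derV (cv_real t) (gsx t hs) dd)))).
  have := gsx t hs; rewrite /dH; move: sg0.
  set a := sg%:C * 'i; set b := g t - _ => a0 b0; field; by rewrite a0 b0.
- by move=> s; rewrite g2pi.
Qed.

(** Contract the circle to x along [p s t]. The s-derivative of the integrand is f'(p) g, which is
    the t-derivative of f(p) / (sg i s). For 0 < s < 1 the point p is in the open disk, so only
    continuity of f enters on the circle. At s = 0 the integral is [f x] times that of
    [cauchy_one]. *)
Lemma cauchy_formula f : A0 f ->
  cI (fun t => f (g t) * (g t / (g t - x))) = (2 * pi)%:C * f x.
Proof.
move=> [hf cf]; pose p s t := x + s%:C * (g t - x).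
pose k t := g t / (g t - x).
have ck : ccont k by exact: cauchy_kernel_cont.
have np s t : s \in `[0, 1]%R -> nm (p s t) <= (1 - s) * nm x + s.
  rewrite in_itv /= => /andP[s0 s1].
  have -> : p s t = (1 - s)%:C * x + s%:C * g t by rewrite /p rmorphB rmorph1; ring.
  apply: le_trans (nmD _ _) _; rewrite !nmM !nmR ng mulr1 !ger0_norm//; lra.
have pc s t : s \in `[0, 1]%R -> cdisk (p s t).
  move=> hs; apply: le_trans (np s t hs) _; move: hs; rewrite in_itv /= => /andP[s0 s1].
  have : 0 <= (1 - s) * (1 - nm x) by rewrite mulr_ge0 ?subr_ge0 ?(ltW hx).
  lra.
have po s t : s \in `]0, 1[%R -> odisk (p s t).
  move=> hs; apply: le_lt_trans (np s t (oc hs)) _; move: hs; rewrite in_itv /= => /andP[s0 s1].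
  have : 0 < (1 - s) * (1 - nm x) by rewrite mulr_gt0 ?subr_gt0.
  lra.
pose H s t := f (p s t) * k t.
pose dH s t := cd f (p s t) * g t.
have gx0 t : g t - x != 0.
  by have := @gsx 1 t; rewrite mul1r; apply; rewrite in_itv /= ler01 lexx.
have cvp (F : set_system R) (FF : Filter F) s t : cv F (fun r => r%:C) s%:C ->
    cv (filter_prod F (nbhs t)) (fun q => p q.1 q.2) (p s t).
  move=> hF; apply: cvD; first exact: cv_cst.
  apply: cvM; first exact: cv_fst hF.
  by apply: cvB; [apply: cv_snd; exact: cg|exact: cv_cst].
have -> : cI (fun t => f (g t) * (g t / (g t - x))) = cI (H 1).
  by apply: eq_cI => t _; rewrite /H /p mul1r [x + _]addrC subrK.
have -> : (2 * pi)%:C * f x = cI (H 0).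
  rewrite mulrC -cauchy_one -cIZ; last exact: cauchy_kernel_cont.
  by apply: eq_cI => t _; rewrite /H /p mul0r addr0.
have nr (s : R) : s \in `]0, 1[%R -> \forall u \near s, u \in `]0, 1[%R.
  by move=> hs; exact: near_in_itvoo.
have dps s t : cder (p^~ t) s (g t - x).
  have := derD (der_cst (fun r : R => r%:C) s x)
    (derM (cv_real s) (der_self _ _) (der_cst _ _ (g t - x))).
  by rewrite mul1r mulr0 addr0 add0r; exact.
have dpt s t : cder (p s) t (s%:C * (sg%:C * 'i * g t)).
  have := derD (der_cst (fun r : R => r%:C) t x)
    (derZ (cv_real t) s%:C (derB (dg t) (der_cst _ _ x))).
  by rewrite subr0 add0r; exact.
apply: (@cI_homotopy _ H dH (fun s t => (sg%:C * 'i * s%:C)^-1 * f (p s t))).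
- move=> s t hs; apply: cvM; last by apply: cv_snd; exact: ck.
  apply: (cv_comp (cf _ (pc s t hs)) (cvp _ _ s t (cv_within _ (cv_real s)))).
  have h : \forall q \near filter_prod (within `[0, 1] (nbhs s)) (nbhs t), q.1 \in `[0, 1]%R.
    exact: (near_fst (within_in `[0, 1] s)).
  by apply: filterS h => q hq; exact: pc.
- move=> s t hs.
  have hc := C1at_wder (pc s t (oc hs)) (hf _ (po s t hs)).
  have h := der_comp (cv_real s) hc (dps s t) _.
  have {}h : cder (fun s => f (p s t)) s (cd f (p s t) * (g t - x)).
    by apply: h; apply: filterS (nr s hs) => u /oc; exact: pc.
  have := derM (cv_real s) h (der_cst _ _ (k t)).
  rewrite mulr0 addr0 /k -mulrA [(g t - x) * _]mulrCA divff// mulr1; exact.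
- move=> s t hs; apply: cvM; last by apply: cv_snd; exact: cg.
  have [_ hc] := hf _ (po s t hs).
  apply: (cv_comp hc (cvp _ _ s t (cv_real s))).
  have h : \forall q \near filter_prod (nbhs s) (nbhs t), q.1 \in `]0, 1[%R.
    exact: (near_fst (nr s hs)).
  by apply: filterS h => q /oc hq; exact: pc.
- move=> s t hs.
  have hc := C1at_wder (pc s t (oc hs)) (hf _ (po s t hs)).
  have h := der_comp (cv_real t) hc (dpt s t) _.
  have {}h : cder (fun t => f (p s t)) t (cd f (p s t) * (s%:C * (sg%:C * 'i * g t))).
    by apply: h; apply: nearW => u; apply: pc; exact: oc.
  apply: (cder_eq (derZ (cv_real t) (sg%:C * 'i * s%:C)^-1 h)).
  have s0 : s%:C != 0 :> R[i].
    by rewrite fmorph_eq0; move: hs; rewrite in_itv /= => /andP[/gt_eqF ->].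
  rewrite /dH; move: sg0; set a := sg%:C * 'i => a0; field; by rewrite s0 a0.
- by move=> s; rewrite /p g2pi.
Qed.

End Kernel.

Lemma bernoulli (e : R) n : 0 <= e -> 1 + n%:R * e <= (1 + e) ^+ n.
Proof.
move=> e0; elim: n => [|n IH]; first by rewrite mul0r addr0 expr0.
rewrite exprS -natr1; have n0 : 0 <= n%:R :> R by exact: ler0n.
have : 0 <= n%:R * e * e by rewrite !mulr_ge0.
nra.
Qed.

(** If m > M > 0, Bernoulli's inequality makes the powers of m / M exceed any C. *)
Lemma power_le (C m M : R) : 0 <= M -> (forall n, m ^+ n <= C * M ^+ n) -> m <= M.
Proof.
move=> M0 h; rewrite leNgt; apply/negP => mM.
move: M0; rewrite le_eqVlt => /orP[/eqP e|M0].
  by have := h 1%N; rewrite !expr1 -e mulr0; lra.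
pose e := m / M - 1; have e0 : 0 < e by rewrite subr_gt0 ltr_pdivlMr ?mul1r.
have hn n : 1 + n%:R * e <= C.
  apply: le_trans (bernoulli n (ltW e0)) _.
  rewrite /e addrC subrK expr_div_n ler_pdivrMr ?exprn_gt0//; exact: h.
have C0 : 0 <= C / e.
  rewrite divr_ge0 ?(ltW e0)//; have := hn 0%N; rewrite mul0r; lra.
have := archi_boundP C0; set n := Num.bound _; rewrite ltr_pdivrMr// => hC.
by have := hn n; lra.
Qed.

(** Cauchy's formula for f^n gives |f z|^n <= C M^n with C = 2 / (1 - |z|) independent of n;
    [power_le] then removes C. *)
Lemma max_principle f (M : R) : A0 f -> (forall t : R, nm (f (cis t)) <= M) ->
  forall z, cdisk z -> nm (f z) <= M.
Proof.
move=> hf hM z hz.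
have M0 : 0 <= M by apply: le_trans (hM 0); exact: nm_ge0.
move: (hz); rewrite /cdisk /mkset le_eqVlt => /orP[/eqP e|hz'].
  by have [t _ ->] := cis_surj e.
apply: (@power_le (2 / (1 - nm z))) => // n.
have hs : (1 : R) = 1 \/ (1 : R) = -1 by left.
have h := cauchy_formula hs hz' (A0X n hf).
have d0 : 0 < 1 - nm z by lra.
have ck := cauchy_kernel_cont 1 hz'.
have cf : ccont (fun t => f (cis (1 * t)) ^+ n * (cis (1 * t) / (cis (1 * t) - z))).
  apply: ccontM => //; apply: (ccont_path (A0X n hf).2); first exact: ccont_cisM.
  by move=> t; exact: cdisk_cis.
have hb (t : R) : t \in `[0, 2 * pi]%R ->
    nm (f (cis (1 * t)) ^+ n * (cis (1 * t) / (cis (1 * t) - z))) <= M ^+ n / (1 - nm z).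
  move=> _; rewrite !nmM nmX nmV nm_cis [X in _ * X]mul1r ler_pM ?exprn_ge0 ?invr_ge0 ?nm_ge0//.
    by rewrite lerXn2r ?nnegrE ?nm_ge0.
  have hd : 1 - nm z <= nm (cis (1 * t) - z).
    by have := nmD (cis (1 * t) - z) z; rewrite subrK nm_cis; lra.
  by rewrite lef_pV2 ?posrE//; lra.
have := cI_bound cf hb; rewrite h nmM nmR nmX ger0_norm; last by have := pi_gt0 R; lra.
have := pi_gt0 R => pi0.
have -> : 4 * pi * (M ^+ n / (1 - nm z)) = 2 * pi * (2 / (1 - nm z) * M ^+ n) by ring.
by rewrite ler_pM2l//; lra.
Qed.

End CauchyFormula.

(** * Boundary regularity in the disk from regularity of the boundary loop *)

Section Regularity.
Context (R : realType).
Implicit Types (f g : R[i] -> R[i]) (x y z : R[i]).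

Lemma cv_compR T (F : set_system T) {FF : Filter F} (u : T -> R) (t : R) (c : R -> R[i]) a :
  u @ F --> t -> cv (nbhs t) c a -> cv F (fun w : T => c (u w)) a.
Proof. by move=> hu hc; have := cvg_comp _ _ hu hc. Qed.

(* The derivative of f along rotations: i z f'(z) inside the disk, and the
   derivative of the boundary loop on the circle. *)
Definition rd f z : R[i] :=
  (fun s : R => complex.Re (f (z * cis s)))^`()%classic 0 +i*
  (fun s : R => complex.Im (f (z * cis s)))^`()%classic 0.

Lemma rdE f z d : cder (fun s => f (z * cis s)) 0 d -> rd f z = d.
Proof.
move=> h; rewrite /rd !derive1E.
have [_ ->] := cder_Re h; have [_ ->] := cder_Im h; by case: d {h}.
Qed.

Lemma C1at_near f g z : cdisk z -> (\forall y \near nb (@cdisk R) z, f y = g y) ->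
  C1at f z -> C1at g z.
Proof.
move=> hz h [h1 h2]; apply: (C1atI (f' := cd f)) => //.
have h' : \forall y \near nb (@cdisk R) z, cdisk y /\ \forall w \near nb (@cdisk R) y, f w = g w.
  have [d /= d0 hd] := h; exists d => //= y [cy hy]; split => //.
  exists (d - nm (y - z)); first by rewrite /= subr_gt0.
  move=> w /= [cw hw]; apply: hd; split => //; have := nm_tri w y z; lra.
apply: filterS2 h1 h' => y h1 [cy hy]; apply: der_near h1 => //.
exact: (nb_self cy hy).
Qed.

Lemma cdiskM x y : cdisk x -> cdisk y -> cdisk (x * y).
Proof. by rewrite /cdisk /mkset => hx hy; rewrite nmM mulr_ile1 ?nm_ge0. Qed.

Lemma A0_rot f (h : R) : A0 f -> A0 (fun z => f (z * cis h)).
Proof.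
move=> [h1 h2]; have cc z : cdisk z -> cdisk (z * cis h).
  by move=> hz; apply: cdiskM => //; exact: cdisk_cis.
have near_cc z : \forall y \near nb (@cdisk R) z, cdisk (y * cis h).
  by apply: filterS (nb_in _ _) => y; exact: cc.
split=> z hz.
  have cz := odisk_cdisk hz; apply: C1at_comp => //.
    by apply: h1; rewrite /odisk /mkset nmM nm_cis mulr1.
  by apply: C1atM => //; [exact: C1at_id|exact: C1at_cst].
apply: (cv_comp (h2 _ (cc z hz)) _ (near_cc z)).
by apply: cvM; [exact: cv_id|exact: cv_cst].
Qed.

Lemma cder_rot f z : cdisk z -> C1at f z ->
  cder (fun s => f (z * cis s)) 0 ('i * z * cd f z).
Proof.
move=> hz hf; have hw := C1at_wder hz hf.
have hc : cder (fun s => z * cis s) 0 ('i * z).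
  apply: (cder_eq (derZ (cv_real 0) z (cder_cis 0))); rewrite cis0; ring.
apply: (cder_eq (der_comp (cv_real 0) (S := @cdisk R) (f := f) (e := cd f z) _ hc _)).
- by rewrite cis0 mulr1.
- by apply: nearW => s; apply: cdiskM => //; exact: cdisk_cis.
- by rewrite mulrC.
Qed.

Lemma nm_sq z : nm z ^+ 2 = complex.Re z ^+ 2 + complex.Im z ^+ 2.
Proof. by case: z => a b /=; rewrite sqr_sqrtr ?addr_ge0 ?sqr_ge0. Qed.

Lemma cdisk_convex y z (s : R) : cdisk y -> cdisk z -> s \in `[0, 1]%R ->
  cdisk (z + s%:C * (y - z)).
Proof.
rewrite in_itv /= => hy hz /andP[s0 s1].
have -> : z + s%:C * (y - z) = (1 - s)%:C * z + s%:C * y by rewrite rmorphB rmorph1; ring.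
apply: le_trans (nmD _ _) _; rewrite !nmM !nmR !ger0_norm ?subr_ge0//.
have : (1 - s) * nm z <= (1 - s) * 1 by rewrite ler_wpM2l ?subr_ge0.
have : s * nm y <= s * 1 by rewrite ler_wpM2l.
lra.
Qed.

(** Strict convexity, from |(1-s) z + s y|^2 = (1-s) |z|^2 + s |y|^2 - s (1-s) |y - z|^2. A chord
    between two points of the circle is thus interior except at its ends. *)
Lemma odisk_convex y z (s : R) : cdisk y -> cdisk z -> y != z -> s \in `]0, 1[%R ->
  odisk (z + s%:C * (y - z)).
Proof.
rewrite in_itv /= /cdisk /odisk /mkset => hy hz yz /andP[s0 s1].
have e1 : nm y ^+ 2 <= 1 by rewrite expr_le1 ?nm_ge0.
have e2 : nm z ^+ 2 <= 1 by rewrite expr_le1 ?nm_ge0.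
have e3 : 0 < nm (y - z) ^+ 2 by rewrite exprn_gt0// nm_gt0 subr_eq0.
rewrite -(@expr_lt1 _ 2) ?nm_ge0//.
have -> : nm (z + s%:C * (y - z)) ^+ 2 =
    (1 - s) * nm z ^+ 2 + s * nm y ^+ 2 - s * (1 - s) * nm (y - z) ^+ 2.
  by rewrite !nm_sq; case: y {hy yz e1 e3} => a b; case: z {hz e2} => c d /=; ring.
have : 0 < s * (1 - s) * nm (y - z) ^+ 2.
  by apply: mulr_gt0 => //; apply: mulr_gt0 => //; rewrite subr_gt0.
have : (1 - s) * nm z ^+ 2 <= (1 - s) * 1 by rewrite ler_wpM2l// subr_ge0 ltW.
have : s * nm y ^+ 2 <= s * 1 by rewrite ler_wpM2l// ltW.
lra.
Qed.

Section Rotation.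
Variables (f : R[i] -> R[i]) (phi : R -> R[i]).
Hypotheses (hf : A0 f) (hphi : forall t, cder (fun t => f (cis t)) t (phi t))
  (cphi : ccont phi).

Lemma cder_rot_cis t : cder (fun s => f (cis t * cis s)) 0 (phi t).
Proof.
have h : cder (fun t => f (cis t)) (t + 0 * 1) (phi t) by rewrite mul0r addr0.
have := cder_comp_affine h; rewrite rmorph1 mulr1; congr (cder _ _ _).
by apply/funext => s; rewrite mulr1 cisD.
Qed.

Lemma rd_cis t : rd f (cis t) = phi t.
Proof. by apply: rdE; exact: cder_rot_cis. Qed.

Lemma rd_odisk z : odisk z -> rd f z = 'i * z * cd f z.
Proof. by move=> hz; apply: rdE; apply: cder_rot (odisk_cdisk hz) (hf.1 _ hz). Qed.

Lemma cder_rd z : cdisk z -> cder (fun s => f (z * cis s)) 0 (rd f z).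
Proof.
rewrite /cdisk /mkset le_eqVlt => /orP[/eqP /cis_surj[t _ ->]|hz].
  by rewrite rd_cis; exact: cder_rot_cis.
by rewrite rd_odisk//; apply: cder_rot (odisk_cdisk hz) (hf.1 _ hz).
Qed.

(** For fixed h this lies in [A0], before anything is known about the continuity of the limit
    [rd f]. *)
Let gq (h : R) z := h%:C^-1 * (f (z * cis h) - f z).

Let A0_gq h : A0 (gq h).
Proof.
apply: A0M; first exact: A0_cst.
by apply: A0B => //; exact: A0_rot.
Qed.

(** On the circle this is a difference quotient of the loop t |-> f (cis t). By the mean value
    inequality its distance to phi is controlled by the oscillation of phi over length h, which is
    small uniformly in t by compactness. The factor 2 is that of [mv01]. *)
Let boundary_unif (e : R) : 0 < e -> \forall h \near (0 : R)^'+,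
  forall t : R, nm (gq h (cis t) - rd f (cis t)) <= 2 * e.
Proof.
move=> e0.
have hu : \forall v \near (0 : R), forall t : R, t \in `[0, 2 * pi]%R ->
    nm (phi (t + v) - phi t) <= e.
  apply: (@unif_near R R (nbhs (0 : R)) _ (fun v t => nm (phi (t + v) - phi t) <= e)).
  move=> t; have e2 : 0 < e / 2 by lra.
  have c1 : (fun p : R * R => p.2 + p.1) @ filter_prod (nbhs (0 : R)) (nbhs t) --> t + 0.
    by apply: cvgD; [exact: cvg_snd|exact: cvg_fst].
  rewrite addr0 in c1.
  have c2 : cv (filter_prod (nbhs (0 : R)) (nbhs t)) (fun p => phi (p.2 + p.1)) (phi t).
    exact: cv_compR c1 (cphi t).
  move/cvP: c2 => /(_ _ e2) h1.
  have c3 : cv (filter_prod (nbhs (0 : R)) (nbhs t)) (fun p => phi p.2) (phi t).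
    by apply: cv_snd; exact: cphi.
  move/cvP: c3 => /(_ _ e2) h2.
  apply: filterS2 h1 h2 => p h1 h2; apply: le_trans (nm_tri _ (phi t) _) _.
  by rewrite (nmC (phi t)); lra.
have [d /= d0 hd] := hu; exists d => // h /= hh0 h0 t.
have hh : `|h| < d by move: hh0; rewrite sub0r normrN.
have [t' ht' ->] := cis_surj (nm_cis t).
rewrite rd_cis /gq -cisD.
have hn : h%:C != 0 :> R[i] by rewrite fmorph_eq0 gt_eqF.
have -> : h%:C^-1 * (f (cis (t' + h)) - f (cis t')) - phi t' =
    h%:C^-1 * (f (cis (t' + h)) - f (cis t') - phi t' * h%:C).
  by rewrite [RHS]mulrBr [X in _ = _ - X]mulrCA mulVf// mulr1.
rewrite nmM nmV nmR gtr0_norm// mulrC ler_pdivrMr//.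
have dc s : cder (fun u => f (cis (t' + u * h))) s (phi (t' + s * h) * h%:C).
  by apply: (@cder_comp_affine R (fun t => f (cis t))).
have := @mv01 R (fun u => f (cis (t' + u * h))) (fun u => phi (t' + u * h) * h%:C)
  (phi t' * h%:C) (e * h); rewrite mul1r mul0r addr0 mulrA; apply => s hs.
- exact: dc.
- by apply: cv_within; apply: (der_cv (cv_real s) (dc s)).
- rewrite -mulrBl nmM nmR gtr0_norm// ler_wpM2r ?(ltW h0)//; apply: (hd (s * h) _ t' ht'); rewrite /ball_ /=.
  move: hs; rewrite in_itv /= => /andP[s0 s1].
  rewrite sub0r normrN normrM (gtr0_norm h0) (gtr0_norm s0).
  by apply: le_lt_trans hh; rewrite gtr0_norm// ler_piMl// ltW.
Qed.

Let gq_cv z : cdisk z -> cv (0 : R)^'+ (fun h => gq h z) (rd f z).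
Proof.
move=> hz; have [q hq e] := cder_rd hz.
apply: (@cv_near _ _ _ _ q); last exact: cv_within hq.
have e' : \forall s \near (0 : R)^'+, f (z * cis s) - f (z * cis 0) = q s * (s%:C - 0%:C).
  by apply: filterS e => s h _.
have p : \forall s \near (0 : R)^'+, 0 < s by exact: nbhs_right_gt.
apply: filterS2 e' p => s; rewrite cis0 mulr1 rmorph0 subr0 /gq => -> s0.
by rewrite mulrCA mulVf ?mulr1// fmorph_eq0 gt_eqF.
Qed.

(* By the maximum principle the difference quotients of rotations, which
   converge uniformly on the circle, converge uniformly on the disk. *)
Let disk_unif (e : R) : 0 < e -> \forall h \near (0 : R)^'+,
  forall z, cdisk z -> nm (gq h z - rd f z) <= 4 * e.
Proof.
move=> e0; have hb := boundary_unif e0; apply: filterS (hb) => h hh z hz.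
(* The maximum principle is applied to a difference of two quotients, both in [A0]; letting h' tend
   to 0 pointwise then replaces the second one by [rd f z]. *)
apply: (@cv_le_bound _ _ (0 : R)^'+ _ (fun h' => gq h z - gq h' z)).
  apply: filterS hb => h' hh'.
  apply: (max_principle (A0B (A0_gq h) (A0_gq h'))) => // t.
  apply: le_trans (nm_tri _ (rd f (cis t)) _) _; rewrite (nmC (rd f _)).
  by have := hh t; have := hh' t; lra.
by apply: cvB; [exact: cv_cst|exact: gq_cv].
Qed.

Lemma rd_contc : contc (rd f).
Proof.
move=> z hz; apply/cvP => e e0; have e1 : 0 < e / 16 by lra.
have [h hh] : exists h, forall z, cdisk z -> nm (gq h z - rd f z) <= 4 * (e / 16).
  by apply: (@filter_ex _ (0 : R)^'+); exact: disk_unif.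
have /cvP /(_ _ e1) := (A0_gq h).2 z hz.
apply: filterS2 (nb_in _ _) => y cy hy.
have h1 := hh y cy; have h2 := hh z hz.
have h3 := nm_tri (rd f y) (gq h y) (rd f z); have h4 := nm_tri (gq h y) (gq h z) (rd f z).
rewrite (nmC (rd f y) (gq h y)) in h3; lra.
Qed.

End Rotation.

(** Mean value inequality along the chord from z to y: its inner points lie in the open disk, where
    f' is the derivative, and f' is close to [f' z] along it. This yields the derivative at boundary
    points too. *)
Lemma wder_closed f (f' : R[i] -> R[i]) : A0 f -> contc f' ->
  (forall z, odisk z -> cd f z = f' z) -> forall z, cdisk z -> wder (@cdisk R) f z (f' z).
Proof.
move=> [hol_f cf] cf' e z hz.
exists (fun y => if y == z then f' z else (f y - f z) / (y - z)); last first.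
  apply: nearW => y; case: eqP => [->|/eqP yz]; first by rewrite !subrr mulr0.
  by rewrite divfK// subr_eq0.
apply/cvP => r r0; have r4 : 0 < r / 4 by lra.
have /cvP /(_ _ r4) [d /= d0 hd] := cf' z hz.
exists d => //= y [cy hy]; case: eqP => [_|/eqP yz]; first by rewrite subrr nm0.
have yz0 : y - z != 0 by rewrite subr_eq0.
have pyz : 0 < nm (y - z) by rewrite nm_gt0.
have -> : (f y - f z) / (y - z) - f' z = (f y - f z - f' z * (y - z)) / (y - z) by field.
rewrite nmM nmV ltr_pdivrMr//.
pose p (s : R) := z + s%:C * (y - z).
have p1 : p 1 = y by rewrite /p mul1r addrC subrK.
have p0 : p 0 = z by rewrite /p mul0r addr0.
have dp s : cder p s (y - z).
  apply: (cder_eq (derD (der_cst _ s z) (derM (cv_real s) (der_self _ _) (der_cst _ _ (y - z))))).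
  by ring.
have := @mv01 R (fun s => f (p s)) (fun s => f' (p s) * (y - z)) (f' z * (y - z))
  (r / 4 * nm (y - z)); rewrite p1 p0 => h.
suff : nm (f y - f z - f' z * (y - z)) <= 2 * (r / 4 * nm (y - z)).
  by move=> {}h; apply: le_lt_trans h _; rewrite mulrA ltr_pM2r//; lra.
have oc (u : R) : u \in `]0, 1[%R -> u \in `[0, 1]%R by apply: subset_itv_oo_cc.
apply: h => s hs.
- have po : odisk (p s) by exact: odisk_convex.
  rewrite -e//; apply: (der_comp (cv_real s) _ (dp s)).
    exact: C1at_wder (odisk_cdisk po) (hol_f _ po).
  apply: filterS (near_in_itvoo hs) => u /oc hu; exact: cdisk_convex.
- have pc : cdisk (p s) by exact: cdisk_convex.
  apply: (cv_comp (cf _ pc)).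
    by apply: cv_within; apply: (der_cv (cv_real s) (dp s)).
  by apply: filterS (within_in `[0, 1] s) => u hu; exact: cdisk_convex.
- have pc : cdisk (p s) by apply: cdisk_convex => //; exact: oc.
  rewrite -mulrBl nmM ler_wpM2r ?nm_ge0//; apply/ltW/hd; split => //.
  rewrite /p addrAC subrr add0r nmM nmR.
  move: hs; rewrite in_itv /= => /andP[s0 s1].
  by apply: le_lt_trans hy; rewrite gtr0_norm// ler_piMl ?nm_ge0// ltW.
Qed.

Lemma boundary_neq0 z : nm z = 1 -> \forall y \near nb (@cdisk R) z, y != 0.
Proof.
move=> hz; exists 1 => [|y /= [_ hy]]; first exact: ltr01.
by apply/eqP => y0; move: hy; rewrite y0 sub0r nmN hz ltxx.
Qed.

Lemma i_neq0 : 'i != 0 :> R[i].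
Proof. by rewrite -nm_gt0 nm_i. Qed.

(** The derivative is recovered as rd f / (i z). The division is only made near the circle, where z
    does not vanish; in the open disk [cd f] is already continuous. *)
Lemma K_of_rd f : A0 f -> contc (rd f) ->
  (forall z, odisk z -> rd f z = 'i * z * cd f z) -> K f.
Proof.
move=> hf crd e.
pose f' z := if nm z < 1 then cd f z else rd f z / ('i * z).
have cf' : contc f'.
  move=> z hz; have [oz|/negbTE nz] := boolP (nm z < 1).
    rewrite {2}/f' oz; apply: (cv_near (f := cd f)); last by have [] := hf.1 z oz.
    by apply: filterS (odisk_near oz) => y oy; rewrite /f' oy.
  have z1 : nm z = 1 by apply/eqP; rewrite eq_le hz leNgt nz.
  have z0 : z != 0 by rewrite -nm_gt0 z1 ltr01.
  rewrite {2}/f' nz; apply: (cv_near (f := fun y => rd f y / ('i * y))).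
    apply: filterS (boundary_neq0 z1) => y y0; rewrite /f'; case: ifP => // oy.
    by rewrite e// mulrC mulrA mulVf ?mul1r// mulf_neq0 ?i_neq0.
  apply: cvM; first exact: crd.
  apply: cvV; first by rewrite mulf_neq0 ?i_neq0.
  by apply: cvM; [exact: cv_cst|exact: cv_id].
have hw := wder_closed hf cf' _; move=> z hz; apply: (C1atI (f' := f')) => //.
  apply: filterS (nb_in _ _) => y cy; apply: hw => // w ow; by rewrite /f' ow.
exact: cf'.
Qed.

Lemma K_div (k j : R[i] -> R[i]) : K k -> hol j ->
  (forall z, cdisk z -> k z = 'i * z * j z) -> K j.
Proof.
move=> hk hj e z hz; have [oz|/negbTE nz] := boolP (nm z < 1); first exact: hj.
have z1 : nm z = 1 by apply/eqP; rewrite eq_le hz leNgt nz.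
have z0 : z != 0 by rewrite -nm_gt0 z1 ltr01.
apply: (@C1at_near (fun y => k y * ('i * y)^-1)) => //.
  apply: filterS2 (nb_in _ _) (boundary_neq0 z1) => y cy y0.
  by rewrite e// mulrC mulrA mulVf ?mul1r// mulf_neq0 ?i_neq0.
apply: C1atM => //; first exact: hk.
apply: C1atV => //; first by rewrite mulf_neq0 ?i_neq0.
by apply: C1atM => //; [exact: C1at_cst|exact: C1at_id].
Qed.

(** The argument is run twice. [rd f] is in [A0] and its boundary loop is phi, which is again
    differentiable with continuous derivative psi; hence both f and [rd f] are in [K]. Dividing
    [rd f] = i z f' by i z near the circle gives the claim for f'. *)
Theorem regularity f (phi psi : R -> R[i]) : A0 f -> hol (cd f) ->
  (forall t, cder (fun t => f (cis t)) t (phi t)) ->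
  (forall t, cder phi t (psi t)) -> ccont psi -> K f /\ K (cd f).
Proof.
move=> hf hcd h1 h2 cpsi; have cphi := cder_cont h2.
have ho := rd_odisk hf.
have A0rd : A0 (rd f).
  split; last exact: rd_contc hf h1 cphi.
  move=> z oz; have cz := odisk_cdisk oz.
  apply: (@C1at_near (fun y => 'i * y * cd f y)) => //.
    by apply: filterS (odisk_near oz) => y /ho.
  apply: C1atM => //; last exact: hcd.
  by apply: C1atM => //; [exact: C1at_cst|exact: C1at_id].
have h1' t : cder (fun t => rd f (cis t)) t (psi t).
  have -> : (fun t => rd f (cis t)) = phi by apply/funext => s; exact: rd_cis.
  exact: h2.
have Kf : K f by apply: K_of_rd => //; exact: A0rd.2.
have Krd : K (rd f).
  apply: K_of_rd => //; first exact: rd_contc A0rd h1' cpsi.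
  exact: rd_odisk.
split => //; apply: (K_div Krd hcd) => z hz.
by apply: rdE; apply: cder_rot => //; exact: Kf.
Qed.

End Regularity.

(** * Cauchy transforms of continuous densities on the circle *)

Section CauchyTransform.
Context (R : realType).
Implicit Types (f : R[i] -> R[i]) (x y z w : R[i]).

Lemma unit_sub_neq0 (u w : R[i]) : nm u = 1 -> odisk w -> u - w != 0.
Proof.
move=> hu hw; rewrite subr_eq0; apply/eqP => e.
by move: hw; rewrite /odisk /mkset -e hu ltxx.
Qed.

Variable psi : R -> R[i].
Hypothesis cpsi : ccont psi.

(** For n = 1 the Cauchy transform of psi, and for larger n its derivative of order n - 1 divided by
    (n - 1)!. Two derivatives of an analytic function are obtained through it, without
    differentiating a power series term by term. *)
Definition cauchy_moment n w := cI (fun t => psi t / (cis t - w) ^+ n).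

Lemma cauchy_moment_cont n w : odisk w -> ccont (fun t => psi t / (cis t - w) ^+ n).
Proof.
move=> hw; apply: ccontM => //; apply: ccontV.
  by move=> t; rewrite expf_neq0// unit_sub_neq0// nm_cis.
elim: n => [|n IH].
  have -> : (fun t => (cis t - w) ^+ 0) = (fun=> 1) by [].
  exact: ccont_cst.
have -> : (fun t => (cis t - w) ^+ n.+1) = (fun t => (cis t - w) * (cis t - w) ^+ n).
  by apply/funext => t; rewrite exprS.
by apply: ccontM => //; apply: ccontD; [exact: ccont_cis|exact: ccont_cst].
Qed.

Lemma cvX T (F : set_system T) {FF : Filter F} (h : T -> R[i]) a n :
  cv F h a -> cv F (fun p => h p ^+ n) (a ^+ n).
Proof.
move=> hh; elim: n => [|n IH]; first by rewrite expr0; exact: cv_cst.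
rewrite exprS; apply: (@cv_near _ _ _ _ (fun p => h p * h p ^+ n)).
  by apply: nearW => p; rewrite exprS.
exact: cvM.
Qed.

Let cv_den w t : cv (filter_prod (nb (@odisk R) w) (nbhs t))
  (fun p => cis p.2 - p.1) (cis t - w).
Proof.
apply: cvB; first by apply: cv_snd; exact: ccont_cis.
by apply: (cv_fst (f := id)); exact: cv_id.
Qed.

Let cv_psi w t : cv (filter_prod (nb (@odisk R) w) (nbhs t)) (fun p => psi p.2) (psi t).
Proof. by apply: cv_snd; exact: cpsi. Qed.

Let den0 w t : odisk w -> cis t - w != 0.
Proof. by move=> hw; rewrite unit_sub_neq0// nm_cis. Qed.

Let nb_odisk w : \forall y \near nb (@odisk R) w, odisk y := nb_in _ _.

Lemma cauchy_moment_cv n w : odisk w -> cv (nb (@odisk R) w) (cauchy_moment n) (cauchy_moment n w).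
Proof.
move=> hw; apply: cI_cv => [||t]; first exact: cauchy_moment_cont.
  by apply: filterS (nb_odisk w) => y; exact: cauchy_moment_cont.
apply: cvM => //; apply: cvV; first by rewrite expf_neq0// den0.
by apply: cvX; exact: cv_den.
Qed.

Lemma cauchy_moment_der1 w : odisk w ->
  der (nb (@odisk R) w) id w (cauchy_moment 1) (cauchy_moment 2 w).
Proof.
move=> hw; pose q y t := psi t / (cis t - y) ^+ 1 * (cis t - w)^-1.
have cq y : odisk y -> ccont (q y).
  move=> hy; apply: ccontM; first exact: cauchy_moment_cont.
  apply: ccontV => [t|]; first exact: den0.
  by apply: ccontD; [exact: ccont_cis|exact: ccont_cst].
exists (fun y => cI (q y)).
  have -> : cauchy_moment 2 w = cI (q w).
    by apply: eq_cI => t _; rewrite /q expr1 expr2 invfM mulrA.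
  apply: cI_cv => [||t]; [exact: cq|by apply: filterS (nb_odisk w) => y; exact: cq|].
  apply: cvM.
    by apply: cvM => //; apply: cvV; [rewrite expr1 den0|exact: cv_den].
  by apply: cvV; [exact: den0|apply: (cv_snd (f := fun t => cis t - w)); apply: cvB; [exact: ccont_cis|exact: cv_cst]].
apply: filterS (nb_odisk w) => y hy; rewrite mulrC -cIZ; last exact: cq.
rewrite -cIB; try exact: cauchy_moment_cont.
apply: eq_cI => t _; rewrite /q !expr1; field; by rewrite !den0.
Qed.

Lemma cauchy_moment_der2 w : odisk w ->
  der (nb (@odisk R) w) id w (cauchy_moment 2) (2 * cauchy_moment 3 w).
Proof.
(* With u = cis t, a = u - y and b = u - w: 1/a^2 - 1/b^2 = (b - a)(a + b) / (a^2 b^2), where b - a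
   = y - w and a + b = 2 u - w - y. *)
move=> hw; pose q y t := (2 * cis t - w - y) * (cis t - w) ^-2 * (psi t / (cis t - y) ^+ 2).
have cl y : ccont (fun t => 2 * cis t - w - y).
  apply: ccontD; last exact: ccont_cst.
  apply: ccontD; last exact: ccont_cst.
  by apply: ccontM; [exact: ccont_cst|exact: ccont_cis].
have cw2 : ccont (fun t => (cis t - w) ^-2).
  apply: ccontV => [t|]; first by rewrite expf_neq0// den0.
  move=> t; apply: cvX; apply: cvB; [exact: ccont_cis|exact: cv_cst].
have cq y : odisk y -> ccont (q y).
  by move=> hy; apply: ccontM; [exact: ccontM|exact: cauchy_moment_cont].
exists (fun y => cI (q y)).
  have -> : 2 * cauchy_moment 3 w = cI (q w).
    rewrite -cIZ; last exact: cauchy_moment_cont.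
    by apply: eq_cI => t _; rewrite /q; field; rewrite den0.
  apply: cI_cv => [||t]; [exact: cq|by apply: filterS (nb_odisk w) => y; exact: cq|].
  apply: cvM; last by apply: cvM => //; apply: cvV; [rewrite expf_neq0// den0|apply: cvX; exact: cv_den].
  apply: cvM; last by apply: (cv_snd (f := fun t => (cis t - w) ^-2)); exact: cw2.
  apply: cvB; last by apply: (cv_fst (f := id)); exact: cv_id.
  apply: cvB; last exact: cv_cst.
  by apply: cvM; [exact: cv_cst|apply: cv_snd; exact: ccont_cis].
apply: filterS (nb_odisk w) => y hy; rewrite mulrC -cIZ; last exact: cq.
rewrite -cIB; try exact: cauchy_moment_cont.
apply: eq_cI => t _; rewrite /q; field; by rewrite !den0.
Qed.

End CauchyTransform.

(** * From power series to two continuous complex derivatives *)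

Section PowerSeries.
Context (R : realType).
Implicit Types (f : R[i] -> R[i]) (x y z w h : R[i]).

Lemma der_eq T (F : set_system T) (u : T -> R[i]) p (g : T -> R[i]) d e :
  der F u p g d -> d = e -> der F u p g e.
Proof. by move=> h <-. Qed.

Definition psum (a : nat -> R[i]) n h := \sum_(k < n) h ^+ k * a k.

Lemma psumS a n h : psum a n.+1 h = psum a n h + h ^+ n * a n.
Proof. by rewrite /psum big_ord_recr. Qed.

Lemma psum_K a n : K (psum a n).
Proof.
elim: n => [|n IH] z hz.
  have -> : psum a 0 = fun=> 0 by apply/funext => y; rewrite /psum big_ord0.
  exact: C1at_cst.
have -> : psum a n.+1 = fun y => psum a n y + y ^+ n * a n.
  by apply/funext => y; rewrite psumS.
apply: C1atD => //; first exact: IH.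
apply: C1atM => //; last exact: C1at_cst.
elim: n {IH} => [|n IH].
  by have -> : (fun y : R[i] => y ^+ 0) = (fun=> 1) by []; exact: C1at_cst.
have -> : (fun y : R[i] => y ^+ n.+1) = (fun y => y * y ^+ n).
  by apply/funext => y; rewrite exprS.
by apply: C1atM => //; exact: C1at_id.
Qed.

(* The terms at radius r/2 tend to 0, hence are bounded by 2. *)
Lemma psum_tail a (r : R) f : 0 < r ->
  (forall h, nm h < r -> cv \oo (fun n => psum a n h) (f h)) ->
  exists N, forall n h, (N <= n)%N -> nm h <= r / 4 ->
    nm (psum a n h - f h) <= 4 * 2^-1 ^+ n.
Proof.
move=> r0 hf; have r2 : 0 < r / 2 by lra.
have nr : nm (r / 2)%:C = r / 2 by rewrite nmR gtr0_norm.
have [N _ hN] : \forall n \near \oo, nm (psum a n (r / 2)%:C - f (r / 2)%:C) < 1.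
  have h0 : nm (r / 2)%:C < r by rewrite nr; lra.
  by move/cvP: (hf _ h0) => /(_ _ ltr01).
exists N.
have term k : (N <= k)%N -> (r / 2) ^+ k * nm (a k) <= 2.
  move=> Nk; rewrite -{1}nr -nmX -nmM.
  have -> : (r / 2)%:C ^+ k * a k = psum a k.+1 (r / 2)%:C - psum a k (r / 2)%:C.
    by rewrite psumS addrC addKr.
  have h1 := hN k Nk; have h2 := hN k.+1 (leqW Nk).
  have := nm_tri (psum a k.+1 (r / 2)%:C) (f (r / 2)%:C) (psum a k (r / 2)%:C).
  by rewrite (nmC (f _)); move: h1 h2 => /=; lra.
move=> n h Nn hr.
(* Passing from radius r / 2 to |h| <= r / 4 gains 1 / 2^k in the k-th term, which is then at most 2
   / 2^k; the right-hand side is the geometric sum of these bounds for k from n to m + n - 1. *)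
have bound m : nm (psum a n h - psum a (m + n) h) <= 4 * (2^-1 ^+ n - 2^-1 ^+ (m + n)).
  elim: m => [|m IH]; first by rewrite add0n !subrr nm0 mulr0.
  rewrite addSn; apply: le_trans (nm_tri _ (psum a (m + n) h) _) _.
  have -> : psum a (m + n) h - psum a (m + n).+1 h = - (h ^+ (m + n) * a (m + n)%N).
    by rewrite psumS; ring.
  rewrite nmN nmM nmX.
  have hk : nm h ^+ (m + n) <= 2^-1 ^+ (m + n) * (r / 2) ^+ (m + n).
    rewrite -exprMn lerXn2r ?nnegrE ?nm_ge0//; last by lra.
    by rewrite mulr_ge0 ?invr_ge0//; lra.
  have t := term (m + n)%N (leq_trans Nn (leq_addl _ _)).
  have p0 : 0 <= 2^-1 ^+ (m + n) :> R by rewrite exprn_ge0// invr_ge0.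
  have : nm h ^+ (m + n) * nm (a (m + n)%N) <= 2^-1 ^+ (m + n) * 2.
    apply: le_trans (ler_wpM2r (nm_ge0 _) hk) _.
    by rewrite -mulrA ler_wpM2l.
  by move: IH; rewrite (exprS _ (m + n)); lra.
have hr' : nm h < r by lra.
apply: (@cv_le_bound _ _ \oo _ (fun m => psum a n h - psum a m h)).
  exists n => // m /= nm'; rewrite -(subnK nm'); apply: le_trans (bound _) _.
  have p0 : 0 <= 2^-1 ^+ (m - n + n) :> R by rewrite exprn_ge0// invr_ge0.
  by lra.
by apply: cvB; [exact: cv_cst|exact: hf].
Qed.

Lemma half_pow_small (e : R) : 0 < e -> \forall n \near \oo, 4 * 2^-1 ^+ n < e.
Proof.
move=> e0; have h : (fun n => 2^-1 ^+ n : R) @ \oo --> (0 : R).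
  by apply: cvg_expr; rewrite ger0_norm ?invr_ge0// invf_lt1// ltr1n.
have e4 : 0 < e / 4 by lra.
move/cvgr0Pnorm_lt: h => /(_ _ e4); apply: filterS => n.
by rewrite ger0_norm ?exprn_ge0 ?invr_ge0//; lra.
Qed.

(** Cauchy's formula holds for the partial sums, which are polynomials, and passes to f by uniform
    convergence on the circle of radius r / 4. The density is f times cis t / (2 pi), because d xi /
    (2 i pi) = cis t dt / (2 pi). *)
Lemma power_series_cauchy a (r : R) f : 0 < r ->
  (forall h, nm h < r -> cv \oo (fun n => psum a n h) (f h)) ->
  exists2 psi : R -> R[i], ccont psi &
    forall w, odisk w -> f ((r / 4)%:C * w) = cauchy_moment psi 1 w.
Proof.
move=> r0 hf; have [N hN] := psum_tail r0 hf.
have thirds (e : R) : e = e / 3 + (e / 3 + e / 3) by lra.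
pose c := (r / 4)%:C : R[i].
have nc : nm c = r / 4 by rewrite /c nmR gtr0_norm//; lra.
have ncis t : nm (c * cis t) = r / 4 by rewrite nmM nc nm_cis mulr1.
have cS n : ccont (fun t => psum a n (c * cis t)).
  elim: n => [|n IH].
    have -> : (fun t => psum a 0 (c * cis t)) = fun=> 0.
      by apply/funext => t; rewrite /psum big_ord0.
    exact: ccont_cst.
  have -> : (fun t => psum a n.+1 (c * cis t)) =
      fun t => psum a n (c * cis t) + (c * cis t) ^+ n * a n.
    by apply/funext => y; rewrite psumS.
  apply: ccontD => //; apply: ccontM; last exact: ccont_cst.
  by move=> t; apply: cvX; apply: cvM; [exact: cv_cst|exact: ccont_cis].
have un (e : R) : 0 < e -> \forall n \near \oo, forall t, nm (psum a n (c * cis t) - f (c * cis t)) < e.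
  move=> e0; have h1 : \forall n \near \oo, (N <= n)%N by exists N.
  apply: filterS2 h1 (half_pow_small e0) => n h1 h2 t.
  by apply: le_lt_trans (hN n _ h1 _) h2; rewrite ncis.
have cf : ccont (fun t => f (c * cis t)).
  move=> t; apply/cvP => e e0; have e3 : 0 < e / 3 by lra.
  have [n hn] : exists n, forall t, nm (psum a n (c * cis t) - f (c * cis t)) < e / 3.
    by apply: (@filter_ex _ \oo); exact: un.
  move/cvP: (cS n t) => /(_ _ e3); apply: filterS => s hs.
  have h1 := hn s; have h2 := hn t.
  have h3 := nm_tri (f (c * cis s)) (psum a n (c * cis s)) (f (c * cis t)).
  have h4 := nm_tri (psum a n (c * cis s)) (psum a n (c * cis t)) (f (c * cis t)).
  rewrite (nmC (f (c * cis s)) (psum a n _)) in h3; apply: (le_lt_trans h3).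
  rewrite (thirds e).
  by apply: ltrD => //; apply: (le_lt_trans h4); exact: ltrD.
have pi0 := pi_gt0 R.
have p2 : (2 * pi)%:C != 0 :> R[i] by rewrite fmorph_eq0; apply: lt0r_neq0; lra.
exists (fun t => (2 * pi)%:C^-1 * (f (c * cis t) * cis t)).
  by apply: ccontM; [exact: ccont_cst|apply: ccontM => //; exact: ccont_cis].
move=> w hw; have hs : (1 : R) = 1 \/ (1 : R) = -1 by left.
have ck := cauchy_kernel_cont 1 hw; have ck' : ccont (fun t => cis t / (cis t - w)).
  by move=> t; have := ck t; under eq_fun do rewrite mul1r; rewrite mul1r; exact.
have cw : nm (c * w) < r.
  by rewrite nmM nc; have := nm_ge0 w; have : nm w < 1 := hw; nra.
have cfk : ccont (fun t => f (c * cis t) * (cis t / (cis t - w))) by exact: ccontM.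
have lim1 : cv \oo (fun n => cI (fun t => psum a n (c * cis t) * (cis t / (cis t - w))))
    (cI (fun t => f (c * cis t) * (cis t / (cis t - w)))).
  apply: cI_cv => [//||t]; first by apply: nearW => n; exact: ccontM.
  apply: cvM; last by apply: (cv_snd (f := fun t => cis t / (cis t - w))); exact: ck'.
  apply/cvP => e e0; have e2 : 0 < e / 2 by lra.
  have c2 : cv (filter_prod \oo (nbhs t)) (fun p => f (c * cis p.2)) (f (c * cis t)).
    by apply: (cv_snd (f := fun t => f (c * cis t))); exact: cf.
  move/cvP: c2 => /(_ _ e2) h1.
  have h2 : \forall p \near filter_prod \oo (nbhs t),
      forall t, nm (psum a p.1 (c * cis t) - f (c * cis t)) < e / 2.
    exact: (near_fst (un _ e2)).
  apply: filterS2 h1 h2 => p h1 h2; have := h2 p.2.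
  by have := nm_tri (psum a p.1 (c * cis p.2)) (f (c * cis p.2)) (f (c * cis t)); lra.
have eqI n : cI (fun t => psum a n (c * cis t) * (cis t / (cis t - w))) =
    (2 * pi)%:C * psum a n (c * w).
  have Kn : A0 (fun z => psum (fun k => c ^+ k * a k) n z) by apply: K_A0; exact: psum_K.
  have es z : psum (fun k => c ^+ k * a k) n z = psum a n (c * z).
    by apply: eq_bigr => k _; rewrite exprMn mulrCA mulrA.
  rewrite -es -(cauchy_formula hs hw Kn); apply: eq_cI => t _.
  by rewrite mul1r es.
have lim2 : cv \oo (fun n => cI (fun t => psum a n (c * cis t) * (cis t / (cis t - w))))
    ((2 * pi)%:C * f (c * w)).
  apply: (@cv_near _ _ _ _ (fun n => (2 * pi)%:C * psum a n (c * w))).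
    by apply: nearW => n; rewrite eqI.
  by apply: cvM; [exact: cv_cst|exact: hf].
apply: (mulfI p2); rewrite -/c -(cv_unique lim1 lim2) -cIZ.
  by apply: eq_cI => t _; rewrite expr1 !mulrA mulfV// mul1r.
apply: cauchy_moment_cont => //.
by apply: ccontM; [exact: ccont_cst|apply: ccontM => //; exact: ccont_cis].
Qed.

(** What is retained of analyticity at a point: enough for [regularity], and easy to transport by w
    = 1/x. *)
Definition C2near f x := exists2 r : R, 0 < r & exists f1 f2, forall y, nm (y - x) < r ->
  [/\ der (nb setT y) id y f (f1 y), der (nb setT y) id y f1 (f2 y) &
      cv (nb setT y) f2 (f2 y)].

Lemma power_series_C2near a (r : R) f x : 0 < r ->
  (forall h, nm h < r -> cv \oo (fun n => psum a n h) (f (x + h))) -> C2near f x.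
Proof.
move=> r0 hf; have [psi cpsi hpsi] := power_series_cauchy (f := fun h => f (x + h)) r0 hf.
pose c := (r / 4)%:C : R[i]; have r4 : 0 < r / 4 by lra.
have c0 : c != 0 by rewrite fmorph_eq0 gt_eqF.
pose g y := c^-1 * (y - x); pose P := cauchy_moment psi.
have go y : nm (y - x) < r / 4 -> odisk (g y).
  by move=> hy; rewrite /odisk /mkset nmM nmV nmR gtr0_norm// mulrC ltr_pdivrMr// mul1r.
have dg y : der (nb setT y) id y g c^-1.
  have := derZ (cv_id setT y) c^-1 (derB (der_self id y) (der_cst id y x)).
  by rewrite subr0 mulr1; exact.
have near_go y : nm (y - x) < r / 4 -> \forall z \near nb setT y, nm (z - x) < r / 4.
  move=> hy; exists (r / 4 - nm (y - x)); first by rewrite /= subr_gt0.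
  by move=> z /= [_ hz]; have := nm_tri z y x; lra.
exists (r / 4) => //.
exists (fun y => P 2 (g y) * c^-1), (fun y => 2 * P 3 (g y) * c^-1 * c^-1) => y hy.
have hgo : \forall z \near nb setT y, odisk (g z).
  by apply: filterS (near_go y hy) => z; exact: go.
have cg : cv (nb setT y) g (g y) by apply: (der_cv (cv_id _ _) (dg y)).
split.
- have fE z : nm (z - x) < r / 4 -> P 1 (g z) = f z.
    move=> /go hz; rewrite /P -hpsi// mulrA mulfV ?mul1r; first by rewrite addrC subrK.
    by [].
  apply: (@der_near _ _ _ _ _ _ (fun z => P 1 (g z))); first exact: fE.
    by apply: filterS (near_go y hy) => z; exact: fE.
  apply: (der_comp (cv_id _ _) _ (dg y) hgo); apply: cauchy_moment_der1 => //; exact: go.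
- have h := der_comp (cv_id _ _) (cauchy_moment_der2 cpsi (go y hy)) (dg y) hgo.
  have := derM (cv_id setT y) (h _) (der_cst id y c^-1); rewrite mulr0 addr0; exact.
- apply: cvM; last exact: cv_cst.
  apply: cvM; last exact: cv_cst.
  apply: cvM; first exact: cv_cst.
  by apply: (cv_comp (cauchy_moment_cv cpsi 3 (go y hy)) cg).
Qed.

(** Carries regularity at a finite point of the exterior to the coordinate w = 1/x; the two
    derivatives come from the chain rule with (1/y)' = -1/y^2. *)
Lemma C2near_inv f x : x != 0 -> C2near f x^-1 -> C2near (fun y => f y^-1) x.
Proof.
move=> x0 [r r0 [f1 [f2 hf]]].
have cinv y : y != 0 -> cv (nb setT y) (fun z => z^-1) y^-1.
  by move=> y0; apply: cvV => //; exact: cv_id.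
have /cvP /(_ _ r0) [d /= d0 hd] := cinv x x0.
have nx : 0 < nm x by rewrite nm_gt0.
exists (Num.min d (nm x)); first by rewrite lt_min d0.
exists (fun y => f1 y^-1 * (- 1 / y ^+ 2)),
  (fun y => f2 y^-1 * (- 1 / y ^+ 2) * (- 1 / y ^+ 2) + f1 y^-1 * (2 / y ^+ 3)) => y.
rewrite lt_min => /andP[y1 y2].
have y0 : y != 0 by apply/eqP => e; move: y2; rewrite e sub0r nmN ltxx.
have [h1 h2 h3] := hf y^-1 (hd y (conj I y1)).
have di : der (nb setT y) id y (fun z => z^-1) (- 1 / y ^+ 2).
  exact: (derV (cv_id setT y) y0 (der_self id y)).
have near_T : \forall z \near nb setT y, setT (z^-1 : R[i]) by apply: nearW.
have g1 : der (nb setT y) id y (fun z => f z^-1) (f1 y^-1 * (- 1 / y ^+ 2)).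
  exact: (der_comp (cv_id _ _) h1 di near_T).
have g2 : der (nb setT y) id y (fun z => f1 z^-1) (f2 y^-1 * (- 1 / y ^+ 2)).
  exact: (der_comp (cv_id _ _) h2 di near_T).
have dd : der (nb setT y) id y (fun z => -1 / z ^+ 2) (2 / y ^+ 3).
  have y20 : y ^+ 2 != 0 by rewrite expf_neq0.
  have hX : der (nb setT y) id y (fun z => z ^+ 2) (2%:R * y ^+ 1 * 1).
    exact: (derX (cv_id setT y) 2 (der_self id y)).
  apply: (der_eq (derZ (cv_id setT y) (-1) (derV (cv_id setT y) (f := fun z => z ^+ 2) y20 hX))).
  by field.
split => //.
- by apply: derM g2 dd; exact: cv_id.
have ci := cinv y y0.
have cf1 : cv (nb setT y) (fun z => f1 z^-1) (f1 y^-1).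
  by apply: (der_cv (cv_id _ _) g2).
have cp n : cv (nb setT y) (fun z => (z ^+ n)^-1) (y ^+ n)^-1.
  by apply: cvV; [rewrite expf_neq0|apply: cvX; exact: cv_id].
have cm : cv (nb setT y) (fun z => -1 / z ^+ 2) (-1 / y ^+ 2).
  by apply: cvM; [exact: cv_cst|exact: cp].
apply: cvD; last by apply: cvM => //; apply: cvM; [exact: cv_cst|exact: cp].
by do 2 apply: cvM => //; apply: (cv_comp h3 ci).
Qed.

Lemma nb_setT (S : set R[i]) z : nb setT z `<=` nb S z.
Proof. by apply: (@nbS R S setT z 1) => //; exact: ltr01. Qed.

Lemma cvS (S : set R[i]) z f a : cv (nb setT z) f a -> cv (nb S z) f a.
Proof. by move=> /cvP h; apply/cvP => e /h; exact: nb_setT. Qed.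

Lemma derS (S : set R[i]) z f d : der (nb setT z) id z f d -> wder S f z d.
Proof. by move=> [q hq e]; exists q; [exact: cvS|exact: nb_setT]. Qed.

Lemma C2near_C1at f z : odisk z -> C2near f z -> C1at f z /\ C1at (cd f) z.
Proof.
move=> oz [r r0 [f1 [f2 hf]]]; have cz := odisk_cdisk oz.
have z0 : nm (z - z) < r by rewrite subrr nm0.
have nz := nb_lt (@cdisk R) z r0.
have e1 : \forall y \near nb (@cdisk R) z, f1 y = cd f y.
  apply: filterS2 (nb_in _ _) nz => y cy /hf [h _ _].
  by rewrite (cdE cy (derS _ h)).
split.
  apply: (C1atI (f' := f1)) => //.
    by apply: filterS nz => y /hf [h _ _]; exact: derS.
  by have [_ h _] := hf z z0; apply: cvS; apply: (der_cv (cv_id _ _) h).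
apply: (C1at_near cz e1); apply: (C1atI (f' := f2)) => //.
  by apply: filterS nz => y /hf [_ h _]; exact: derS.
by have [_ _ h] := hf z z0; exact: cvS.
Qed.

End PowerSeries.

(** * Circle integrals for functions inside and outside, gluing, and extension to the circle *)

Section CircleFormulas.
Context (R : realType).
Implicit Types (f g : R[i] -> R[i]) (x y z w : R[i]) (t : R).

Lemma A0_id : A0 (@id R[i]).
Proof. by apply: K_A0 => z hz; exact: C1at_id. Qed.

Lemma cisNV t : cis (-1 * t) = (cis t)^-1 :> R[i].
Proof. by rewrite mulN1r cisN. Qed.

Lemma mean_value (sg : R) f : sg = 1 \/ sg = -1 -> A0 f ->
  cI (fun t => f (cis (sg * t))) = (2 * pi)%:C * f 0.
Proof.
move=> hs hf; have h0 : nm (0 : R[i]) < 1 by rewrite nm0.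
rewrite -(cauchy_formula hs h0 hf); apply: eq_cI => t _.
by rewrite subr0 divff ?mulr1// cis_neq0.
Qed.

Lemma mean_value_cis f : A0 f -> cI (fun t => f (cis t)) = (2 * pi)%:C * f 0.
Proof.
move=> hf; rewrite -(mean_value (or_introl erefl) hf).
by apply: eq_cI => t _; rewrite mul1r.
Qed.

Lemma mean_value_inv f : A0 f -> cI (fun t => f (cis t)^-1) = (2 * pi)%:C * f 0.
Proof.
move=> hf; rewrite -(mean_value (or_intror erefl) hf).
by apply: eq_cI => t _; rewrite cisNV.
Qed.

Lemma cauchy_in f x : A0 f -> nm x < 1 ->
  cI (fun t => f (cis t) * (cis t / (cis t - x))) = (2 * pi)%:C * f x.
Proof.
move=> hf hx; rewrite -(cauchy_formula (or_introl erefl) hx hf).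
by apply: eq_cI => t _; rewrite mul1r.
Qed.

(** For |x| > 1 the function z / (z - x) is in [A0] and vanishes at 0, so the mean value property
    gives 0. *)
Lemma cauchy_out f x : A0 f -> 1 < nm x ->
  cI (fun t => f (cis t) * (cis t / (cis t - x))) = 0.
Proof.
move=> hf hx; rewrite (mean_value_cis (f := fun z => f z * (z / (z - x)))).
  by rewrite mul0r !mulr0.
apply: A0M => //; apply: A0M; first exact: A0_id.
apply: A0V; last by apply: A0B; [exact: A0_id|exact: A0_cst].
move=> z; rewrite /cdisk /mkset => hz; rewrite subr_eq0; apply/eqP => e.
by move: hx; rewrite -e ltNge hz.
Qed.

Lemma cis_sub_neq0 t x : nm x <> 1 -> cis t - x != 0.
Proof. by move=> hx; rewrite subr_eq0; apply/eqP => e; apply: hx; rewrite -e nm_cis. Qed.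

Let A0_kernel x : nm x < 1 -> A0 (fun w => (1 - x * w)^-1).
Proof.
move=> hx; apply: A0V; last first.
  apply: A0B; first exact: A0_cst.
  by apply: A0M; [exact: A0_cst|exact: A0_id].
move=> z; rewrite /cdisk /mkset => hz; rewrite subr_eq0; apply/eqP => e.
have := nm1 R; rewrite e nmM; have := nm_ge0 x; have := nm_ge0 z; nra.
Qed.

Let kernel_inv x t : nm x <> 1 -> cis t / (cis t - x) = (1 - x * (cis t)^-1)^-1.
Proof.
move=> hx; have c0 := cis_neq0 t; have s0 := cis_sub_neq0 t hx.
rewrite -[LHS]invrK; congr (_^-1); rewrite invf_div mulrBl mulfV//.
Qed.

(** In w = 1/xi the kernel xi / (xi - x) becomes 1 / (1 - x w), which for |x| < 1 is in [A0] with
    value 1 at w = 0; the mean value property applies to its product with f. *)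
Lemma cauchy_in_inv f x : A0 f -> nm x < 1 ->
  cI (fun t => f (cis t)^-1 * (cis t / (cis t - x))) = (2 * pi)%:C * f 0.
Proof.
move=> hf hx; have hk := A0M hf (A0_kernel hx).
transitivity ((2 * pi)%:C * (f 0 * (1 - x * 0)^-1)); last first.
  by rewrite mulr0 subr0 invr1 mulr1.
rewrite -(mean_value_inv hk); apply: eq_cI => t _; rewrite kernel_inv//.
by move=> e; move: hx; rewrite e ltxx.
Qed.

Lemma ccont_disk (sg : R) f : A0 f -> ccont (fun t => f (cis (sg * t))).
Proof.
move=> hf; apply: (ccont_path hf.2); first exact: ccont_cisM.
by move=> t; exact: cdisk_cis.
Qed.

Lemma ccont_disk_inv f : A0 f -> ccont (fun t => f (cis t)^-1).
Proof.
move=> hf; have := ccont_disk (-1) hf.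
by congr (ccont _); apply/funext => t; rewrite cisNV.
Qed.

(** In w = 1/xi the kernel is 1 - w / (w - 1/x), with 1/x inside the disk: the first term gives the
    mean value of f, the second Cauchy's formula at 1/x. *)
Lemma cauchy_out_inv f x : A0 f -> 1 < nm x ->
  cI (fun t => f (cis t)^-1 * (cis t / (cis t - x))) = (2 * pi)%:C * (f 0 - f x^-1).
Proof.
move=> hf hx; have x0 : x != 0 by rewrite -nm_gt0; apply: lt_trans hx; exact: ltr01.
have hx' : nm x^-1 < 1 by rewrite nmV invf_lt1// (lt_trans ltr01).
have hs : (-1 : R) = 1 \/ (-1 : R) = -1 by right.
rewrite mulrBr -(mean_value hs hf) -(cauchy_formula hs hx' hf) -cIB.
- apply: eq_cI => t _; rewrite cisNV.
  have c0 := cis_neq0 t; have s0 : cis t - x != 0.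
    by apply: cis_sub_neq0 => e; move: hx; rewrite e ltxx.
  have s1 : x - cis t != 0 by rewrite -opprB oppr_eq0.
  have -> : (cis t)^-1 - x^-1 = (x - cis t) / (cis t * x) by field; rewrite c0 x0.
  have e2 : (cis t)^-1 * (cis t * x / (x - cis t)) = x / (x - cis t).
    by rewrite -[cis t * x / _]mulrA mulKf.
  rewrite invf_div e2 -[X in _ = X - _]mulr1 -mulrBr; congr (_ * _).
  by rewrite -(opprB x) invrN mulrN -mulNr -[X in _ = X - _](mulfV s1) -mulrBl; congr (_ / _); ring.
- exact: ccont_disk.
- by apply: ccontM; [exact: ccont_disk|exact: cauchy_kernel_cont].
Qed.

(** Liouville's theorem for the function equal to f inside and to g (1/x) outside. The same circle
    integral is computed from f as a value at x and from g as a value at the centre; the second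
    identity exchanges the roles. *)
Lemma glued_constant f g : A0 f -> A0 g -> (forall t, f (cis t) = g (cis t)^-1) ->
  forall x, nm x < 1 -> f x = g 0 /\ g x = f 0.
Proof.
move=> hf hg e x hx; have pi0 := pi_gt0 R.
have p2 : (2 * pi)%:C != 0 :> R[i] by rewrite fmorph_eq0; apply: lt0r_neq0; lra.
split; apply: (mulfI p2).
  rewrite -(cauchy_in hf hx) -(cauchy_in_inv hg hx).
  by apply: eq_cI => t _; rewrite e.
rewrite -(cauchy_formula (or_intror erefl) hx hg).
have hk := A0M hf (A0_kernel hx).
transitivity ((2 * pi)%:C * (f 0 * (1 - x * 0)^-1)); last first.
  by rewrite mulr0 subr0 invr1 mulr1.
rewrite -(mean_value_cis hk); apply: eq_cI => t _; rewrite cisNV e.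
have c0 := cis_neq0 t; congr (_ * _).
rewrite -[LHS]invrK; congr (_^-1); rewrite invf_div invrK mulrBl mulVf//.
Qed.

(** With u = cis t - x, expand 1 / (u - h) in powers of q = h / u. If |h| is below half the distance
    from x to the circle then |q| <= 1/2, so convergence is uniform in t. [T n] is the integrand
    with the first n terms summed in closed form. *)
Lemma cI_geometric (al : R -> R[i]) x : ccont al -> nm x <> 1 ->
  exists2 r : R, 0 < r & forall h, nm h < r ->
    cv \oo (psum (fun k => cI (fun t => al t / (cis t - x) ^+ k.+1)) ^~ h)
      (cI (fun t => al t / (cis t - (x + h)))).
Proof.
move=> ca hx; pose d := `|1 - nm x|.
have d0 : 0 < d by rewrite normr_gt0 subr_eq0 eq_sym; apply/eqP.
have d2 : 0 < d / 2 by lra.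
pose u t := cis t - x.
have nu t : d <= nm (u t) by have := nm_dist (cis t) x; rewrite nm_cis.
have cu : ccont u by apply: ccontD; [exact: ccont_cis|exact: ccont_cst].
have u0 t : u t != 0 by rewrite -nm_gt0; apply: lt_le_trans (nu t).
exists (d / 2) => // h hh.
have uh0 t : u t - h != 0.
  rewrite subr_eq0; apply/eqP => e; have := nu t; rewrite e; lra.
have cuV : ccont (fun t => (u t)^-1) by exact: ccontV.
have cuh : ccont (fun t => (u t - h)^-1).
  by apply: ccontV => //; apply: ccontD => //; exact: ccont_cst.
pose q t := h / u t.
have cq : ccont q by apply: ccontM => //; exact: ccont_cst.
have nq t : nm (q t) <= 2^-1.
  rewrite nmM nmV ler_pdivrMr; last by apply: lt_le_trans (nu t).
  by have := nu t; lra.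
pose T n t := al t * ((1 - q t ^+ n) * (u t - h)^-1).
have cqn n : ccont (fun t => q t ^+ n) by move=> t; exact: cvX.
have cT n : ccont (T n).
  apply: ccontM => //; apply: ccontM => //; apply: ccontD; first exact: ccont_cst.
  exact: ccontN.
have cc n : ccont (fun t => al t / u t ^+ n).
  apply: ccontM => //; apply: ccontV => [t|]; first by rewrite expf_neq0.
  by move=> t; apply: cvX; exact: cu.
have eT n : psum (fun k => cI (fun t => al t / (cis t - x) ^+ k.+1)) n h = cI (T n).
  elim: n => [|n IH].
    transitivity (cI (fun=> (0 : R[i]))); first by rewrite cI_cst mulr0 /psum big_ord0.
    by apply: eq_cI => t _; rewrite /T expr0 subrr mul0r mulr0.
  rewrite psumS IH -cIZ; last exact: (cc n.+1).
  rewrite -cID//; last by apply: ccontM; [exact: ccont_cst|exact: (cc n.+1)].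
  apply: eq_cI => t _; rewrite /T /q -/(u t) !expr_div_n !exprS.
  have un : u t ^+ n != 0 by rewrite expf_neq0.
  by field; rewrite un u0 uh0.
apply: (@cv_near _ _ _ _ (fun n => cI (T n))); first by apply: nearW => n; rewrite eT.
have -> : cI (fun t => al t / (cis t - (x + h))) = cI (fun t => al t * ((1 - 0) * (u t - h)^-1)).
  by apply: eq_cI => t _; rewrite subr0 mul1r /u opprD addrA.
apply: cI_cv => [||t].
- by apply: ccontM => //; apply: ccontM => //; exact: ccont_cst.
- by apply: nearW.
apply: cvM; first by apply: cv_snd; exact: ca.
apply: cvM; last by apply: (cv_snd (f := fun t => (u t - h)^-1)); exact: cuh.
apply: cvB; first exact: cv_cst.
have c1 : (fun p : nat * R => 2^-1 ^+ p.1 : R) @ filter_prod \oo (nbhs t) --> (0 : R).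
  have h0 : (fun n => 2^-1 ^+ n : R) @ \oo --> (0 : R).
    by apply: cvg_expr; rewrite ger0_norm ?invr_ge0// invf_lt1// ltr1n.
  apply/cvgr0Pnorm_lt => e e0.
  apply: (near_fst (P := fun n => `|2^-1 ^+ n : R| < e)).
  by move/cvgr0Pnorm_lt: h0 => /(_ _ e0).
apply: (cv_le _ c1); apply: nearW => p; rewrite subr0 nmX lerXn2r ?nnegrE ?nm_ge0// invr_ge0.
Qed.

(** Cauchy's formula with its kernel expanded by [cI_geometric]. At z = 0, in the coordinate w, it
    gives analyticity at infinity. *)
Lemma A0_series f z : A0 f -> odisk z -> exists (a : nat -> R[i]) (r : R), 0 < r /\
  forall h, nm h < r -> cv \oo (psum a ^~ h) (f (z + h)).
Proof.
move=> hf hz; have pi0 := pi_gt0 R.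
have p2 : (2 * pi)%:C != 0 :> R[i] by rewrite fmorph_eq0; apply: lt0r_neq0; lra.
pose al t := (2 * pi)%:C^-1 * (f (cis t) * cis t).
have cf : ccont (fun t => f (cis t)).
  by apply: (ccont_path hf.2); [exact: ccont_cis|move=> t; exact: cdisk_cis].
have ca : ccont al.
  by apply: ccontM; [exact: ccont_cst|apply: ccontM => //; exact: ccont_cis].
have hz1 : nm z <> 1 by move=> e; move: hz; rewrite /odisk /mkset e ltxx.
have [r r0 hr] := cI_geometric ca hz1.
exists (fun k => cI (fun t => al t / (cis t - z) ^+ k.+1)), (Num.min r (1 - nm z)).
have hz' : nm z < 1 := hz.
split=> [|h]; first by rewrite lt_min r0 subr_gt0.
rewrite lt_min => /andP[h1 h2].
have hzh : nm (z + h) < 1 by have := nmD z h; lra.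
have -> : f (z + h) = cI (fun t => al t / (cis t - (z + h))); last exact: hr.
apply: (mulfI p2); rewrite -(cauchy_in hf hzh) -cIZ.
  by apply: eq_cI => t _; rewrite /al !mulrA mulfV// mul1r.
apply: ccontM => //; apply: ccontV.
  by move=> t; apply: cis_sub_neq0 => e; move: hzh; rewrite e ltxx.
by apply: ccontD; [exact: ccont_cis|exact: ccont_cst].
Qed.

Lemma C2near_eq f g x (r : R) : 0 < r -> (forall y, nm (y - x) < r -> f y = g y) ->
  C2near f x -> C2near g x.
Proof.
move=> r0 e [d d0 [f1 [f2 hf]]]; exists (Num.min d r); first by rewrite lt_min d0.
exists f1, f2 => y; rewrite lt_min => /andP[y1 y2]; have [h1 h2 h3] := hf y y1.
split => //; apply: der_near h1; first exact: e.
exists (r - nm (y - x)); first by rewrite /= subr_gt0.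
by move=> w /= [_ hw]; apply: e; have := nm_tri w y x; lra.
Qed.

Lemma circle_odisk_proper z : nm z = 1 -> ProperFilter (nb (@odisk R) z).
Proof.
move=> hz; apply: Build_ProperFilter_ex => P [d /= d0 hP].
pose e := Num.min (d / 2) (1 / 2); have e0 : 0 < e by rewrite lt_min; apply/andP; split; lra.
have [e1 e2] : e <= d / 2 /\ e <= 1 / 2 by split; rewrite ge_min lexx ?orbT.
exists ((1 - e)%:C * z); apply: hP; split.
  by rewrite /odisk /mkset nmM hz mulr1 nmR ger0_norm; lra.
rewrite -[X in _ - X]mul1r -mulrBl -rmorphB nmM hz mulr1 nmR addrAC subrr add0r normrN.
rewrite gtr0_norm//; lra.
Qed.

(** At a point y of the circle near z, [b y] is a limit of values of f at interior points near z,
    hence close to the value at z. Continuity along the circle thus comes from the interior. *)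
Lemma C0_extend f (b : R[i] -> R[i]) :
  (forall z, odisk z -> cv (nb (@odisk R) z) f (f z)) ->
  (forall z, nm z = 1 -> cv (nb (@odisk R) z) f (b z)) ->
  contc (fun z => if nm z < 1 then f z else b z).
Proof.
move=> h1 h2 z hz.
set F := fun z => _.
have cF : cv (nb (@odisk R) z) f (F z).
  rewrite /F; case: ifP => hz'; first exact: h1.
  by apply: h2; apply/eqP; rewrite eq_le hz leNgt hz'.
apply/cvP => e e0; have e2 : 0 < e / 2 by lra.
move/cvP: cF => /(_ _ e2) [d /= d0 hd].
exists d => // y [cy hy]; rewrite {1}/F; case: ifP => hy'.
  by apply: lt_trans (hd y (conj hy' hy)) _; lra.
have y1 : nm y = 1 by apply/eqP; rewrite eq_le cy leNgt hy'.
apply: (@le_lt_trans _ _ (e / 2)); last by lra.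
apply: (@cv_le_bound _ _ _ (circle_odisk_proper y1) (fun w => f w - F z)).
  exists (d - nm (y - z)); first by rewrite /= subr_gt0.
  move=> w /= [ow hw]; apply/ltW/hd; split => //.
  by have := nm_tri w y z; lra.
by apply: cvB; [exact: h2|exact: cv_cst].
Qed.

Lemma disk_loop f (b : R[i] -> R[i]) (phi psi : R -> R[i]) :
  (forall z, odisk z -> C2near f z) ->
  (forall z, nm z = 1 -> cv (nb (@odisk R) z) f (b z)) ->
  (forall t, cder (fun t => b (cis t)) t (phi t)) ->
  (forall t, cder phi t (psi t)) -> ccont psi ->
  let F z := if nm z < 1 then f z else b z in K F /\ K (cd F).
Proof.
move=> hf hb h1 h2 cpsi F.
have hF z : odisk z -> C2near F z.
  move=> oz; have oz' : nm z < 1 := oz.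
  apply: (@C2near_eq f _ _ (1 - nm z)) => [|y hy|]; [by rewrite subr_gt0| |exact: hf].
  by rewrite /F ifT//; have := nmD (y - z) z; rewrite subrK; lra.
apply: (@regularity _ F phi psi) => //.
- split; first by move=> z oz; have [] := C2near_C1at oz (hF z oz).
  apply: C0_extend => // z oz; have [r r0 [f1 [f2 h]]] := hf z oz.
  have [|d _ _] := h z; first by rewrite subrr nm0.
  by apply: cvS; apply: (der_cv (cv_id _ _) d).
- by move=> z oz; have [] := C2near_C1at oz (hF z oz).
- move=> t; have -> : (fun t => F (cis t)) = fun t => b (cis t) => //.
  by apply/funext => s; rewrite /F nm_cis ltxx.
Qed.

End CircleFormulas.

(** * Classes of functions stable under sums and products, applied to matrix entries *)

Section Closure.
Context (R : realType) (P : (R[i] -> R[i]) -> Prop).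
Hypotheses (Pcst : forall a, P (fun=> a))
  (PD : forall f g, P f -> P g -> P (fun z => f z + g z))
  (PM : forall f g, P f -> P g -> P (fun z => f z * g z)).

Lemma closed_sum I (r : seq I) (Q : pred I) (F : I -> R[i] -> R[i]) :
  (forall i, P (F i)) -> P (fun z => \sum_(i <- r | Q i) F i z).
Proof.
move=> hF; elim: r => [|i r IH].
  by rewrite (_ : (fun _ => _) = fun=> 0)//; apply/funext => z; rewrite big_nil.
have [Qi|nQi] := boolP (Q i).
  rewrite (_ : (fun _ => _) = fun z => F i z + \sum_(i <- r | Q i) F i z); first exact: PD.
  by apply/funext => z; rewrite big_cons Qi.
rewrite (_ : (fun _ => _) = fun z => \sum_(i <- r | Q i) F i z)//.
by apply/funext => z; rewrite big_cons (negbTE nQi).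
Qed.

Lemma closed_prod I (r : seq I) (Q : pred I) (F : I -> R[i] -> R[i]) :
  (forall i, P (F i)) -> P (fun z => \prod_(i <- r | Q i) F i z).
Proof.
move=> hF; elim: r => [|i r IH].
  by rewrite (_ : (fun _ => _) = fun=> 1)//; apply/funext => z; rewrite big_nil.
have [Qi|nQi] := boolP (Q i).
  rewrite (_ : (fun _ => _) = fun z => F i z * \prod_(i <- r | Q i) F i z); first exact: PM.
  by apply/funext => z; rewrite big_cons Qi.
rewrite (_ : (fun _ => _) = fun z => \prod_(i <- r | Q i) F i z)//.
by apply/funext => z; rewrite big_cons (negbTE nQi).
Qed.

Definition entrywise m n (M : R[i] -> 'M[R[i]]_(m, n)) := forall i j, P (fun z => M z i j).

Lemma closed_mulmx m n p (M : R[i] -> 'M[R[i]]_(m, n)) (L : R[i] -> 'M[R[i]]_(n, p)) :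
  entrywise M -> entrywise L -> entrywise (fun z => M z *m L z).
Proof.
move=> hM hL i j; rewrite (_ : (fun _ => _) = fun z => \sum_k M z i k * L z k j).
  by apply: closed_sum => k; exact: PM.
by apply/funext => z; rewrite mxE.
Qed.

Lemma closed_det n (M : R[i] -> 'M[R[i]]_n) : entrywise M -> P (fun z => \det (M z)).
Proof.
move=> hM; apply: closed_sum => s; apply: PM => //.
exact: closed_prod.
Qed.

End Closure.

(** * Inverses of matrices with entries in [K] *)

Section InverseMatrix.
Context (R : realType).

Lemma Kcst (a : R[i]) : K (fun=> a).
Proof. by move=> z hz; exact: C1at_cst. Qed.

Lemma K_id : K (@id R[i]).
Proof. by move=> z hz; exact: C1at_id. Qed.

Lemma KD (f g : R[i] -> R[i]) : K f -> K g -> K (fun z => f z + g z).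
Proof. by move=> hf hg z hz; apply: C1atD; auto. Qed.

Lemma KM (f g : R[i] -> R[i]) : K f -> K g -> K (fun z => f z * g z).
Proof. by move=> hf hg z hz; apply: C1atM; auto. Qed.

Lemma K_eq (f g : R[i] -> R[i]) : (forall z, cdisk z -> f z = g z) -> K f -> K g.
Proof.
move=> e hf z hz; apply: (C1at_near hz) (hf z hz).
by apply: filterS (nb_in _ _) => y; exact: e.
Qed.

Lemma K_invmx n (M : R[i] -> 'M[R[i]]_n) : (forall z, cdisk z -> M z \in unitmx) ->
  entrywise (@K R) M -> entrywise (@K R) (fun z => invmx (M z)).
Proof.
move=> hu hM i j.
(* Cramer's rule: a cofactor divided by the determinant. *)
apply: (@K_eq (fun z => (\det (M z))^-1 * ((-1) ^+ (j + i) * \det (row' j (col' i (M z)))))).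
  by move=> z /hu hz; rewrite /invmx hz !mxE.
have hd m (L : R[i] -> 'M[R[i]]_m) : entrywise (@K R) L -> K (fun z => \det (L z)).
  by move=> hL; apply: closed_det => //; [exact: Kcst|exact: KD|exact: KM].
apply: KM; last first.
  apply: KM; first exact: Kcst.
  apply: hd => k l; rewrite (_ : (fun _ => _) = fun z => M z (lift j k) (lift i l))//.
  by apply/funext => z; rewrite !mxE.
move=> z hz; apply: C1atV => //; last exact: hd.
by have := hu z hz; rewrite unitmxE unitfE.
Qed.

End InverseMatrix.

(** * Translation to the topology of complex matrices *)

Section Topology.
Context (R : realType).
Implicit Types (x y z w : R[i]) (S : set R[i]).

Lemma pos_real (e : R[i]) : 0 < e -> exists2 r : R, 0 < r & e = r%:C.
Proof. by case: e => a b; rewrite ltcE /= => /andP[/eqP -> ha]; exists a. Qed.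

Lemma nbhs_nm z (P : set R[i]) : nbhs z P <-> exists2 d : R, 0 < d &
  forall y, nm (y - z) < d -> P y.
Proof.
split=> [/nbhs_ballP [e /= /pos_real [d d0 ->] h]|[d d0 h]].
  by exists d => // y hy; apply: h; rewrite -ball_normE /= nmE ltcR nmC.
apply/nbhs_ballP; exists d%:C => /=; first by rewrite ltcR.
by move=> y; rewrite -ball_normE /= nmE ltcR nmC; exact: h.
Qed.

Lemma nb_within S z (P : set R[i]) : nb S z P <-> within S (nbhs z) P.
Proof.
split=> [[d /= d0 h]|].
  by apply/nbhs_nm; exists d => // y hy Sy; apply: h.
by move=> /nbhs_nm [d d0 h]; exists d => //= y [Sy hy]; apply: h.
Qed.

Lemma cv_within_nb S z (f : R[i] -> R[i]) a :
  cv (within S (nbhs z)) f a <-> cv (nb S z) f a.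
Proof. by split=> /cvP h; apply/cvP => e /h /nb_within. Qed.

Lemma mx_norm_entry m n (M : 'M[R[i]]_(m, n)) i j : `|M i j| <= `|M|.
Proof.
rewrite [leRHS]mx_normE -[leLHS]nngE num_le.
exact: (le_bigmax _ (fun k : 'I_m * 'I_n => `|M k.1 k.2|%:nng) (i, j)).
Qed.

Lemma mx_norm_le m n (M : 'M[R[i]]_(m, n)) (c : R) : 0 <= c ->
  (forall i j, nm (M i j) <= c) -> `|M| <= c%:C.
Proof.
move=> c0 h; have [E|n0] := eqVneq (mx_norm M) 0.
  by have -> : `|M| = 0 by []; rewrite (_ : 0 = 0%:C)// lecR.
have [[i j] e] := mx_norm_neq0 n0.
by rewrite [leLHS]e /= nmE lecR.
Qed.

Lemma cv_mxP T (F : set_system T) (FF : Filter F) m n (M : T -> 'M[R[i]]_(m, n))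
    (L : 'M[R[i]]_(m, n)) :
  M @ F --> L <-> forall i j, cv F (fun t : T => M t i j) (L i j).
Proof.
split=> [h i j|h].
  apply/cvP => e e0.
  have h1 : nbhs L [set N : 'M[R[i]]_(m, n) | nm (N i j - L i j) < e].
    apply: (@coord_continuous R[i] m n i j L [set u | nm (u - L i j) < e]).
    by apply/nbhs_nm; exists e.
  exact: h h1.
move=> P [Q /= hQ hP].
have h1 : \forall x \near F, forall ij : 'I_m * 'I_n, Q ij.1 ij.2 (M x ij.1 ij.2).
  apply: filter_forall => -[i j] /=.
  have /nbhs_nm [d d0 hd] := hQ i j.
  by have /cvP /(_ _ d0) := h i j; apply: filterS => x; exact: hd.
by apply: filterS h1 => x hx; apply: hP => i j; exact: (hx (i, j)).
Qed.

Lemma mx_hausdorff N : hausdorff_space 'M[R[i]]_N.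
Proof. exact: norm_hausdorff. Qed.

Lemma mx_derive1 N (F : R[i] -> 'M[R[i]]_N) z (D : 'M[R[i]]_N) :
  (forall i j, der (nb setT z) id z (fun x => F x i j) (D i j)) ->
  derive1 F z = D.
Proof.
move=> h; rewrite /derive1.
apply: (@cvg_lim _ (@mx_hausdorff N) _ _ _ _ D).
apply/cv_mxP => i j; have [q hq [d /= d0 hd]] := h i j.
apply/cv_within_nb; apply: (@cv_near _ _ _ _ (fun k => q (k + z))).
  exists d => //= k [k0 hk]; have {}k0 : k != 0 := k0.
  have hk' : nm (k + z - z) < d by rewrite addrK -[k]subr0.
  have := hd (k + z) (conj I hk'); rewrite /= addrK !mxE => ->.
  by rewrite mulrCA mulVf ?mulr1.
apply: (cv_comp hq (S := setT)); last exact: nearW.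
rewrite -[X in cv _ _ X]add0r; apply: cvD; last exact: cv_cst.
exact: cv_id.
Qed.

End Topology.

(** * Analyticity on the sphere, entry by entry *)

Section Analytic.
Context (R : realType) (N : nat).
Implicit Types (F : P1 R -> 'M[R[i]]_N) (p : P1 R).

Lemma series_entry (a : nat -> 'M[R[i]]_N) (h : R[i]) n (i j : 'I_N) :
  series (fun n => h ^+ n *: a n) n i j = psum (fun k => a k i j) n h.
Proof. by rewrite seriesEord /= summxE; apply: eq_bigr => k _; rewrite mxE. Qed.

Lemma analytic_entry F p (i j : 'I_N) : analytic_at F p ->
  exists (a : nat -> R[i]) (r : R), 0 < r /\
  forall h, nm h < r -> cv \oo (psum a ^~ h) (F (Defs.coord p h) i j).
Proof.
move=> [a [r [r0 h]]]; exists (fun k => a k i j), r; split => // k hk.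
have hk' : `|k| < r%:C by rewrite nmE ltcR.
have /cv_mxP /(_ i j) := h k hk'.
by apply: cv_near; apply: nearW => n; rewrite series_entry.
Qed.

Lemma analytic_of_entries F p :
  (forall i j : 'I_N, exists (a : nat -> R[i]) (r : R), 0 < r /\
    forall h, nm h < r -> cv \oo (psum a ^~ h) (F (Defs.coord p h) i j)) ->
  analytic_at F p.
Proof.
move=> H; pose Q (ij : 'I_N * 'I_N) (ar : (nat -> R[i]) * R) := 0 < ar.2 /\
  forall h, nm h < ar.2 -> cv \oo (psum ar.1 ^~ h) (F (Defs.coord p h) ij.1 ij.2).
have /choice [c hc] : forall ij, exists ar, Q ij ar.
  by move=> [i j]; have [a [r h]] := H i j; exists (a, r).
(* A common radius exists because there are finitely many entries. *)
have [r [r0 hr]] : exists r : R, 0 < r /\ forall ij, r < (c ij).2.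
  apply: (@filter_ex _ (0 : R)^'+); apply: filterI; first exact: nbhs_right_gt.
  apply: (@filter_forall R _ (fun ij r => r < (c ij).2) (0 : R)^'+) => ij.
  have [c0 _] := hc ij; exists (c ij).2 => // r /=.
  by rewrite sub0r normrN => hr r0; move: hr; rewrite gtr0_norm.
exists (fun k => \matrix_(i, j) (c (i, j)).1 k), r; split => // h.
rewrite nmE ltcR => hh; apply/cv_mxP => i j.
have [_ hq] := hc (i, j); have := hq h (lt_trans hh (hr (i, j))).
apply: cv_near; apply: nearW => n; rewrite series_entry.
by apply: eq_bigr => k _; rewrite mxE.
Qed.

Lemma analytic_C2near F z (i j : 'I_N) : analytic_at F (Some z) ->
  C2near (fun x => F (Some x) i j) z.
Proof. by move=> /(@analytic_entry _ _ i j) [a [r [r0 h]]]; exact: power_series_C2near h. Qed.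

Lemma Dminus_inv (w : R[i]) : w != 0 -> odisk w -> Dminus (Some w^-1).
Proof.
move=> w0 hw; rewrite /Dminus /mkset nm_gt1 nmV invf_gt1// nm_gt0//.
Qed.

Lemma analytic_C2near_inv F w (i j : 'I_N) : analytic_on (@Dminus R) F -> odisk w ->
  C2near (fun x => F (Defs.coord None x) i j) w.
Proof.
move=> hF hw; have [->|w0] := eqVneq w 0.
  (* At infinity analyticity is stated in the coordinate w itself; at the other points it is
     transported by inversion. *)
  have [a [r [r0 h]]] := analytic_entry i j (hF None I).
  by apply: (power_series_C2near r0) => k hk; rewrite add0r; exact: h.
have h := analytic_C2near i j (hF _ (Dminus_inv w0 hw)).
apply: (@C2near_eq _ (fun x => F (Some x^-1) i j) _ _ (nm w)); first by rewrite nm_gt0.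
  move=> y hy; rewrite /Defs.coord; case: eqP => // y0.
  by move: hy; rewrite y0 sub0r nmN ltxx.
exact: (C2near_inv w0 h).
Qed.

End Analytic.

(** * Hölder continuity on the sphere and nontangential limits *)

Section Holder.
Context (R : realType) (N : nat).

Lemma powR_small (a e : R) : 0 < a -> 0 < e ->
  exists2 d, 0 < d & forall x, 0 <= x -> x < d -> x `^ a < e.
Proof.
move=> a0 e0; exists (e `^ a^-1); first exact: powR_gt0.
move=> x x0 hx; have -> : e = (e `^ a^-1) `^ a.
  by rewrite -powRrM mulVf ?gt_eqF// powRr1// ltW.
by apply: gt0_ltr_powR => //; rewrite ?nnegrE ?in_itv /= ?x0 ?powR_ge0.
Qed.

Lemma holder_contc (E : set (P1 R)) (F : P1 R -> 'M[R[i]]_N) (g : R[i] -> P1 R)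
    (i j : 'I_N) :
  (forall z, cdisk z -> E (g z)) ->
  (forall y z, 0 <= chordal (g y) (g z) <= 2 * nm (y - z)) ->
  holder_on E F -> contc (fun z => F (g z) i j).
Proof.
move=> hg hc [a [k [/andP[a0 a1] h]]] z hz; apply/cvP => e e0.
have k0 : 0 < `|k| + 1 by have := normr_ge0 k; lra.
have [d d0 hd] := powR_small a0 (divr_gt0 e0 k0).
exists (d / 2) => [|y /= [cy hy]]; first by rewrite /= divr_gt0.
have /andP[c0 c1] := hc y z.
have := h _ _ (hg y cy) (hg z hz) => hn.
have := le_trans (mx_norm_entry _ i j) hn; rewrite !mxE nmE lecR => {}hn.
have cd' : chordal (g y) (g z) < d by apply: le_lt_trans c1 _; lra.
have hp := hd _ c0 cd'; move: hp; rewrite ltr_pdivlMr// => hp.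
have p0 := powR_ge0 (chordal (g y) (g z)) a.
have kk : k * chordal (g y) (g z) `^ a <= `|k| * chordal (g y) (g z) `^ a.
  by rewrite ler_wpM2r// ler_norm.
by apply: le_lt_trans hn _; apply: le_lt_trans kk _; nra.
Qed.

Let W (x : R[i]) : R := Num.sqrt (1 + nm x ^+ 2).
Let W1 x : 1 <= W x.
Proof. by rewrite -[leLHS]sqrtr1 ler_wsqrtr// lerDl sqr_ge0. Qed.
Let Wn x : nm x <= W x.
Proof.
by rewrite -[leLHS]ger0_norm ?nm_ge0// -sqrtr_sqr ler_wsqrtr// lerDr ler01.
Qed.

Lemma chordal_plus (y z : R[i]) : 0 <= chordal (Some y) (Some z) <= 2 * nm (y - z).
Proof.
have h1 := W1 y; have h2 := W1 z; have n0 := nm_ge0 (y - z).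
have ww : 1 <= W y * W z by rewrite mulr_ege1.
rewrite /chordal -/(W y) -/(W z); apply/andP; split.
  by rewrite divr_ge0 ?mulr_ge0//; lra.
by rewrite ler_pdivrMr; [nra|lra].
Qed.

Let chordal_infty (w : R[i]) : w != 0 -> 0 <= 2 / W w^-1 <= 2 * nm w.
Proof.
move=> w0; have h := Wn w^-1; have h1 := W1 w^-1.
apply/andP; split; first by rewrite divr_ge0//; lra.
rewrite ler_pdivrMr; last by lra.
have : nm w * nm w^-1 <= nm w * W w^-1 by rewrite ler_wpM2l ?nm_ge0.
rewrite -nmM divff// nm1; lra.
Qed.

(** |1/y - 1/z| = |y - z| |1/y| |1/z|, and |1/y| <= [W y^-1], so the factors that blow up near
    infinity cancel. *)
Lemma chordal_minus (y z : R[i]) :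
  0 <= chordal (Defs.coord None y) (Defs.coord None z) <= 2 * nm (y - z).
Proof.
rewrite /Defs.coord; have [->|y0] := eqVneq y 0; have [->|z0] := eqVneq z 0.
- by rewrite subrr nm0 mulr0 lexx.
- by rewrite sub0r nmN; exact: chordal_infty.
- by rewrite subr0; exact: chordal_infty.
rewrite /chordal -/(W _) -/(W _).
have h1 := W1 y^-1; have h2 := W1 z^-1; have h3 := Wn y^-1; have h4 := Wn z^-1.
have p : 0 < W y^-1 * W z^-1 by rewrite mulr_gt0//; lra.
apply/andP; split; first by apply: divr_ge0; [rewrite mulr_ge0 ?nm_ge0|exact: ltW].
rewrite ler_pdivrMr//.
have -> : nm (y^-1 - z^-1) = nm (y - z) * (nm y^-1 * nm z^-1).
  by rewrite -!nmM -nmN; congr nm; field; rewrite y0 z0.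
rewrite -mulrA ler_wpM2l// ler_wpM2l ?nm_ge0//.
by rewrite ler_pM ?nm_ge0.
Qed.

Lemma closure_plus (z : R[i]) : cdisk z -> (@Dplus R `|` @circle R) (Some z).
Proof.
rewrite /cdisk /mkset le_eqVlt => /orP[/eqP h|h].
  by right; exists z => //; apply/nm_eq1.
by left; rewrite /Dplus /mkset nm_lt1.
Qed.

Lemma closure_minus (w : R[i]) : cdisk w -> (@Dminus R `|` @circle R) (Defs.coord None w).
Proof.
move=> hw; rewrite /Defs.coord; case: eqP => [_|/eqP w0]; first by left.
move: (hw); rewrite /cdisk /mkset le_eqVlt => /orP[/eqP h|h].
  by right; exists w^-1 => //; apply/nm_eq1; rewrite nmV h invr1.
by left; exact: Dminus_inv.
Qed.

(** The radial points (1 + s e) xi satisfy |x - xi| = |1 - |x||, so they lie in the Stolz region of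
    aperture 1. Properness is what makes nontangential limits unique. *)
Lemma stolz_proper (D : set (P1 R)) (s : R) (xi : R[i]) : nm xi = 1 -> s = 1 \/ s = -1 ->
  (forall e : R, 0 < e -> e < 1 -> D (Some ((1 + s * e)%:C * xi))) ->
  ProperFilter (nb ((Some @^-1` D) `&` stolz xi 1) xi).
Proof.
move=> hxi hs hD; apply: Build_ProperFilter_ex => P [d /= d0 hP].
pose e := Num.min (d / 2) (1 / 2); have e0 : 0 < e by rewrite lt_min; apply/andP; split; lra.
have [e1 e2] : e <= d / 2 /\ e <= 1 / 2 by split; rewrite ge_min lexx ?orbT.
have dist : nm ((1 + s * e)%:C * xi - xi) = e.
  rewrite -[X in _ - X]mul1r -mulrBl -rmorphB nmM hxi mulr1 nmR addrAC subrr add0r normrM.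
  by rewrite (gtr0_norm e0); case: hs => ->; rewrite ?normrN normr1 mul1r.
exists ((1 + s * e)%:C * xi); apply: hP; split; last by rewrite dist; lra.
split; first by apply: hD => //; lra.
have se : -e <= s * e <= e by case: hs => ->; lra.
rewrite /stolz /mkset mul1r !nmE dist lecR.
have -> : 1 - (nm ((1 + s * e)%:C * xi))%:C = (1 - nm ((1 + s * e)%:C * xi))%:C.
  by rewrite rmorphB rmorph1.
rewrite nmR.
rewrite nmM hxi mulr1 nmR (@ger0_norm _ (1 + s * e)); last by lra.
rewrite opprD addNKr normrN normrM (gtr0_norm e0).
by case: hs => ->; rewrite ?normrN normr1 mul1r.
Qed.

Lemma nontangential_plus (Y : P1 R -> 'M[R[i]]_N) xi l (i j : 'I_N) (f : R[i] -> R[i]) :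
  nm xi = 1 -> contc f -> (forall z, odisk z -> Y (Some z) i j = f z) ->
  nontangential_limit (@Dplus R) Y xi l -> l i j = f xi.
Proof.
move=> hxi cf e h.
have PF : ProperFilter (nb ((Some @^-1` @Dplus R) `&` stolz xi 1) xi).
  apply: (@stolz_proper _ (-1)) => //; first by right.
  move=> d d0 d1; rewrite /Dplus /mkset nm_lt1 nmM hxi mulr1 nmR ger0_norm; lra.
apply: (@cv_unique _ _ _ PF (fun x => Y (Some x) i j)).
  by apply/cv_within_nb; have /cv_mxP := h 1; exact.
have hin : \forall x \near nb ((Some @^-1` @Dplus R) `&` stolz xi 1) xi, odisk x.
  by apply: filterS (nb_in _ _) => x [] /=; rewrite /Dplus /mkset nm_lt1.
apply: (@cv_near _ _ _ _ f); first by apply: filterS hin => x hx; rewrite e.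
have cxi : cdisk xi by rewrite /cdisk /mkset hxi.
by apply: (cv_comp (cf _ cxi) (cv_id _ _)); apply: filterS hin => x; exact: odisk_cdisk.
Qed.

Lemma nontangential_minus (Y : P1 R -> 'M[R[i]]_N) xi l (i j : 'I_N) (f : R[i] -> R[i]) :
  nm xi = 1 -> contc f -> (forall z, odisk z -> Y (Defs.coord None z) i j = f z) ->
  nontangential_limit (@Dminus R) Y xi l -> l i j = f xi^-1.
Proof.
move=> hxi cf e h.
have x0 : xi != 0 by rewrite -nm_gt0 hxi.
have PF : ProperFilter (nb ((Some @^-1` @Dminus R) `&` stolz xi 1) xi).
  apply: (@stolz_proper _ 1) => //; first by left.
  move=> d d0 d1; rewrite /Dminus /mkset nm_gt1 nmM hxi mulr1 nmR ger0_norm; lra.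
apply: (@cv_unique _ _ _ PF (fun x => Y (Some x) i j)).
  by apply/cv_within_nb; have /cv_mxP := h 1; exact.
have hin : \forall x \near nb ((Some @^-1` @Dminus R) `&` stolz xi 1) xi,
    x != 0 /\ odisk x^-1.
  apply: filterS (nb_in _ _) => x [] /=; rewrite /Dminus /mkset nm_gt1 => hx _.
  have px : 0 < nm x by apply: lt_trans hx.
  by rewrite -nm_gt0; split => //; rewrite /odisk /mkset nmV invf_lt1.
apply: (@cv_near _ _ _ _ (fun x => f x^-1)).
  apply: filterS hin => x [nx hx]; rewrite -e// /Defs.coord invr_eq0 (negbTE nx) invrK//.
have cxi : cdisk xi^-1 by rewrite /cdisk /mkset nmV hxi invr1.
apply: (cv_comp (cf _ cxi)).
  by apply: cvV => //; exact: cv_id.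
by apply: filterS hin => x [_]; exact: odisk_cdisk.
Qed.

End Holder.

(** * Real smoothness on the closed disk and on the circle *)

Section Smoothness.
Context (R : realType) (N : nat).

Lemma C1_closed_of_K (E : R[i] -> 'M[R[i]]_N) : entrywise (@K R) E -> C1_closed_disk E.
Proof.
move=> hE; have cdE z : @closed_disk R z = cdisk z.
  by rewrite /closed_disk /cdisk /mkset nm_le1.
have cdS : @closed_disk R = @cdisk R by apply/funext => z; rewrite cdE.
(* By the Cauchy-Riemann equations the two partial derivatives are f' and i f'. *)
exists (fun z => \matrix_(i, j) cd (fun z => E z i j) z),
  (fun z => \matrix_(i, j) ('i%C * cd (fun z => E z i j) z)).
rewrite cdS; split.
- apply/subspace_continuousP => z hz; apply/cv_mxP => i j; apply/cv_within_nb.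
  have [_] := hE i j z hz; rewrite mxE; apply: cv_near.
  by apply: nearW => y; rewrite mxE.
- apply/subspace_continuousP => z hz; apply/cv_mxP => i j; apply/cv_within_nb.
  have [_ h] := hE i j z hz; rewrite mxE.
  apply: (@cv_near _ _ _ _ (fun y => 'i%C * cd (fun z => E z i j) y)).
    by apply: nearW => y; rewrite mxE.
  by apply: cvM => //; exact: cv_cst.
move=> z hz e e0.
have H : \forall y \near nb (@cdisk R) z, forall ij : 'I_N * 'I_N,
    nm (E y ij.1 ij.2 - E z ij.1 ij.2 - (y - z) * cd (fun z => E z ij.1 ij.2) z)
      <= e * nm (y - z).
  apply: filter_forall => -[i j] /=.
  have [q /cvP /(_ _ e0) hq eq] := C1at_wder hz (hE i j z hz).
  apply: filterS2 hq eq => y h1 h2; rewrite h2 /= -(mulrC (cd _ z)) -mulrBl nmM.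
  by rewrite ler_wpM2r ?nm_ge0// ltW.
move/nb_within: H; apply: filterS => y H.
rewrite nmE -rmorphM /=; apply: mx_norm_le.
  by rewrite mulr_ge0 ?nm_ge0// ltW.
move=> i j; have h : nm (E y i j - E z i j - (y - z) * cd (fun z => E z i j) z) <=
  e * nm (y - z) := H (i, j).
move: h; rewrite !mxE.
set c := cd _ z; congr (nm _ <= _); rewrite -[RHS]addrA -opprD; congr (_ - _).
by rewrite {1}(complexE (y - z)); ring.
Qed.

Lemma Ck2_cder (b : R -> R[i]) : Ck 2 (fun t => complex.Re (b t)) ->
  Ck 2 (fun t => complex.Im (b t)) -> exists phi psi : R -> R[i],
  [/\ forall t, cder b t (phi t), forall t, cder phi t (psi t) & ccont psi].
Proof.
move=> [d1 c1] [d2 c2].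
exists (fun t => (fun t => complex.Re (b t))^`()%classic t +i* (fun t => complex.Im (b t))^`()%classic t).
exists (fun t => derive1n 2 (fun t => complex.Re (b t)) t +i* derive1n 2 (fun t => complex.Im (b t)) t).
have isd (f : R -> R) t : derivable f t 1 -> is_derive t 1 f (f^`()%classic t).
  by move=> h; rewrite derive1E; exact: derivableP.
split=> t.
- by apply: cder_ReIm; apply: isd; [exact: (d1 0%N)|exact: (d2 0%N)].
- by apply: cder_ReIm => /=; apply: isd; [exact: (d1 1%N)|exact: (d2 1%N)].
- by apply: cv_ReIm; [exact: c1|exact: c2].
Qed.

Lemma cder_Ck1 (b phi : R -> R[i]) : (forall t, cder b t (phi t)) -> ccont phi ->
  Ck 1 (fun t => complex.Re (b t)) /\ Ck 1 (fun t => complex.Im (b t)).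
Proof.
move=> h c; have aux (f g : R -> R) : (forall t : R, is_derive t 1 f (g t)) -> continuous g -> Ck 1 f.
  move=> hf cg; split.
    by case=> // _ t; case: (hf t).
  rewrite (_ : derive1n 1 f = g)//; apply/funext => t /=; rewrite derive1E.
  by case: (hf t).
split.
  by apply: (aux _ (fun t => complex.Re (phi t))) => [t|]; [exact: cder_Re|exact: ccont_Re].
by apply: (aux _ (fun t => complex.Im (phi t))) => [t|]; [exact: cder_Im|exact: ccont_Im].
Qed.

End Smoothness.

(** * The Birkhoff solution and its logarithmic derivative *)

Section Birkhoff.
Context (R : realType) (N : nat).
Implicit Types (Y Z F : P1 R -> 'M[R[i]]_N) (M L : R[i] -> 'M[R[i]]_N).

Definition dmx M z : 'M[R[i]]_N := \matrix_(i, j) cd (fun z => M z i j) z.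

Definition disk_plus Y (B : R[i] -> 'M[R[i]]_N) z : 'M[R[i]]_N :=
  if nm z < 1 then Y (Some z) else B z.

(* The variable w is the coordinate 1/x of the exterior of the circle. *)
Definition disk_minus Z (B : R[i] -> 'M[R[i]]_N) w : 'M[R[i]]_N :=
  if nm w < 1 then Z (Defs.coord None w) else B w^-1.

Lemma entry_if (b : bool) (A B : 'M[R[i]]_N) i j :
  (if b then A else B) i j = if b then A i j else B i j.
Proof. by case: b. Qed.

Lemma disk_plus_regular Y B : in_Lplus Y B ->
  [/\ entrywise (@K R) (disk_plus Y B), entrywise (@K R) (dmx (disk_plus Y B)) &
      forall z, cdisk z -> disk_plus Y B z \in unitmx].
Proof.
move=> [hY hu hb [hC hB]].
have H i j : K (fun z => disk_plus Y B z i j) /\ K (cd (fun z => disk_plus Y B z i j)).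
  have -> : (fun z => disk_plus Y B z i j) =
      fun z => if nm z < 1 then Y (Some z) i j else B z i j.
    by apply/funext => z; rewrite /disk_plus entry_if.
  have [cr ci] := hC i j.
  have [phi [psi [h1 h2 h3]]] := Ck2_cder (b := fun t => B (cis t) i j) cr ci.
  apply: (disk_loop (f := fun z => Y (Some z) i j) (b := fun z => B z i j) _ _ h1 h2 h3).
    by move=> z hz; apply: analytic_C2near; apply: hY; rewrite /Dplus /mkset nm_lt1.
  move=> z hz; have : unit_circle z by apply/nm_eq1.
  move=> /hb /cv_mxP /(_ i j) /cv_within_nb.
  have -> : Some @^-1` @Dplus R = @odisk R; last by [].
  by apply/funext => x; rewrite /odisk /preimage /Dplus /mkset /= nm_lt1.
split.
- by move=> i j; have [] := H i j.
- move=> i j; have [_] := H i j; apply: K_eq => z _; by rewrite mxE.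
move=> z hz; rewrite /disk_plus; case: ifP => h.
  by apply: hu; rewrite /Dplus /mkset nm_lt1.
by apply: hB; apply/nm_eq1/eqP; rewrite eq_le hz leNgt h.
Qed.

Lemma disk_minus_regular Z B : in_Lminus0 Z B ->
  [/\ entrywise (@K R) (disk_minus Z B), entrywise (@K R) (dmx (disk_minus Z B)) &
      forall z, cdisk z -> disk_minus Z B z \in unitmx].
Proof.
move=> [hZ hu hb [hC hB] _].
have H i j : K (fun z => disk_minus Z B z i j) /\ K (cd (fun z => disk_minus Z B z i j)).
  have -> : (fun z => disk_minus Z B z i j) =
      fun z => if nm z < 1 then Z (Defs.coord None z) i j else B z^-1 i j.
    by apply/funext => z; rewrite /disk_minus entry_if.
  have [cr ci] := hC i j.
  have [phi [psi [h1 h2 h3]]] := Ck2_cder (b := fun t => B (cis t) i j) cr ci.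
  (* In the coordinate w the boundary loop is t |-> B (cis (-t)), so each derivative brings a factor
     -1. The form 0 + t * -1 matches [cder_comp_affine]. *)
  pose phi' t := phi (0 + t * -1) * (-1)%:C.
  pose psi' t := psi (0 + t * -1) * (-1)%:C * (-1)%:C.
  apply: (disk_loop (f := fun z => Z (Defs.coord None z) i j) (b := fun z => B z^-1 i j)
    (phi := phi') (psi := psi')).
  - by move=> z hz; exact: analytic_C2near_inv.
  - move=> z hz; have z0 : z != 0 by rewrite -nm_gt0 hz.
    have : unit_circle z^-1 by apply/nm_eq1; rewrite nmV hz invr1.
    move=> /hb /cv_mxP /(_ i j) /cv_within_nb hc.
    have zn : \forall w \near nb (@odisk R) z, w != 0.
      exists 1 => [|w /= [_ hw]]; first exact: ltr01.
      by apply/eqP => w0; move: hw; rewrite w0 sub0r nmN hz ltxx.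
    apply: (@cv_near _ _ _ _ (fun w => Z (Some w^-1) i j)).
      by apply: filterS zn => w w0; rewrite /Defs.coord (negbTE w0).
    apply: (cv_comp hc); first by apply: cvV => //; exact: cv_id.
    by apply: filterS2 zn (nb_in _ _) => w w0 ow; exact: Dminus_inv.
  - move=> t; have -> : (fun t => B (cis t)^-1 i j) = fun t => B (cis (0 + t * -1)) i j.
      by apply/funext => s; rewrite add0r mulrC cisNV.
    exact: (@cder_comp_affine R (fun t => B (cis t) i j) 0 (-1)).
  - move=> t; have := derM (cv_real t) (cder_comp_affine (h2 (0 + t * -1)))
      (der_cst (fun s : R => s%:C) t ((-1)%:C)).
    by rewrite mulr0 addr0; exact.
  - apply: ccontM; last exact: ccont_cst.
    apply: ccontM; last exact: ccont_cst.
    move=> t; apply: (@cv_compR R _ _ _ (fun t => 0 + t * -1)); last exact: h3.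
    by apply: cvgD; [exact: cvg_cst|apply: cvgM; [exact: cvg_id|exact: cvg_cst]].
split.
- by move=> i j; have [] := H i j.
- move=> i j; have [_] := H i j; apply: K_eq => z _; by rewrite mxE.
move=> z hz; rewrite /disk_minus; case: ifP => h.
  apply: hu; rewrite /Defs.coord; case: eqP => // /eqP z0; exact: Dminus_inv.
apply: hB; apply/nm_eq1; rewrite nmV; apply/eqP; rewrite invr_eq1.
by rewrite eq_le hz leNgt h.
Qed.

Lemma A0_mulmx M L : entrywise (@A0 R) M -> entrywise (@A0 R) L ->
  entrywise (@A0 R) (fun z => M z *m L z).
Proof. by apply: closed_mulmx; [exact: A0_cst|exact: A0D|exact: A0M]. Qed.

Lemma K_mulmx M L : entrywise (@K R) M -> entrywise (@K R) L ->
  entrywise (@K R) (fun z => M z *m L z).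
Proof. by apply: closed_mulmx; [exact: Kcst|exact: KD|exact: KM]. Qed.

Lemma A0_of_C2near (f : R[i] -> R[i]) : (forall z, odisk z -> C2near f z) -> contc f -> A0 f.
Proof. by move=> h c; split=> // z oz; have [] := C2near_C1at oz (h z oz). Qed.

Section Solution.
Variables (G : R[i] -> 'M[R[i]]_N) (Y Y0 Z : P1 R -> 'M[R[i]]_N) (Yp Zm : R[i] -> 'M[R[i]]_N).
Hypotheses (hY0 : in_Lplus Y0 Yp) (hZ : in_Lminus0 Z Zm)
  (hG : forall xi, unit_circle xi -> G xi = invmx (Zm xi) *m Yp xi)
  (hY : birkhoff_solution G Y).

Let Yc := disk_plus Y0 Yp.
Let Zc := disk_minus Z Zm.

Lemma birkhoff_unique : (forall z, odisk z -> Y (Some z) = Yc z) /\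
  (forall w, odisk w -> Y (Defs.coord None w) = Zc w).
Proof.
have [KY _ uY] := disk_plus_regular hY0; have [KZ _ uZ] := disk_minus_regular hZ.
case: hY => anp anm [Fp [eFp hFp]] [Fm [eFm hFm]] jump Yinf.
have eFp' z : odisk z -> Fp (Some z) = Y (Some z).
  by move=> hz; apply: eFp; rewrite /Dplus /mkset nm_lt1.
have eFm' z : odisk z -> Fm (Defs.coord None z) = Y (Defs.coord None z).
  move=> hz; apply: eFm; rewrite /Defs.coord; case: eqP => // /eqP z0; exact: Dminus_inv.
have cp i j : contc (fun z => Fp (Some z) i j).
  by apply: (holder_contc (g := Some)) hFp => [z|y z]; [exact: closure_plus|exact: chordal_plus].
have cm i j : contc (fun w => Fm (Defs.coord None w) i j).
  by apply: (holder_contc (g := Defs.coord None)) hFm => [z|y z];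
    [exact: closure_minus|exact: chordal_minus].
have ball (z y : R[i]) : odisk z -> nm (y - z) < 1 - nm z -> odisk y.
  by rewrite /odisk /mkset => hz hy; have := nmD (y - z) z; rewrite subrK; lra.
have Ap : entrywise (@A0 R) (fun z => Fp (Some z)).
  move=> i j; apply: A0_of_C2near => // z hz.
  apply: (@C2near_eq _ (fun z => Y (Some z) i j) _ _ (1 - nm z)).
  - by rewrite subr_gt0.
  - by move=> y hy; rewrite eFp'//; exact: ball hy.
  - by apply: analytic_C2near; apply: anp; rewrite /Dplus /mkset nm_lt1.
have Am : entrywise (@A0 R) (fun w => Fm (Defs.coord None w)).
  move=> i j; apply: A0_of_C2near => // z hz.
  apply: (@C2near_eq _ (fun z => Y (Defs.coord None z) i j) _ _ (1 - nm z)).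
  - by rewrite subr_gt0.
  - by move=> y hy; rewrite eFm'//; exact: ball hy.
  - exact: analytic_C2near_inv.
pose Wp z := Fp (Some z) *m invmx (Yc z).
pose Wm w := Fm (Defs.coord None w) *m invmx (Zc w).
have AWp : entrywise (@A0 R) Wp.
  by apply: A0_mulmx => // i j; apply: K_A0; exact: K_invmx.
have AWm : entrywise (@A0 R) Wm.
  by apply: A0_mulmx => // i j; apply: K_A0; exact: K_invmx.
(* The nontangential limits are the values of the Hölder extensions, so Fp = Fm G on the circle;
   with G = Zm^-1 Yp this reads Fp Yp^-1 = Fm Zm^-1. *)
have glue t : Wp (cis t) = Wm (cis t)^-1.
  have nc : nm (cis t) = 1 by exact: nm_cis.
  have uc : unit_circle (cis t) by apply/nm_eq1.
  have [Lp [Lm [lp lm e]]] := jump _ uc.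
  have eLp : Lp = Fp (Some (cis t)).
    apply/matrixP => i j.
    by apply: (nontangential_plus nc (cp i j) _ lp) => z /eFp' ->.
  have eLm : Lm = Fm (Defs.coord None (cis t)^-1).
    apply/matrixP => i j.
    by apply: (nontangential_minus nc (cm i j) _ lm) => z /eFm' ->.
  have eYc : Yc (cis t) = Yp (cis t) by rewrite /Yc /disk_plus nc ltxx.
  have eZc : Zc (cis t)^-1 = Zm (cis t) by rewrite /Zc /disk_minus nmV nc invr1 ltxx invrK.
  have uYp : Yp (cis t) \in unitmx by rewrite -eYc; apply: uY; exact: cdisk_cis.
  rewrite /Wp /Wm -eLp -eLm eYc eZc e hG// -!mulmxA mulmxV// mulmx1//.
have Zc0 : Zc 0 = 1%:M.
  by rewrite /Zc /disk_minus nm0 ltr01 /Defs.coord eqxx; case: hZ.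
(* w = 0 is the point at infinity, where Y and Z are both the identity; this determines the
   constant. *)
have Wm0 : Wm 0 = 1%:M.
  have o0 : odisk (0 : R[i]) by rewrite /odisk /mkset nm0.
  by rewrite /Wm Zc0 eFm'// /Defs.coord eqxx Yinf mul1mx invmx1.
have gl z : odisk z -> Wp z = Wm 0 /\ Wm z = Wp 0.
  move=> hz; split; apply/matrixP => i j;
    have := glued_constant (AWp i j) (AWm i j) _ hz;
    by case=> // t; rewrite glue.
have o0 : odisk (0 : R[i]) by rewrite /odisk /mkset nm0.
have one (A B : 'M[R[i]]_N) : B \in unitmx -> A *m invmx B = 1%:M -> A = B.
  by move=> uB h; rewrite -[A]mulmx1 -(mulVmx uB) mulmxA h mul1mx.
have Wp1 : Wp 0 = 1%:M by rewrite (gl 0 o0).1.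
split=> z hz; have cz := odisk_cdisk hz.
  rewrite -eFp'//; apply: one; first exact: uY.
  by have := (gl z hz).1; rewrite Wm0.
rewrite -eFm'//; apply: one; first exact: uZ.
by have := (gl z hz).2; rewrite Wp1.
Qed.

Definition Eplus z := dmx Yc z *m invmx (Yc z).
(* At x = 1/w one has d/dx = - w^2 d/dw. *)
Definition Mminus w := dmx Zc w *m invmx (Zc w).
Definition Eminus w := (- w ^+ 2) *: Mminus w.

Lemma K_Eplus : entrywise (@K R) Eplus.
Proof.
have [KY KdY uY] := disk_plus_regular hY0.
by apply: K_mulmx => //; exact: K_invmx.
Qed.

Lemma K_Mminus : entrywise (@K R) Mminus.
Proof.
have [KZ KdZ uZ] := disk_minus_regular hZ.
by apply: K_mulmx => //; exact: K_invmx.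
Qed.

(** In d xi = i xi dt the factor xi = 1/w cancels one of the two factors w of [Eminus]; the
    remaining - w M(w) still vanishes at 0, which is what kills the integral of the jump. *)
Lemma K_scaled i j : K (fun w => - w * Mminus w i j).
Proof.
apply: KM; last exact: K_Mminus.
by apply: (K_eq (f := fun w => -1 * w)) => [w _|]; [rewrite mulN1r|apply: KM; [exact: Kcst|exact: K_id]].
Qed.

Lemma Eminus_entry w i j : Eminus w i j = w * (- w * Mminus w i j).
Proof. by rewrite mxE; ring. Qed.

Lemma K_Eminus : entrywise (@K R) Eminus.
Proof.
move=> i j; apply: (K_eq (f := fun w => w * (- w * Mminus w i j))) => [w _|].
  by rewrite Eminus_entry.
by apply: KM; [exact: K_id|exact: K_scaled].
Qed.

Lemma Eminus0 : Eminus 0 = 0.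
Proof. by rewrite /Eminus expr0n oppr0 scale0r. Qed.

Lemma der_odisk (f : R[i] -> R[i]) z d : odisk z -> wder (@cdisk R) f z d ->
  der (nb setT z) id z f d.
Proof.
move=> hz [q hq e]; have hz' : nm z < 1 := hz.
have sub : nb (@cdisk R) z `<=` nb setT z.
  have r0 : 0 < 1 - nm z by rewrite subr_gt0.
  have hin (y : R[i]) : nm (y - z) < 1 - nm z -> setT y -> cdisk y.
    by move=> hy _; have := nmD (y - z) z; rewrite subrK /cdisk /mkset; lra.
  exact: (nbS r0 hin).
exists q; last exact: sub e.
by apply/cvP => r r0; apply: sub; move/cvP: hq => /(_ _ r0).
Qed.

Lemma odisk_nearT (z : R[i]) : odisk z -> \forall y \near nb setT z, odisk y.
Proof.
move=> hz; have hz' : nm z < 1 := hz.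
exists (1 - nm z); first by rewrite /= subr_gt0.
by move=> y /= [_ hy]; have := nmD (y - z) z; rewrite subrK /odisk /mkset; lra.
Qed.

Lemma log_derivative_plus z : odisk z -> log_derivative Y (Some z) = Eplus z.
Proof.
move=> hz; have [eY _] := birkhoff_unique; have [KY _ _] := disk_plus_regular hY0.
rewrite /log_derivative /log_derivative_fin eY//; congr (_ *m _).
apply: mx_derive1 => i j; rewrite mxE.
apply: (@der_near _ _ _ _ _ _ (fun x => Yc x i j)); first by rewrite eY.
  by apply: filterS (odisk_nearT hz) => y hy; rewrite eY.
apply: der_odisk => //; apply: C1at_wder; first exact: odisk_cdisk.
by apply: KY; exact: odisk_cdisk.
Qed.

Lemma log_derivative_fin_minus w : w != 0 -> odisk w ->
  log_derivative_fin Y w^-1 = Eminus w.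
Proof.
move=> w0 hw; have [_ eY] := birkhoff_unique; have [KZ _ _] := disk_minus_regular hZ.
have eYs x : x != 0 -> odisk x^-1 -> Y (Some x) = Zc x^-1.
  by move=> x0 hx; rewrite -eY// /Defs.coord invr_eq0 (negbTE x0) invrK.
have wi : w^-1 != 0 by rewrite invr_eq0.
have hwi : odisk w^-1^-1 by rewrite invrK.
rewrite /log_derivative_fin eYs// invrK /Eminus scalemxAl; congr (_ *m _).
apply: mx_derive1 => i j; rewrite !mxE.
have cinv : cv (nb setT w^-1) (fun x => x^-1) w.
  by rewrite -[X in cv _ _ X]invrK; apply: cvV => //; exact: cv_id.
have near1 : \forall x \near nb setT w^-1, x != 0 /\ odisk x^-1.
  have /nb_lt : 0 < nm w^-1 by rewrite nm_gt0.
  move=> /(_ setT w^-1) h1.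
  have hw1 : 0 < 1 - nm w by rewrite subr_gt0.
  move/cvP: cinv => /(_ _ hw1) h2.
  apply: filterS2 h1 h2 => x h1 h2; split.
    by apply/eqP => x0; move: h1; rewrite x0 sub0r nmN ltxx.
  by have := nmD (x^-1 - w) w; rewrite subrK /odisk /mkset; lra.
apply: (@der_near _ _ _ _ _ _ (fun x => Zc x^-1 i j)); first by rewrite eYs.
  by apply: filterS near1 => x [x0 hx]; rewrite eYs.
have dz : der (nb setT w^-1^-1) id w^-1^-1 (fun w => Zc w i j) (cd (fun w => Zc w i j) w).
  rewrite invrK; apply: der_odisk => //; apply: C1at_wder; first exact: odisk_cdisk.
  by apply: KZ; exact: odisk_cdisk.
have di : der (nb setT w^-1) id w^-1 (fun x => x^-1) (- 1 / (w^-1) ^+ 2).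
  exact: (derV (cv_id setT w^-1) wi (der_self id w^-1)).
have nT : \forall x \near nb setT w^-1, setT (x^-1 : R[i]) by exact: nearW.
apply: (der_eq (der_comp (cv_id _ _) dz di nT)).
by rewrite exprVn invrK; ring.
Qed.

(** [Eminus] is continuous at w = 0 and vanishes there, so the [lim] that defines the value at
    infinity is an actual limit. *)
Lemma log_derivative_infty : log_derivative Y None = 0.
Proof.
apply: (@cvg_lim _ (@mx_hausdorff R N)).
apply/cv_mxP => i j; apply/cv_within_nb.
have c0 : cdisk (0 : R[i]) by rewrite /cdisk /mkset nm0.
apply: (@cv_near _ _ _ _ (fun w => Eminus w i j)).
  exists 1 => [|w /= [w0 hw]]; first exact: ltr01.
  by rewrite log_derivative_fin_minus// -[w]subr0.
rewrite -Eminus0; apply: (cv_comp (K_contc (K_Eminus i j) c0)); first exact: cv_id.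
exists 1 => [|w /= [w0 hw]]; first exact: ltr01.
by rewrite /cdisk /mkset -[w]subr0 ltW.
Qed.

Lemma log_derivative_minus w : odisk w -> log_derivative Y (Defs.coord None w) = Eminus w.
Proof.
move=> hw; rewrite /Defs.coord; case: eqP => [->|/eqP w0].
  by rewrite log_derivative_infty Eminus0.
exact: log_derivative_fin_minus.
Qed.

Lemma log_derivative_out x : 1 < nm x -> log_derivative Y (Some x) = Eminus x^-1.
Proof.
move=> hx; have x0 : x != 0 by rewrite -nm_gt0; apply: lt_trans hx.
rewrite -[in LHS](invrK x); apply: log_derivative_fin_minus; first by rewrite invr_eq0.
by rewrite /odisk /mkset nmV invf_lt1// (lt_trans ltr01).
Qed.

(** The Plemelj jump, interior minus exterior boundary value; the exterior one is expressed in w =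
    1/xi. *)
Definition jumpA xi := Eplus xi - Eminus xi^-1.

Lemma jumpA_entry xi i j : jumpA xi i j = Eplus xi i j - Eminus xi^-1 i j.
Proof. by rewrite !mxE. Qed.

Lemma cder_K_cis (f : R[i] -> R[i]) (a t : R) : K f ->
  cder (fun t => f (cis (a * t))) t (cd f (cis (a * t)) * (a%:C * 'i%C * cis (a * t))).
Proof.
move=> hf; apply: (der_comp (cv_real t) _ (cder_cisM a t)).
  exact: C1at_wder (cdisk_cis _) (hf _ (cdisk_cis _)).
by apply: nearW => s; exact: cdisk_cis.
Qed.

Lemma ccont_cd (f : R[i] -> R[i]) (a : R) : K f ->
  ccont (fun t => cd f (cis (a * t)) * (a%:C * 'i%C * cis (a * t))).
Proof.
move=> hf; apply: ccontM; last by apply: ccontM; [exact: ccont_cst|exact: ccont_cisM].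
apply: (ccont_path _ (ccont_cisM a)) => [z hz|t]; last exact: cdisk_cis.
by have [] := hf z hz.
Qed.

Lemma jumpA_C1 : Ck_circle 1 jumpA.
Proof.
move=> i j; have KE := K_Eplus i j; have KE' := K_Eminus i j.
set f := fun t => jumpA (cis t) i j.
have ef : f = fun t => Eplus (cis (1 * t)) i j - Eminus (cis (-1 * t)) i j.
  by apply/funext => t; rewrite /f jumpA_entry mul1r cisNV.
apply: (@cder_Ck1 R f (fun t => _ - _)).
  by move=> t; rewrite ef; apply: (derB (cder_K_cis 1 t KE) (cder_K_cis (-1) t KE')).
apply: ccontD; first exact: (ccont_cd 1 KE).
by apply: ccontN; exact: (ccont_cd (-1) KE').
Qed.

Lemma ccont_jump i j : ccont (fun t => jumpA (cis t) i j).
Proof.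
have -> : (fun t => jumpA (cis t) i j) =
    fun t => Eplus (cis (1 * t)) i j - Eminus (cis (-1 * t)) i j.
  by apply/funext => t; rewrite jumpA_entry mul1r cisNV.
apply: ccontD; first exact: (ccont_disk 1 (K_A0 (K_Eplus i j))).
apply: ccontN; exact: (ccont_disk (-1) (K_A0 (K_Eminus i j))).
Qed.

Let c := (2 * pi)%:C * 'i%C : R[i].
Let c0 : c != 0.
Proof.
apply: mulf_neq0; last exact: i_neq0.
by rewrite fmorph_eq0; apply: lt0r_neq0; have := pi_gt0 R; lra.
Qed.

Lemma cauchy_integral_entry x i j : nm x <> 1 ->
  cauchy_integral jumpA (Some x) i j =
  cI (fun t => (c^-1 * (jumpA (cis t) i j * ('i%C * cis t))) / (cis t - x)).
Proof.
move=> hx; rewrite /cauchy_integral /circle_integral !mxE -/c.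
have s0 t := cis_sub_neq0 t hx.
have cc : ccont (fun t => (cis t - x)^-1 * jumpA (cis t) i j * ('i%C * cis t)).
  apply: ccontM; last by apply: ccontM; [exact: ccont_cst|exact: ccont_cis].
  apply: ccontM; last exact: ccont_jump.
  apply: ccontV => //; apply: ccontD; [exact: ccont_cis|exact: ccont_cst].
transitivity (c^-1 * cI (fun t => (cis t - x)^-1 * jumpA (cis t) i j * ('i%C * cis t))).
  by congr (_ * _); apply: eq_cI => t _; rewrite !mxE.
by rewrite -cIZ//; apply: eq_cI => t _; ring.
Qed.

Lemma cauchy_integral_jump p : ~ circle p -> log_derivative Y p = cauchy_integral jumpA p.
Proof.
case: p => [x|_]; last first.
  rewrite log_derivative_infty; apply/matrixP => i j.
  rewrite /cauchy_integral /circle_integral !mxE -/c.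
  transitivity (c^-1 * cI (fun=> 0)); first by rewrite cI_cst !mulr0.
  by congr (_ * _); apply: eq_cI => t _; rewrite /cauchy_kernel scale0r mxE mul0r.
move=> hx; have {}hx : nm x <> 1.
  by move=> e; apply: hx; exists x => //; apply/nm_eq1.
apply/matrixP => i j; rewrite cauchy_integral_entry//.
have AE := K_A0 (K_Eplus i j); have AE' := K_A0 (K_Eminus i j).
have s0 t := cis_sub_neq0 t hx.
have ck : ccont (fun t => cis t / (cis t - x)).
  apply: ccontM; first exact: ccont_cis.
  apply: ccontV => //; apply: ccontD; [exact: ccont_cis|exact: ccont_cst].
have cp : ccont (fun t => Eplus (cis t) i j * (cis t / (cis t - x))).
  by apply: ccontM => //; apply: (ccont_path AE.2 (@ccont_cis R)) => t; exact: cdisk_cis.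
have cm : ccont (fun t => Eminus (cis t)^-1 i j * (cis t / (cis t - x))).
  by apply: ccontM; [exact: (ccont_disk_inv AE')|exact: ck].
transitivity (c^-1 * ('i%C * (cI (fun t => Eplus (cis t) i j * (cis t / (cis t - x))) -
    cI (fun t => Eminus (cis t)^-1 i j * (cis t / (cis t - x)))))); last first.
  rewrite -cIB// -cIZ; last by apply: ccontD => //; exact: ccontN.
  rewrite -cIZ; last first.
    by apply: ccontM; [exact: ccont_cst|apply: ccontD => //; exact: ccontN].
  by apply: eq_cI => t _; rewrite jumpA_entry; ring.
have e0 : Eminus 0 i j = 0 by rewrite Eminus0 mxE.
have fin (u : R[i]) : c^-1 * ('i%C * ((2 * pi)%:C * u)) = u.
  by rewrite (mulrCA 'i%C) [(2 * pi)%:C * _]mulrA mulKf.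
(* Inside, the exterior part contributes its value at w = 0, which is 0. Outside, the interior part
   contributes 0 and the subtracted exterior part gives Eminus (1/x) - Eminus 0. *)
have [hx1|hx1] := ltP (nm x) 1.
  rewrite log_derivative_plus// (cauchy_in AE hx1) (cauchy_in_inv AE' hx1) e0.
  by rewrite mulr0 subr0 fin.
have hx2 : 1 < nm x by rewrite lt_def hx1 andbT; apply/eqP.
rewrite log_derivative_out// (cauchy_out AE hx2) (cauchy_out_inv AE' hx2) e0.
by rewrite !sub0r [X in - X]mulrN opprK fin.
Qed.

(** Read off from the Cauchy integral by [cI_geometric]; the bound |1 - |x|| on the radius keeps x +
    h off the circle. *)
Lemma log_derivative_analytic x : nm x <> 1 -> analytic_at (log_derivative Y) (Some x).
Proof.
move=> hx; apply: analytic_of_entries => i j.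
pose al t := c^-1 * (jumpA (cis t) i j * ('i%C * cis t)).
have ca : ccont al.
  apply: ccontM; first exact: ccont_cst.
  by apply: ccontM; [exact: ccont_jump|apply: ccontM; [exact: ccont_cst|exact: ccont_cis]].
have [r r0 hr] := cI_geometric ca hx.
exists (fun k => cI (fun t => al t / (cis t - x) ^+ k.+1)), (Num.min r `|1 - nm x|).
split=> [|h]; first by rewrite lt_min r0 normr_gt0 subr_eq0 eq_sym; apply/eqP.
rewrite lt_min => /andP[h1 h2].
have hxh : nm (x + h) <> 1.
  move=> e; have := nm_dist (x + h) x; rewrite e addrAC subrr add0r => h3.
  by move: (le_lt_trans h3 h2); rewrite ltxx.
rewrite cauchy_integral_jump; last by move=> [z /nm_eq1 hz [e]]; apply: hxh; rewrite -e.
by rewrite cauchy_integral_entry//; exact: hr.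
Qed.

Lemma log_derivative_analytic_infty : analytic_at (log_derivative Y) None.
Proof.
apply: analytic_of_entries => i j; have AE' := K_A0 (K_Eminus i j).
have o0 : odisk (0 : R[i]) by rewrite /odisk /mkset nm0.
have [a [r [r0 hr]]] := A0_series AE' o0.
exists a, (Num.min r 1); split=> [|h]; first by rewrite lt_min r0 ltr01.
rewrite lt_min => /andP[h1 h2]; have := hr h h1.
by rewrite add0r log_derivative_minus.
Qed.

(** After d xi = i xi dt, both parts are mean values: of z Eplus(z) at z = 0, and of - w M(w) at w =
    0. Both functions vanish there. *)
Lemma circle_integral_jump : circle_integral jumpA = 0.
Proof.
apply/matrixP => i j; rewrite !mxE.
have AE := K_A0 (K_Eplus i j); have Ae := K_A0 (K_scaled i j).
have Az : A0 (fun z => z * Eplus z i j) by apply: A0M => //; exact: A0_id.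
have cp : ccont (fun t => cis t * Eplus (cis t) i j).
  by apply: (ccont_path Az.2 (@ccont_cis R)) => t; exact: cdisk_cis.
have cm : ccont (fun t => - (cis t)^-1 * Mminus (cis t)^-1 i j).
  exact: (ccont_disk_inv Ae).
transitivity ('i%C * (cI (fun t => cis t * Eplus (cis t) i j) -
    cI (fun t => - (cis t)^-1 * Mminus (cis t)^-1 i j))).
  rewrite -cIB// -cIZ; last by apply: ccontD => //; exact: ccontN.
  apply: eq_cI => t _; rewrite jumpA_entry Eminus_entry.
  have n0 := cis_neq0 t.
  set u := Eplus _ _ _; set v := Mminus _ _ _.
  by field; rewrite n0.
rewrite (mean_value_cis Az) (mean_value_inv Ae).
by rewrite !mul0r oppr0 !mul0r !mulr0 subrr mulr0.
Qed.

Lemma log_derivative_bigO : bigO_inv_sqr_at_infty (log_derivative Y).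
Proof.
have cz : cdisk (0 : R[i]) by rewrite /cdisk /mkset nm0.
(* The sum dominates all entries at once; the added 1 is the tolerance used below to choose d,
   within which [Mminus w] stays near [Mminus 0]. *)
pose k := \sum_(ij : 'I_N * 'I_N) (nm (Mminus 0 ij.1 ij.2) + 1).
have hk (ij : 'I_N * 'I_N) : nm (Mminus 0 ij.1 ij.2) + 1 <= k.
  rewrite /k (bigD1 ij)//= lerDl; apply: sumr_ge0 => l _.
  by rewrite addr_ge0 ?nm_ge0.
have k0 : 0 <= k by apply: sumr_ge0 => l _; rewrite addr_ge0 ?nm_ge0.
have [d /= d0 hd] : \forall w \near nb (@cdisk R) 0, forall ij : 'I_N * 'I_N,
    nm (Mminus w ij.1 ij.2 - Mminus 0 ij.1 ij.2) < 1.
  apply: filter_forall => -[i j] /=.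
  by have /cvP := K_contc (K_Mminus i j) cz; apply; exact: ltr01.
exists k, (Num.max 1 d^-1) => x.
rewrite nmE ltcR gt_max => /andP[x1 xd].
have px : 0 < nm x by apply: lt_trans x1.
rewrite log_derivative_out//.
have -> : k%:C / (nm x)%:C ^+ 2 = (k / nm x ^+ 2)%:C by rewrite fmorph_div rmorphXn.
apply: mx_norm_le; first by rewrite divr_ge0// exprn_ge0// ltW.
move=> i j; rewrite mxE nmM nmN nmX nmV exprVn mulrC ler_wpM2r//.
  by rewrite invr_ge0 exprn_ge0// ltW.
have hx1 : cdisk x^-1 by rewrite /cdisk /mkset nmV invf_le1// ltW.
have hx2 : nm (x^-1 - 0) < d by rewrite subr0 nmV invf_plt ?posrE.
have := hd x^-1 (conj hx1 hx2) (i, j); have := hk (i, j); rewrite /=.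
have := nmD (Mminus x^-1 i j - Mminus 0 i j) (Mminus 0 i j); rewrite subrK; lra.
Qed.

Lemma log_derivative_C1_plus : C1_extends_plus (log_derivative Y).
Proof.
exists (fun p => if p is Some z then Eplus z else 0); split; last first.
  by apply: C1_closed_of_K; exact: K_Eplus.
by case=> // z; rewrite /Dplus /mkset nm_lt1 => hz; rewrite log_derivative_plus.
Qed.

Lemma log_derivative_C1_minus : C1_extends_minus (log_derivative Y).
Proof.
exists (fun p => if p is Some x then Eminus x^-1 else Eminus 0); split.
  case=> [x|_]; last by rewrite log_derivative_infty Eminus0.
  by rewrite /Dminus /mkset nm_gt1 => hx; rewrite log_derivative_out.
have -> : (fun w => if Defs.coord None w is Some x then Eminus x^-1 else Eminus 0) = Eminus.
  by apply/funext => w; rewrite /Defs.coord; case: eqP => [->|_] //; rewrite invrK.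
by apply: C1_closed_of_K; exact: K_Eminus.
Qed.

End Solution.
End Birkhoff.

Theorem proposition1p1 (R : realType) (N : nat) (G : R[i] -> 'M[R[i]]_N)
    (Y : P1 R -> 'M[R[i]]_N)
    (hG : in_Ltilde G) (hY : birkhoff_solution G Y) :
  exists A : R[i] -> 'M[R[i]]_N,
    [/\ Ck_circle 1 A,
        forall p : P1 R, ~ circle p ->
          log_derivative Y p = cauchy_integral A p,
        analytic_on (@Dplus R) (log_derivative Y) /\
        analytic_on (@Dminus R) (log_derivative Y),
        C1_extends_plus (log_derivative Y) /\
        C1_extends_minus (log_derivative Y) &
        circle_integral A = 0 /\
        (circle_integral A = 0 <->
         bigO_inv_sqr_at_infty (log_derivative Y))].
Proof.
have [_ [Y0 [Z [Yp [Zm [hY0 hZ eG]]]]]] := hG.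
exists (jumpA Y0 Z Yp Zm); split.
- exact: jumpA_C1 hY0 hZ.
- by move=> p; exact: (cauchy_integral_jump hY0 hZ eG hY).
- split=> [[x|//]|[x|_]].
  + rewrite /Dplus /mkset nm_lt1 => hx; apply: (log_derivative_analytic hY0 hZ eG hY).
    by move=> e; move: hx; rewrite e ltxx.
  + rewrite /Dminus /mkset nm_gt1 => hx; apply: (log_derivative_analytic hY0 hZ eG hY).
    by move=> e; move: hx; rewrite e ltxx.
  + exact: (log_derivative_analytic_infty hY0 hZ eG hY).
- split; first exact: (log_derivative_C1_plus hY0 hZ eG hY).
  exact: (log_derivative_C1_minus hY0 hZ eG hY).
split; first exact: circle_integral_jump hY0 hZ.
(* Both sides of the equivalence hold, so each implication is settled by its conclusion. *)
split=> _; first exact: (log_derivative_bigO hY0 hZ eG hY).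
exact: circle_integral_jump hY0 hZ.
Qed.
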